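(* Assume the setting in the context. Let $f\in L^2(0,T;H)$, let $U^0=(u^0,w^0)\in V\times\mathcal M$ satisfy $u^0-w^0(r)\in K_r$ for $\mu$-a.e. $r$, and let $U_h^0=(u_h^0,w_h^0)\in\mathcal C_h$. Let $U=(u,w)$ solve $U_t+\partial\Psi(U)\ni F$ in $\mathcal H$ for a.e. $t\in(0,T)$, $U(0)=U^0$, and let $U_h=(u_h,w_h)$ solve $U_{h,t}+\partial\Psi_h(U_h)\ni F$ in $\mathcal H$ for a.e. $t\in(0,T)$, $U_h(0)=U_h^0$, where $F=(f/\kappa,0)$. Then $$\max_{t\in[0,T]}\left[\kappa\|u(t)-u_h(t)\|^2+\|w(t)-w_h(t)\|_{\mathcal M}^2\right]+\int_0^T\|\nabla(u-u_h)\|^2\,dt\le C\left(\kappa\|u^0-u_h^0\|^2+\|w^0-w_h^0\|_{\mathcal M}^2+h^2\mathcal M_{\mathrm{sp}}^2\right),$$ where $$\mathcal M_{\mathrm{sp}}:=\sqrt\Lambda\,\|u\|_{L^2(0,T;H^2(\Omega))}+\|f\|_{L^2(0,T;H)}+\sqrt\Lambda\,\|\nabla u_h^0\|,\qquad \Lambda:=\kappa+S_c,$$ and the constant $C$ depends only on $C_{\rm app}$.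
   Context: $\Omega\subset\mathbb R^d$ is a bounded convex polygonal or polyhedral domain (so $v\in V$, $\Delta v\in H$ implies $v\in H^2(\Omega)$ with $\|v\|_{H^2(\Omega)}\le C_{\rm ell}\|\Delta v\|$), $T>0$, $H=L^2(\Omega)$ (real) with inner product $(\cdot,\cdot)_H$ and norm $\|\cdot\|$ (also used for vector fields), $V=H_0^1(\Omega)$ with $\|v\|_V=\|\nabla v\|$. Constitutive data: $(\mathcal R,\mathcal A,\mu)$ is a complete finite measure space with $\mu\ge 0$; $a\ge0$ and $\kappa:=1+a$; $c:\mathcal R\to(0,\infty)$ is measurable with $S_c:=\int_{\mathcal R}c\,d\mu<\infty$; for each $r\in\mathcal R$, $K_r\subset H$ is closed and convex with $0\in K_r$; and $\{(r,z)\in\mathcal R\times H: z\in K_r\}\in\mathcal A\otimes\mathcal B(H)$, where $\mathcal B(H)$ is the Borel $\sigma$-algebra. $\mathcal M:=L^2(\mathcal R,c\,d\mu;H)$ (Bochner space) with inner product $\langle z_1,z_2\rangle_{\mathcal M}=\int_{\mathcal R}c(r)(z_1(r),z_2(r))_H\,d\mu(r)$. $\mathcal H:=H\times\mathcal M$ with inner product $\langle(u,w),(v,z)\rangle_{\mathcal H}=\kappa(u,v)_H+\langle w,z\rangle_{\mathcal M}$. $\mathcal C=\{(u,w)\in\mathcal H: u-w(r)\in K_r\text{ for }\mu\text{-a.e. }r\}$; $\Psi(u,w)=\frac12\|\nabla u\|^2$ if $u\in V$ and $(u,w)\in\mathcal C$, $+\infty$ otherwise. $(V_h)_{0<h\le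 h_0}$ is a family of finite-dimensional subspaces of $V$; $\mathcal C_h=\mathcal C\cap(V_h\times\mathcal M)$; $\Psi_h(u,w)=\frac12\|\nabla u\|^2$ if $(u,w)\in\mathcal C_h$, $+\infty$ otherwise. $\partial\Psi,\partial\Psi_h$ are the convex subdifferentials in $\mathcal H$ with respect to $\langle\cdot,\cdot\rangle_{\mathcal H}$. Solutions of both flows are understood in $H^1(0,T;\mathcal H)$; they exist and are unique, and $\Delta u\in L^2(0,T;H)$. $R_h:V\to V_h$ is the Ritz projection, $(\nabla R_hv,\nabla z_h)_H=(\nabla v,\nabla z_h)_H$ for all $z_h\in V_h$. It is assumed that there is $C_{\rm app}>0$, independent of $h$ and $v$, with $\|v-R_hv\|+h\|\nabla(v-R_hv)\|\le C_{\rm app}h^2\|v\|_{H^2(\Omega)}$ for all $v\in V\cap H^2(\Omega)$ and $\|v-R_hv\|\le C_{\rm app}h\|v\|_V$ for all $v\in V$. *)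

(* Defs.v *)
From HB Require Import structures.
From mathcomp Require Import all_boot all_order all_algebra.
From mathcomp Require Import all_classical all_reals all_analysis.
From mathcomp Require Import measurable_realfun.

Set Implicit Arguments.
Unset Strict Implicit.
Unset Printing Implicit Defensive.

Import Order.TTheory GRing.Theory Num.Theory.
Import numFieldNormedType.Exports.

Local Open Scope classical_set_scope.
Local Open Scope ring_scope.

(* The product sigma-algebra on ['rV[R]_d], which is its Borel sigma-algebra. *)
Section measurable_rV.
Variables (R : realType) (d : nat).

Definition rV_coord (i : 'I_d) (x : 'rV[R]_d) : R := x ord0 i.

HB.instance Definition _ := @isMeasurable.Build
  (measure_tuple_display default_measure_display) 'rV[R]_d
  (g_sigma_preimage rV_coord) (@sigma_algebra0 _ setT _)
  (@sigma_algebraC _ _) (@sigma_algebra_bigcup _ setT _).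

Lemma measurable_rV_coord (i : 'I_d) : measurable_fun setT (rV_coord i).
Proof.
move=> _ Y mY; rewrite setTI; apply: sub_sigma_algebra => /=.
rewrite -bigcup_seq/=; exists i => /=; first by rewrite mem_index_enum.
by exists Y => //; rewrite setTI.
Qed.

Lemma measurable_fun_rV d' (T : measurableType d') (f : T -> 'rV[R]_d) :
  (forall i, measurable_fun setT (rV_coord i \o f)) -> measurable_fun setT f.
Proof.
move=> mf.
have sub : \big[setU/set0]_(i < d)
    preimage_set_system setT (rV_coord i) measurable `<=`
    [set A | measurable (f @^-1` A)].
  move=> A; rewrite -bigcup_seq => -[i _ [B mB <-]] /=.
  by have := mf i measurableT B mB; rewrite !setTI.
move=> _ Y mY; rewrite setTI.
apply: (@smallest_sub _ (sigma_algebra setT) _ [set A | measurable (f @^-1` A)]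
  _ sub Y mY).
split => [|A mA|F mF] /=.
- by rewrite preimage_set0.
- by rewrite setTD preimage_setC; apply: measurableC.
- by rewrite preimage_bigcup; apply: bigcup_measurable => k _; exact: mF.
Qed.

End measurable_rV.

Section lebesgue_rV.
Variable R : realType.

Definition cons_rV (d : nat) (p : measurableTypeR R * 'rV[R]_d) : 'rV[R]_d.+1 :=
  \row_i if unlift ord0 i is Some j then p.2 ord0 j else p.1.

Lemma measurable_cons_rV d : measurable_fun setT (@cons_rV d).
Proof.
apply: measurable_fun_rV => i.
rewrite (_ : _ \o _ = fun p : measurableTypeR R * 'rV[R]_d =>
    if unlift ord0 i is Some j then rV_coord j p.2 else p.1); last first.
  by apply/funext => p; rewrite /rV_coord /= mxE.
case: unliftP => [j _|_]; last exact: measurable_fst.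
by apply: measurableT_comp measurable_snd; exact: measurable_rV_coord.
Qed.

Section step.
Variables (d : nat) (m : {sigma_finite_measure set 'rV[R]_d -> \bar R}).

Definition lebesgue_rV_step : set 'rV[R]_d.+1 -> \bar R :=
  pushforward (@lebesgue_measure R \x m)%E (@cons_rV d).

Let step0 : lebesgue_rV_step set0 = 0%E.
Proof. by rewrite /lebesgue_rV_step /pushforward preimage_set0 measure0. Qed.

Let step_ge0 A : (0 <= lebesgue_rV_step A)%E.
Proof. by rewrite /lebesgue_rV_step /pushforward; exact: measure_ge0. Qed.

Let step_sigma_additive : semi_sigma_additive lebesgue_rV_step.
Proof.
pose nu := [the {measure set _ -> \bar R} of (@lebesgue_measure R \x m)%E].
move=> F mF tF mUF; rewrite /lebesgue_rV_step /pushforward preimage_bigcup.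
have mc := @measurable_cons_rV d.
apply: (@measure_semi_sigma_additive _ _ _ nu).
- by move=> n; rewrite -[X in measurable X]setTI; exact: mc.
- apply/trivIsetP => /= i j _ _ ij; rewrite -preimage_setI.
  by move/trivIsetP : tF => /(_ _ _ _ _ ij) ->//; rewrite preimage_set0.
- by rewrite -preimage_bigcup -[X in measurable X]setTI; exact: mc.
Qed.

HB.instance Definition _ := isMeasure.Build _ _ _ lebesgue_rV_step
  step0 step_ge0 step_sigma_additive.

Let step_sigma_finite : sigma_finite setT lebesgue_rV_step.
Proof.
have [F TF Ffin] : sigma_finite setT (@lebesgue_measure R \x m)%E.
  have /sigma_finiteP[F [TF ndF Foo]] := sigma_finiteT (@lebesgue_measure R).
  have /sigma_finiteP[G [TG ndG Goo]] := sigma_finiteT m.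
  exists (fun n => F n `*` G n).
    rewrite -setXTT TF TG predeqE => -[x y]; split.
      move=> [/= [n _ Fnx] [k _ Gky]]; exists (maxn n k) => //; split.
      - by move: x Fnx; exact/subsetPset/ndF/leq_maxl.
      - by move: y Gky; exact/subsetPset/ndG/leq_maxr.
    by move=> [n _ []/= ? ?]; split; exists n.
  move=> k; have [? ?] := Foo k; have [? ?] := Goo k.
  split; first exact: measurableX.
  by rewrite product_measure1E// lte_mul_pinfty// ge0_fin_numE.
pose tl (x : 'rV[R]_d.+1) : measurableTypeR R * 'rV[R]_d :=
  (x ord0 ord0, \row_j x ord0 (lift ord0 j)).
have tlK : cancel (@cons_rV d) tl.
  move=> [a x]; rewrite /tl /cons_rV mxE unlift_none; congr pair.
  by apply/rowP => j; rewrite !mxE liftK.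
have mtl : measurable_fun setT tl.
  apply/measurable_fun_pairP; split; first exact: (@measurable_rV_coord R _ ord0).
  apply: measurable_fun_rV => j.
  rewrite (_ : _ \o _ = rV_coord (lift ord0 j)); first exact: measurable_rV_coord.
  by apply/funext => x; rewrite /= /rV_coord mxE.
exists (fun n => tl @^-1` F n).
  by rewrite -preimage_bigcup -TF preimage_setT.
move=> n; have [mF Foo] := Ffin n; split.
  by rewrite -[X in measurable X]setTI; exact: mtl.
rewrite /lebesgue_rV_step /pushforward -comp_preimage.
by rewrite (_ : tl \o _ = id) //; apply/funext => x /=; rewrite tlK.
Qed.

HB.instance Definition _ := @Measure_isSigmaFinite.Build _ _ _ lebesgue_rV_step
  step_sigma_finite.

End step.

Lemma dirac_rV0_sigma_finite : sigma_finite setT (@dirac _ 'rV[R]_0 0 R).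
Proof.
exists (fun=> setT); first by rewrite bigcup_const.
by move=> _; split => //; rewrite diracT ltry.
Qed.

Definition dirac_rV0 : set 'rV[R]_0 -> \bar R := @dirac _ 'rV[R]_0 0 R.
HB.instance Definition _ := Measure.on dirac_rV0.
HB.instance Definition _ := @Measure_isSigmaFinite.Build _ _ _ dirac_rV0
  dirac_rV0_sigma_finite.

Fixpoint lebesgue_rV (d : nat) : {sigma_finite_measure set 'rV[R]_d -> \bar R} :=
  match d with
  | 0%N => [the {sigma_finite_measure set 'rV[R]_0 -> \bar R} of dirac_rV0]
  | d'.+1 => [the {sigma_finite_measure set 'rV[R]_d'.+1 -> \bar R} of
               lebesgue_rV_step (lebesgue_rV d')]
  end.

End lebesgue_rV.

(* Finite intersections of open half-spaces, hence open and convex. *)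
Record polytope (R : realType) (d : nat) := Polytope {
  pdomain :> set 'rV[R]_d ;
  pdomain_neq0 : pdomain !=set0 ;
  pdomain_bounded : bounded_set pdomain ;
  pdomain_halfspaces : exists (n : nat) (A : 'M[R]_(n, d)) (b : 'I_n -> R),
    pdomain = [set x | forall i, \sum_j A i j * x ord0 j < b i]
}.

Section L2.
Variables (R : realType) (d : nat) (Om : polytope R d).

Lemma measurable_polytope : measurable (Om : set 'rV[R]_d).
Proof.
have [n [A [b ->]]] := pdomain_halfspaces Om.
suff : measurable (\bigcap_(i in [set: 'I_n])
    [set x : 'rV[R]_d | \sum_j A i j * rV_coord j x < b i]).
  congr measurable; apply/seteqP.
  by split => x /= xA i; [exact: xA|move=> _; exact: xA].
apply: fin_bigcap_measurable => //= i _.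
have mf : measurable_fun setT (fun x : 'rV[R]_d => \sum_j A i j * rV_coord j x).
  apply: measurable_sum => j; apply: measurable_funM => //.
  exact: measurable_rV_coord.
have := mf measurableT _ (measurable_itv `]-oo, (b i)[).
rewrite setTI; congr measurable; apply/seteqP.
Qed.

Definition vol := mrestr (@lebesgue_rV R d) measurable_polytope.
HB.instance Definition _ := Measure.on vol.

(* Representatives: functions, not classes modulo a.e. equality. *)
Definition L2 := LfunType vol (lee1n 2).

End L2.

Section L2_instances.
Variables (R : realType) (d : nat) (Om : polytope R d).
HB.instance Definition _ := GRing.Lmodule.on (L2 Om).
HB.instance Definition _ := isPointed.Build (L2 Om) 0.
End L2_instances.

(* A real Hilbert space is given by a set [hin] of representatives and a
   positive semidefinite form [hip] on it; elements at distance 0 are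
   identified, so every notion below is phrased through [hip] only. *)
Record hspace (R : realType) (E : lmodType R) := HSpace {
  hin : set E ;
  hip : E -> E -> R
}.

Section hspace_theory.
Variables (R : realType) (E : lmodType R) (X : hspace E).

Definition hnorm (x : E) : R := Num.sqrt (hip X x x).

Definition hopen (A : set E) :=
  forall x, A x -> exists2 e, 0 < e & forall y, hnorm (y - x) < e -> A y.

Definition hclosed (A : set E) := hopen (~` A).

Definition subdifferential (Psi : E -> \bar R) (x : E) : set E :=
  [set xi | [/\ hin X x, hin X xi &
    forall y, hin X y -> (Psi x + (hip X xi (y - x))%:E <= Psi y)%E]].

Section bochner.
Context dT (T : measurableType dT).
Variables (nu : {measure set T -> \bar R}) (D : set T).

Definition simple (s : T -> E) :=
  [/\ finite_set (range s), (forall t, hin X (s t)) &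
      forall y, measurable (s @^-1` [set y])].

Definition strongly_measurable (f : T -> E) :=
  exists2 s : (T -> E)^nat, (forall n, simple (s n)) &
    {ae nu, forall t, D t -> hnorm (s n t - f t) @[n --> \oo] --> 0}.

(* Membership in the Bochner space L^2(D, c d nu; X), for a weight c > 0. *)
Definition bochnerL2 (c : T -> R) (f : T -> E) :=
  [/\ (forall t, D t -> hin X (f t)), strongly_measurable f &
      (\int[nu]_(t in D) (c t * hnorm (f t) ^+ 2)%:E < +oo)%E].

(* [y] is the Bochner integral of [f] over [D], where [nu D < +oo]. *)
Definition bochner_integral (f : T -> E) (y : E) :=
  exists s : (T -> E)^nat, [/\ (forall n, simple (s n)),
    (\int[nu]_(t in D) (hnorm (s n t - f t))%:E)%E @[n --> \oo] --> 0%E &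
    hnorm (\sum_(z \in range (s n)) fine (nu (D `&` s n @^-1` [set z])) *: z - y)
      @[n --> \oo] --> 0].

End bochner.

Local Notation leb := (@lebesgue_measure R).

(* [U] is the continuous representative of an element of H^1(0,T;X) whose
   derivative is represented by [U']. *)
Definition H1_time (T : R) (U U' : R -> E) :=
  [/\ (forall t, t \in `[0, T] -> hin X (U t)),
      bochnerL2 leb `]0, T[ (cst 1) U' &
      forall t, t \in `[0, T] -> bochner_integral leb `]0, t[ U' (U t - U 0)].

(* [U] solves [U' + subdifferential Psi U \ni F], [U 0 = U0]. *)
Definition gradient_flow (T : R) (Psi : E -> \bar R) (F : R -> E) (U0 : E)
    (U : R -> E) :=
  exists U' : R -> E, [/\ H1_time T U U', hnorm (U 0 - U0) = 0 &
    {ae leb, forall t, t \in `]0, T[ ->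
       subdifferential Psi (U t) (F t - U' t)}].

End hspace_theory.

Section sobolev.
Variables (R : realType) (d : nat) (Om : polytope R d).
Local Notation H := (L2 Om).

Definition pderiv (i : 'I_d) (phi : 'rV[R]_d -> R) : 'rV[R]_d -> R :=
  'D_(delta_mx ord0 i) phi.

Fixpoint Ck (k : nat) (phi : 'rV[R]_d -> R) : Prop :=
  match k with
  | 0%N => continuous phi
  | k'.+1 => continuous phi /\ forall i,
      (forall x, derivable phi x (delta_mx ord0 i)) /\ Ck k' (pderiv i phi)
  end.

Definition testfun (phi : 'rV[R]_d -> R) :=
  (forall k, Ck k phi) /\
  exists K : set 'rV[R]_d,
    [/\ compact K, K `<=` Om & forall x, ~ K x -> phi x = 0].

Definition L2space : hspace H :=
  {| hin := setT ; hip := fun u v : H => \int[vol Om]_x (u x * v x) |}.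


Definition is_wpartial (i : 'I_d) (v g : H) :=
  forall phi, testfun phi ->
    \int[vol Om]_x (v x * pderiv i phi x) = - \int[vol Om]_x (g x * phi x).

(* [0] when [v] has no weak derivative in L^2; unique up to null sets. *)
Definition wpartial (i : 'I_d) (v : H) : H := xget 0 [set g | is_wpartial i v g].

Definition grad_ip (u v : H) : R :=
  \sum_i hip L2space (wpartial i u) (wpartial i v).

Definition grad_norm (v : H) : R := Num.sqrt (grad_ip v v).

Definition sobH1 : set H := [set v | forall i, exists g, is_wpartial i v g].

(* The closure of the test functions in [sobH1]. *)
Definition sobH10 : set H := [set v | sobH1 v /\
  exists2 phi : ('rV[R]_d -> R)^nat, (forall n, testfun (phi n)) &
    (\int[vol Om]_x ((phi n x - v x) ^+ 2)%:E)%E @[n --> \oo] --> 0%E /\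
    forall i, (\int[vol Om]_x ((pderiv i (phi n) x - wpartial i v x) ^+ 2)%:E)%E
      @[n --> \oo] --> 0%E].

Definition sobH2 : set H := [set v | sobH1 v /\ forall i, sobH1 (wpartial i v)].

Definition H2_norm (v : H) : R :=
  Num.sqrt (hnorm L2space v ^+ 2 + grad_norm v ^+ 2 +
            \sum_i grad_norm (wpartial i v) ^+ 2).

Definition H2_enorm (v : H) : \bar R :=
  if `[< sobH2 v >] then (H2_norm v)%:E else +oo%E.

(* The distributional Laplacian of [v] is represented by [g]. *)
Definition is_laplacian (v g : H) :=
  forall phi, testfun phi ->
    \int[vol Om]_x (v x * \sum_i pderiv i (pderiv i phi) x) =
    \int[vol Om]_x (g x * phi x).

Definition elliptic_regularity (Cell : R) :=
  forall v g, sobH10 v -> is_laplacian v g ->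
    sobH2 v /\ H2_norm v <= Cell * hnorm L2space g.

(* [W] is closed under a.e. equality: it stands for a subspace of classes. *)
Definition findim_subspace (W : set H) :=
  exists (n : nat) (e : 'I_n -> H), W =
    [set v | exists a : 'I_n -> R, hnorm L2space (v - \sum_i a i *: e i) = 0].

Definition is_ritz (W : set H) (P : H -> H) :=
  forall v, sobH10 v -> W (P v) /\ forall z, W z -> grad_ip (P v) z = grad_ip v z.

End sobolev.

Section flow.
Variables (R : realType) (d : nat) (Om : polytope R d).
Context dX (X : measurableType dX) (mu : {finite_measure set X -> \bar R}).
Variables (a : R) (c : X -> R) (K : X -> set (L2 Om)).
Local Notation H := (L2 Om).

Definition kappa : R := 1 + a.

Definition Sc : R := \int[mu]_r c r.

Definition Mspace : hspace (X -> H) :=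
  {| hin := bochnerL2 (L2space Om) mu setT c ;
     hip := fun w z => \int[mu]_r (c r * hip (L2space Om) (w r) (z r)) |}.

Definition Hspace : hspace (H * (X -> H))%type :=
  {| hin := [set U | hin Mspace U.2] ;
     hip := fun U V => kappa * hip (L2space Om) U.1 V.1 + hip Mspace U.2 V.2 |}.

(* The Borel sigma-algebra of H is that of the L^2 seminorm topology. *)
Definition measurable_graph :=
  measurable [set p : X * g_sigma_algebraType (hopen (L2space Om)) | K p.1 p.2].

Definition constraint : set (H * (X -> H)) :=
  [set U | hin Hspace U /\ {ae mu, forall r, K r (U.1 - U.2 r)}].

Definition energy (C : set (H * (X -> H))) (U : H * (X -> H)) : \bar R :=
  if `[< sobH10 U.1 /\ C U >] then (2^-1 * grad_norm U.1 ^+ 2)%:E else +oo%E.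

Definition Psi := energy constraint.

Definition Psi_h (Vh : set H) := energy [set U | constraint U /\ Vh U.1].

End flow.

Section bound.
Variables (R : realType) (d : nat) (Om : polytope R d).
Local Notation leb := (@lebesgue_measure R).

(* sqrt Lam * |u|_{L^2(0,T;H^2)} + |f|_{L^2(0,T;L^2)} + sqrt Lam * |grad uh0|,
   where the first norm is +oo if u is not in L^2(0,T;H^2). *)
Definition Msp (T Lam : R) (u f : R -> L2 Om) (uh0 : L2 Om) : \bar R :=
  ((Num.sqrt Lam)%:E * sqrte (\int[leb]_(t in `]0%R, T[) (H2_enorm (u t)) ^+ 2)
   + sqrte (\int[leb]_(t in `]0%R, T[) (hnorm (L2space Om) (f t) ^+ 2)%:E)
   + (Num.sqrt Lam * grad_norm uh0)%:E)%E.

End bound.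

(* Main.v *)
Require Import Defs.
From HB Require Import structures.
From mathcomp Require Import all_boot all_order all_algebra.
From mathcomp Require Import all_classical all_reals all_analysis.
From mathcomp Require Import measurable_realfun finmap ring lra.

Set Implicit Arguments.
Unset Strict Implicit.
Unset Printing Implicit Defensive.

Import Order.TTheory GRing.Theory Num.Theory.
Import numFieldNormedType.Exports.

Local Open Scope classical_set_scope.
Local Open Scope ring_scope.

(* Let E = U - U_h, e = u - u_h and rho = R_h u - u. Move from U towards U_h in
   the inclusion for U, and from U_h towards (R_h u, w + rho) in the inclusion
   for U_h; the latter is admissible because u - w is unchanged. In the sum, the
   Ritz property removes the gradient of rho, so that for a.e. t
     <E', E> + |grad e|^2 <= <U_h', (rho, rho)> - (f, rho)
       <= h^2 (|U_h'|^2 / 2 + |f|^2 / 2 + C_app^2 Lambda |u|_{H^2}^2).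
   The energy estimate int |U_h'|^2 <= int |F|^2 + |grad u_h^0|^2 controls U_h',
   and it remains to integrate in time. The energy estimate itself is proved by
   comparing U_h(t) with U_h(t - s) along a uniform grid of step s, averaging over
   the offset of the grid and letting s tend to 0. Neither the energy nor
   t |-> |u(t)|_{H^2} has to be measurable: the integral of a nonnegative function
   is the supremum of those of the measurable functions below it. *)

(** * Integrals of nonnegative, possibly non-measurable functions *)

(** The comparison is asymmetric because [Vh h] lies in [sobH10]: [U_h] is admissible for the
    continuous energy, whereas [U] has to be corrected before the discrete energy accepts it. The
    correction is constant in [r], and the squared norm of [(rho, rho)] is [(kappa + Sc) |rho|^2];
    this is the origin of Lambda. Young's inequality with weight [h^2] balances [|rho| = O(h^2)]
    against a derivative [U_h'] that is only known to be square integrable, hence the factor [h^2]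
    for squared errors. The forms are merely semidefinite on representatives, and [wpartial] picks
    some weak derivative. Even the linearity of the gradient form therefore rests on uniqueness of
    weak derivatives, that is on the fundamental lemma of the calculus of variations, proved here
    with bumps built from [exp(-1/x)]. In time, [U'] enters only through its norm and its inner
    products, and the fundamental theorem is used only after pairing with a fixed vector. The chain
    rule for [|U|^2] then comes from Fubini on a triangle, without differentiating [U]. *)

Section lower_integral.
Context dT (T : measurableType dT) (R : realType).
Variable mu : {measure set T -> \bar R}.
Implicit Types (D : set T) (f g : T -> \bar R).
Local Open Scope ereal_scope.
Import HBNNSimple.

(** A simple function below [f] is set to zero on the exceptional null set: its integral does not
    change, and it now lies below [g] everywhere. *)
Lemma ae_ge0_le_lower_integral D f g :
  (forall x, D x -> 0 <= f x) -> (forall x, D x -> 0 <= g x) ->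
  {ae mu, forall x, D x -> f x <= g x} ->
  \int[mu]_(x in D) f x <= \int[mu]_(x in D) g x.
Proof.
move=> f0 g0 [N [mN N0 fgN]].
rewrite !(integral_mkcond D).
have f0' x : 0 <= (f \_ D) x by rewrite patchE; case: ifPn => // /set_mem/f0.
have g0' x : 0 <= (g \_ D) x by rewrite patchE; case: ifPn => // /set_mem/g0.
rewrite ge0_integralTE//; apply/ge_ereal_sup => _ [s /= sf <-].
have -> : sintegral mu s = \int[mu]_x (proj_nnsfun s (measurableC mN) x)%:E.
  rewrite -integralT_nnsfun; apply: ae_eq_integral => //.
  - exact/measurable_EFinP.
  - exact/measurable_EFinP.
  exists N; split => // x /= /not_implyP[_ h]; apply: contrapT => Nx; apply: h.
  by rewrite mindicE mem_set ?mulr1.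
rewrite integralT_nnsfun ge0_integralTE//; apply: ereal_sup_ubound.
exists (proj_nnsfun s (measurableC mN)) => //= x; rewrite mindicE.
have [/set_mem Nx|_] := boolP (x \in ~` N); last by rewrite mulr0.
rewrite mulr1 (le_trans (sf x))// !patchE; case: ifPn => // /set_mem Dx.
by apply: contrapT => fg; apply: Nx; apply: fgN => /= /(_ Dx).
Qed.

Lemma ge0_le_lower_integral D f g :
  (forall x, D x -> 0 <= f x) -> (forall x, D x -> f x <= g x) ->
  \int[mu]_(x in D) f x <= \int[mu]_(x in D) g x.
Proof.
move=> f0 fg; apply: ae_ge0_le_lower_integral => //.
- by move=> x Dx; rewrite (le_trans (f0 x Dx))// fg.
- exact: aeW.
Qed.

Lemma ae_eq_lower_integral D f g :
  ae_eq mu D f g -> \int[mu]_(x in D) f x = \int[mu]_(x in D) g x.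
Proof.
move=> fg; rewrite integralE [RHS]integralE; congr (_ - _); apply/eqP;
  rewrite eq_le; apply/andP; split; apply: ae_ge0_le_lower_integral => //;
  apply: filterS fg => x /= + Dx => /(_ Dx) e.
- by rewrite !funeposE e.
- by rewrite !funeposE e.
- by rewrite !funenegE e.
- by rewrite !funenegE e.
Qed.

Lemma ae_eq_lower_Rintegral D (f g : T -> R) :
  ae_eq mu D (EFin \o f) (EFin \o g) ->
  (\int[mu]_(x in D) f x = \int[mu]_(x in D) g x)%R.
Proof. by move=> fg; rewrite /Rintegral; congr fine; exact: ae_eq_lower_integral. Qed.

End lower_integral.

(** * Real-valued integrable functions *)

Section real_integrable.
Context dT (T : measurableType dT) (R : realType).
Variables (mu : {measure set T -> \bar R}) (D : set T).
Hypothesis mD : measurable D.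
Implicit Types f g : T -> R.

Lemma Rintegrable_D f g : mu.-integrable D (EFin \o f) -> mu.-integrable D (EFin \o g) ->
  mu.-integrable D (EFin \o (fun x => f x + g x)).
Proof. by move=> fi gi; apply: eq_integrable (integrableD mD fi gi). Qed.

Lemma Rintegrable_B f g : mu.-integrable D (EFin \o f) -> mu.-integrable D (EFin \o g) ->
  mu.-integrable D (EFin \o (fun x => f x - g x)).
Proof. by move=> fi gi; apply: eq_integrable (integrableB mD fi gi). Qed.

Lemma Rintegrable_Z k f : mu.-integrable D (EFin \o f) ->
  mu.-integrable D (EFin \o (fun x => k * f x)).
Proof. by move=> fi; apply: eq_integrable (integrableZl mD k fi). Qed.

Lemma Rintegrable_cst (k : R) : (mu D < +oo)%E -> mu.-integrable D (EFin \o (fun=> k)).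
Proof.
move=> fD; apply: measurable_bounded_integrable => //.
exists `|k|; split => [|e ke t _]; first exact: num_real.
exact: ltW.
Qed.

Lemma ae_le_Rintegral f g : mu.-integrable D (EFin \o f) -> mu.-integrable D (EFin \o g) ->
  {ae mu, forall x, D x -> f x <= g x} ->
  \int[mu]_(x in D) f x <= \int[mu]_(x in D) g x.
Proof.
move=> fi gi fg; rewrite -subr_ge0 -RintegralB//.
(* The integrand is nonnegative only almost everywhere; its absolute value is nonnegative everywhere
   and has the same integral. *)
rewrite (_ : Rintegral _ _ _ = \int[mu]_(x in D) `|g x - f x|).
  by apply: Rintegral_ge0 => x _; exact: normr_ge0.
apply: ae_eq_lower_Rintegral; apply: filterS fg => x fg Dx /=.
by rewrite ger0_norm// subr_ge0 fg.
Qed.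

End real_integrable.

(** Linearity is asked on [hin] only, since the integrals defining the forms may diverge for other
    representatives. Symmetry and positivity hold for all vectors, directly from the integrands. *)
Record prehilb (R : realType) (E : lmodType R) (X : hspace E) : Prop := Prehilb {
  hin0 : hin X 0 ;
  hinD : forall x y, hin X x -> hin X y -> hin X (x + y) ;
  hinZ : forall k x, hin X x -> hin X (k *: x) ;
  hipC : forall x y, hip X x y = hip X y x ;
  hipDl : forall x y z, hin X x -> hin X y -> hin X z ->
    hip X (x + y) z = hip X x z + hip X y z ;
  hipZl : forall k x z, hin X x -> hin X z -> hip X (k *: x) z = k * hip X x z ;
  hip_ge0 : forall x, 0 <= hip X x x
}.

(** * Pre-Hilbert spaces of representatives *)

Section prehilb_theory.
Variables (R : realType) (E : lmodType R) (X : hspace E).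
Hypothesis PX : prehilb X.
Implicit Types x y z : E.
Local Notation ip := (hip X).
Local Notation N := (hnorm X).
Local Notation "x \inX" := (hin X x) (at level 70).

Lemma hinN x : x \inX -> (- x) \inX.
Proof. by rewrite -scaleN1r; exact: hinZ. Qed.

Lemma hinB x y : x \inX -> y \inX -> (x - y) \inX.
Proof. by move=> xX yX; apply: hinD => //; exact: hinN. Qed.

Lemma hipDr x y z : x \inX -> y \inX -> z \inX -> ip z (x + y) = ip z x + ip z y.
Proof. by move=> *; rewrite hipC// hipDl// !(hipC PX z). Qed.

Lemma hipZr k x z : x \inX -> z \inX -> ip z (k *: x) = k * ip z x.
Proof. by move=> *; rewrite hipC// hipZl// (hipC PX z). Qed.

Lemma hipNl x z : x \inX -> z \inX -> ip (- x) z = - ip x z.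
Proof. by move=> *; rewrite -scaleN1r hipZl// mulN1r. Qed.

Lemma hipNr x z : x \inX -> z \inX -> ip z (- x) = - ip z x.
Proof. by move=> *; rewrite -scaleN1r hipZr// mulN1r. Qed.

Lemma hipBl x y z : x \inX -> y \inX -> z \inX -> ip (x - y) z = ip x z - ip y z.
Proof. by move=> *; rewrite hipDl ?hipNl//; exact: hinN. Qed.

Lemma hipBr x y z : x \inX -> y \inX -> z \inX -> ip z (x - y) = ip z x - ip z y.
Proof. by move=> *; rewrite hipDr ?hipNr//; exact: hinN. Qed.

Lemma hip0l z : z \inX -> ip 0 z = 0.
Proof. by move=> zX; rewrite -(scale0r 0) hipZl ?mul0r//; exact: hin0. Qed.

Lemma hnorm_ge0 x : 0 <= N x.
Proof. exact: sqrtr_ge0. Qed.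

Lemma sqr_hnorm x : N x ^+ 2 = ip x x.
Proof. by rewrite sqr_sqrtr// hip_ge0. Qed.

Lemma hip_subE x y : x \inX -> y \inX ->
  ip (x - y) (x - y) = ip x x - 2 * ip x y + ip y y.
Proof.
move=> xX yX; have bX := hinB xX yX.
by rewrite hipBl// !hipBr// (hipC PX y x); ring.
Qed.

Lemma hip_addE x y : x \inX -> y \inX ->
  ip (x + y) (x + y) = ip x x + 2 * ip x y + ip y y.
Proof.
move=> xX yX; have bX := hinD PX xX yX.
by rewrite hipDl// !hipDr// (hipC PX y x); ring.
Qed.

Lemma hnorm_segment x y th : x \inX -> y \inX ->
  N (x + th *: y) ^+ 2 = N x ^+ 2 + 2 * (th * ip x y) + th ^+ 2 * ip y y.
Proof.
move=> xX yX; have tyX := hinZ PX th yX.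
by rewrite !sqr_hnorm hip_addE// hipZl// !hipZr//; ring.
Qed.

Lemma cauchy_schwarz x y : x \inX -> y \inX -> `|ip x y| <= N x * N y.
Proof.
move=> xX yX; set a := ip x x; set b := ip x y; set c := ip y y.
have a0 : 0 <= a by exact: hip_ge0.
have c0 : 0 <= c by exact: hip_ge0.
have H (t : R) : 0 <= a + 2 * t * b + t ^+ 2 * c.
  have tyX := hinZ PX t yX; have := hip_ge0 PX (x + t *: y).
  by rewrite hip_addE// hipZl// !hipZr// -/a -/b -/c; congr (_ <= _); ring.
suff H2 : b ^+ 2 <= a * c.
  by rewrite -sqrtrM// -sqrtr_sqr ler_wsqrtr.
(* In a semidefinite form [y] may have norm 0 without being 0. The quadratic in [t] is then affine,
   and if [b] were nonzero it would take the value -1 at the [t] chosen below. *)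
have [c00|cn0] := eqVneq c 0.
  have [->|bn0] := eqVneq b 0; first by rewrite expr0n mulr_ge0.
  have := H (- (a + 1) / (2 * b)); rewrite c00 mulr0 addr0.
  rewrite [X in a + X](_ : _ = - (a + 1)); last by field.
  by move=> h; exfalso; lra.
have cgt0 : 0 < c by rewrite lt_def cn0.
have := H (- b / c).
rewrite [X in 0 <= X](_ : _ = (a * c - b ^+ 2) / c); last by field.
by rewrite pmulr_lge0 ?invr_gt0// subr_ge0.
Qed.

Lemma hip_le_norm x y : x \inX -> y \inX -> ip x y <= N x * N y.
Proof. by move=> xX yX; rewrite (le_trans (ler_norm _))// cauchy_schwarz. Qed.

Lemma hip_young x y : x \inX -> y \inX -> 2 * ip x y <= ip x x + ip y y.
Proof.
move=> xX yX; have := hip_ge0 PX (x - y); rewrite hip_subE//; lra.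
Qed.

Lemma ler_hnormD x y : x \inX -> y \inX -> N (x + y) <= N x + N y.
Proof.
move=> xX yX; rewrite -[leRHS]ger0_norm ?addr_ge0 ?hnorm_ge0//.
rewrite -sqrtr_sqr ler_wsqrtr// hip_addE// sqrrD !sqr_hnorm.
by have := hip_le_norm xX yX; rewrite mulr_natl; lra.
Qed.

Lemma hnormN x : x \inX -> N (- x) = N x.
Proof.
by move=> xX; rewrite /hnorm hipNl ?hipNr ?opprK//; exact: hinN.
Qed.

Lemma hnormBC x y : x \inX -> y \inX -> N (x - y) = N (y - x).
Proof. by move=> xX yX; rewrite -opprB hnormN//; exact: hinB. Qed.

Lemma hnorm0 : N 0 = 0.
Proof. by rewrite /hnorm hip0l ?sqrtr0//; exact: hin0. Qed.

Lemma hnormZ k x : x \inX -> N (k *: x) = `|k| * N x.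
Proof.
move=> xX; rewrite /hnorm hipZl ?hipZr//; last exact: hinZ.
by rewrite mulrA -expr2 sqrtrM ?sqr_ge0// sqrtr_sqr.
Qed.

Lemma ler_dist_hnorm x y : x \inX -> y \inX -> `|N x - N y| <= N (x - y).
Proof.
move=> xX yX; rewrite ler_norml; apply/andP; split.
  have := ler_hnormD xX (hinB yX xX); rewrite subrKC (hnormBC yX xX); lra.
have := ler_hnormD yX (hinB xX yX); rewrite subrKC; lra.
Qed.

Lemma ler_hnormB_trans y x z : x \inX -> y \inX -> z \inX ->
  N (x - z) <= N (x - y) + N (y - z).
Proof.
move=> xX yX zX; have := ler_hnormD (hinB xX yX) (hinB yX zX).
by rewrite addrA subrK.
Qed.

(** By Cauchy-Schwarz, vectors of norm 0 are invisible to the form. This is what permits exchanging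
    representatives at distance 0. *)
Lemma hip_eq0l x z : x \inX -> z \inX -> N x = 0 -> ip x z = 0.
Proof.
move=> xX zX x0; apply/eqP; rewrite -normr_le0.
by rewrite (le_trans (cauchy_schwarz xX zX))// x0 mul0r.
Qed.

Lemma hinsum (I : Type) (r : seq I) (P : pred I) (F : I -> E) :
  (forall i, P i -> F i \inX) -> (\sum_(i <- r | P i) F i) \inX.
Proof. by move=> FX; elim/big_ind: _ => //; [exact: hin0|exact: hinD]. Qed.

Lemma hip_suml (I : Type) (r : seq I) (P : pred I) (F : I -> E) z :
  (forall i, P i -> F i \inX) -> z \inX ->
  ip (\sum_(i <- r | P i) F i) z = \sum_(i <- r | P i) ip (F i) z.
Proof.
move=> FX zX; elim: r => [|i r IH]; first by rewrite !big_nil hip0l.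
by rewrite !big_cons; case: ifPn => // Pi; rewrite hipDl ?IH//; [exact: FX|exact: hinsum].
Qed.

End prehilb_theory.

Section L2_prehilb.
Variables (R : realType) (d : nat) (Om : polytope R d).
Implicit Types u v : L2 Om.

Lemma L2_mul_integrable u v :
  (vol Om).-integrable setT (EFin \o (fun x => u x * v x)).
Proof.
by rewrite -Lfun1_integrable; apply: Lfun2_mul_Lfun1; exact: LfunP.
Qed.

Lemma L2space_prehilb : prehilb (L2space Om).
Proof.
split => //=.
- by move=> u v; apply: eq_Rintegral => x _; rewrite mulrC.
- move=> u v w _ _ _.
  rewrite -RintegralD//; [|exact: L2_mul_integrable..].
  by apply: eq_Rintegral => x _; rewrite -mulrDl.
- move=> k u w _ _; rewrite -RintegralZl//; last exact: L2_mul_integrable.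
  by apply: eq_Rintegral => x _; rewrite mulrA.
- by move=> u; apply: Rintegral_ge0 => x _; rewrite -expr2 sqr_ge0.
Qed.

End L2_prehilb.

(** * Strong measurability and Bochner spaces *)

Section finitely_valued.
Context dT (T : measurableType dT).

Definition finitely_valued (A : choiceType) (s : T -> A) :=
  finite_set (range s) /\ forall y, measurable (s @^-1` [set y]).

(** A preimage is a finite union of measurable level sets, whatever [Y] is. Hence any map at all, in
    particular an inner product, may be composed with functions of finitely many values. *)
Lemma finitely_valued_preimage (A : choiceType) (s : T -> A) (Y : set A) :
  finitely_valued s -> measurable (s @^-1` Y).
Proof.
move=> [fs ms].
rewrite (_ : s @^-1` Y = \bigcup_(y in range s `&` Y) s @^-1` [set y]).
  by apply: fin_bigcup_measurable => // ; exact: finite_setIl.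
apply/seteqP; split => [t Yt|t [y [_ Yy] /= ->]] //.
by exists (s t) => //; split => //; exists t.
Qed.

Lemma finitely_valued_comp (A B : choiceType) (s : T -> A) (g : A -> B) :
  finitely_valued s -> finitely_valued (g \o s).
Proof.
move=> fs; split=> [|y]; last exact: (finitely_valued_preimage (g @^-1` [set y])).
apply: (@sub_finite_set _ _ (g @` range s)); last exact: finite_image fs.1.
by move=> _ [t _ <-]; exists (s t) => //; exists t.
Qed.

Lemma finitely_valued_pair (A B : choiceType) (s : T -> A) (s' : T -> B) :
  finitely_valued s -> finitely_valued s' -> finitely_valued (fun t => (s t, s' t)).
Proof.
move=> [fs ms] [fs' ms']; split=> [|[y y']].
  apply: (@sub_finite_set _ _ (range s `*` range s')); last exact: finite_setX.
  by move=> _ [t _ <-]; split; exists t.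
rewrite (_ : _ @^-1` _ = s @^-1` [set y] `&` s' @^-1` [set y']).
  exact: measurableI.
by apply/seteqP; split => t /= => [[-> ->]|[-> ->]].
Qed.

Lemma finitely_valued_measurable (R : realType) (s : T -> R) :
  finitely_valued s -> measurable_fun setT s.
Proof. by move=> fs _ Y mY; rewrite setTI; exact: finitely_valued_preimage. Qed.

End finitely_valued.

Section hmeas.
Variables (R : realType) (E : lmodType R) (X : hspace E).
Hypothesis PX : prehilb X.

Lemma simpleP dT (T : measurableType dT) (s : T -> E) :
  simple X s <-> finitely_valued s /\ forall t, hin X (s t).
Proof. by split=> [[? ? ?]|[[? ?] ?]]; split. Qed.

(* Unlike [strongly_measurable], the approximation holds everywhere, so that
   inner products of such functions are measurable without completeness. *)
Definition hmeas dT (T : measurableType dT) (f : T -> E) :=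
  (forall t, hin X (f t)) /\
  exists2 s : (T -> E)^nat, (forall n, simple X (s n)) &
    forall t, hnorm X (s n t - f t) @[n --> \oo] --> 0.

Lemma hip_cvg (s s' : E^nat) (x y : E) :
  (forall n, hin X (s n)) -> (forall n, hin X (s' n)) -> hin X x -> hin X y ->
  hnorm X (s n - x) @[n --> \oo] --> 0 -> hnorm X (s' n - y) @[n --> \oo] --> 0 ->
  hip X (s n) (s' n) @[n --> \oo] --> hip X x y.
Proof.
move=> sX s'X xX yX sx s'y.
pose b n := hnorm X (s n - x) * hnorm X (s' n - y)
  + hnorm X x * hnorm X (s' n - y) + hnorm X (s n - x) * hnorm X y.
have b0 : b n @[n --> \oo] --> 0.
  rewrite -[X in _ --> X](_ : 0 * 0 + hnorm X x * 0 + 0 * hnorm X y = 0); last by ring.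
  apply: cvgD; first apply: cvgD.
  - exact: cvgM.
  - by apply: cvgM => //; exact: cvg_cst.
  - by apply: cvgM => //; exact: cvg_cst.
apply/cvgrPdist_le => e e0.
have /cvgrPdist_le/(_ e e0) := b0; apply: filterS => n; rewrite sub0r normrN.
move=> h; apply: le_trans h; apply: le_trans (ler_norm _).
rewrite distrC /b.
have -> : hip X (s n) (s' n) - hip X x y = hip X (s n - x) (s' n - y)
    + hip X x (s' n - y) + hip X (s n - x) y.
  by rewrite !(hipBl PX)// ?(hipBr PX)//; [ring|exact: hinB].
apply: (le_trans (ler_normD _ _)); apply: lerD.
  apply: (le_trans (ler_normD _ _)); apply: lerD.
    by apply: cauchy_schwarz => //; exact: hinB.
  by apply: cauchy_schwarz => //; exact: hinB.
by apply: cauchy_schwarz => //; exact: hinB.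
Qed.

Section one_space.
Context dT (T : measurableType dT).
Implicit Types f g : T -> E.

Lemma hmeas_hip f g : hmeas f -> hmeas g ->
  measurable_fun setT (fun t => hip X (f t) (g t)).
Proof.
move=> [fX [s ss sf]] [gX [s' ss' s'g]].
apply: (@measurable_fun_cvg _ _ _ _ (fun n t => hip X (s n t) (s' n t))).
  move=> n; apply: finitely_valued_measurable.
  have /simpleP[fs _] := ss n; have /simpleP[fs' _] := ss' n.
  exact: (finitely_valued_comp (fun p => hip X p.1 p.2) (finitely_valued_pair fs fs')).
move=> t _; apply: hip_cvg => //.
  by move=> n; have [_ + _] := ss n; exact.
by move=> n; have [_ + _] := ss' n; exact.
Qed.

Lemma hmeas_hnorm f : hmeas f -> measurable_fun setT (fun t => hnorm X (f t)).
Proof.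
move=> mf; apply: (measurableT_comp _ (hmeas_hip mf mf)).
by apply: continuous_measurable_fun; exact: sqrt_continuous.
Qed.

Lemma hmeas_simple f : simple X f -> hmeas f.
Proof.
move=> sf; split; first by case: sf.
exists (fun=> f) => // t; rewrite subrr hnorm0//; exact: cvg_cst.
Qed.

Lemma simple_cst x : hin X x -> simple X (fun _ : T => x).
Proof.
move=> xX; split => //.
  by apply: (@sub_finite_set _ _ [set x]) => // _ [t _ <-].
by move=> y; rewrite preimage_cst; case: ifP.
Qed.

Lemma hmeas_cst x : hin X x -> hmeas (fun _ : T => x).
Proof. by move=> xX; apply: hmeas_simple; exact: simple_cst. Qed.

Lemma simple_lin k f g : simple X f -> simple X g ->
  simple X (fun t => k *: f t + g t).
Proof.
move=> /simpleP[ff fX] /simpleP[fg gX]; apply/simpleP; split.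
  exact: (finitely_valued_comp (fun p => k *: p.1 + p.2) (finitely_valued_pair ff fg)).
by move=> t; apply: hinD => //; exact: hinZ.
Qed.

Lemma cvg_hnorm_lin k (s s' : E^nat) (x y : E) :
  (forall n, hin X (s n)) -> (forall n, hin X (s' n)) -> hin X x -> hin X y ->
  hnorm X (s n - x) @[n --> \oo] --> 0 -> hnorm X (s' n - y) @[n --> \oo] --> 0 ->
  hnorm X (k *: s n + s' n - (k *: x + y)) @[n --> \oo] --> 0.
Proof.
move=> sX s'X xX yX sx s'y.
pose b n := `|k| * hnorm X (s n - x) + hnorm X (s' n - y).
have b0 : b n @[n --> \oo] --> 0.
  rewrite -[X in _ --> X](_ : `|k| * 0 + 0 = 0); last by ring.
  by apply: cvgD => //; apply: cvgM => //; exact: cvg_cst.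
apply: (@squeeze_cvgr _ _ _ _ (cst 0) b) => //; last exact: cvg_cst.
apply: nearW => n; rewrite hnorm_ge0/= /b.
rewrite opprD addrACA -scalerBr -(hnormZ PX); last exact: hinB.
by apply: ler_hnormD => //; [apply: hinZ => //|]; exact: hinB.
Qed.

Lemma hmeas_lin k f g : hmeas f -> hmeas g -> hmeas (fun t => k *: f t + g t).
Proof.
move=> [fX [s ss sf]] [gX [s' ss' s'g]]; split.
  by move=> t; apply: hinD => //; exact: hinZ.
exists (fun n t => k *: s n t + s' n t); first by move=> n; exact: simple_lin.
move=> t; apply: cvg_hnorm_lin => //.
  by move=> n; have [_ + _] := ss n; exact.
by move=> n; have [_ + _] := ss' n; exact.
Qed.

Lemma hmeasD f g : hmeas f -> hmeas g -> hmeas (fun t => f t + g t).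
Proof.
move=> mf mg; have := hmeas_lin 1 mf mg.
by congr hmeas; apply/funext => t; rewrite scale1r.
Qed.

Lemma hmeasZ k f : hmeas f -> hmeas (fun t => k *: f t).
Proof.
move=> mf; have := hmeas_lin k mf (hmeas_cst (hin0 PX)).
by congr hmeas; apply/funext => t; rewrite addr0.
Qed.

Lemma hmeasB f g : hmeas f -> hmeas g -> hmeas (fun t => f t - g t).
Proof.
move=> mf mg; have := hmeasD mf (hmeasZ (-1) mg).
by congr hmeas; apply/funext => t; rewrite scaleN1r.
Qed.

Lemma simple_restrict (A : set T) f : measurable A -> simple X f ->
  simple X (fun t => if t \in A then f t else 0).
Proof.
move=> mA /simpleP[ff fX]; apply/simpleP; split; last first.
  by move=> t; case: ifP => // _; exact: hin0.
have fA : finitely_valued (fun t => t \in A).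
  split; first exact: finite_finset.
  move=> [|].
  - by rewrite (_ : _ @^-1` _ = A)//; apply/seteqP; split => t /=; [exact: set_mem|exact: mem_set].
  - rewrite (_ : _ @^-1` _ = ~` A); first exact: measurableC.
    apply/seteqP; split => t /=; first by move=> /negbT; rewrite notin_setE.
    by move=> At; apply/negbTE; rewrite notin_setE.
exact: (finitely_valued_comp (fun p : bool * E => if p.1 then p.2 else 0)
          (finitely_valued_pair fA ff)).
Qed.

(** The function and its approximations are set to 0 outside [D] and on a measurable null set
    containing the points without convergence. The approximations stay simple, and now converge
    everywhere. *)
Lemma strongly_measurable_version (nu : {measure set T -> \bar R}) (D : set T) f :
  measurable D -> (forall t, D t -> hin X (f t)) -> strongly_measurable X nu D f ->
  exists g, [/\ hmeas g, (forall t, ~ D t -> g t = 0) & ae_eq nu D f g].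
Proof.
move=> mD fX [s ss [N [mN N0 sN]]]; pose A := D `\` N.
have mA : measurable A by exact: measurableD.
exists (fun t => if t \in A then f t else 0); split; last first.
- exists N; split => // t /= /not_implyP[Dt h]; apply: contrapT => Nt; apply: h.
  by rewrite mem_set.
- by move=> t Dt; case: ifPn => // /set_mem [].
split; first by move=> t; case: ifPn => [/set_mem[Dt _]|_]; [exact: fX|exact: hin0].
exists (fun n t => if t \in A then s n t else 0); first by move=> n; exact: simple_restrict.
move=> t; case: ifPn => [/set_mem[Dt Nt]|_].
  by apply: contrapT => h; apply: Nt; apply: sN => /= /(_ Dt).
by rewrite subrr hnorm0//; exact: cvg_cst.
Qed.

End one_space.

Lemma simple_comp dT dS (T : measurableType dT) (S : measurableType dS)
    (f : T -> E) (phi : S -> T) :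
  measurable_fun setT phi -> simple X f -> simple X (f \o phi).
Proof.
move=> mphi [ff fX mf]; split => //.
- by apply: sub_finite_set ff => _ [t _ <-]; exists (phi t).
- by move=> t; exact: fX.
- by move=> y; have := mphi measurableT _ (mf y); rewrite setTI.
Qed.

Lemma hmeas_comp dT dS (T : measurableType dT) (S : measurableType dS)
    (f : T -> E) (phi : S -> T) :
  measurable_fun setT phi -> hmeas f -> hmeas (f \o phi).
Proof.
move=> mphi [fX [s ss sf]]; split; first by move=> t; exact: fX.
by exists (fun n => s n \o phi) => [n|t]; [exact: simple_comp|exact: sf].
Qed.

End hmeas.

Section bochner_space.
Variables (R : realType) (E : lmodType R) (X : hspace E).
Hypothesis PX : prehilb X.
Context dT (T : measurableType dT) (nu : {measure set T -> \bar R}).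
Variable c : T -> R.
Hypotheses (mc : measurable_fun setT c) (c0 : forall t, 0 <= c t).

Lemma bochnerL2_version (D : set T) f :
  measurable D -> bochnerL2 X nu D c f ->
  exists g, [/\ hmeas X g, (forall t, ~ D t -> g t = 0), ae_eq nu D f g &
    (\int[nu]_(t in D) (c t * hip X (g t) (g t))%:E < +oo)%E].
Proof.
move=> mD [fX sf foo]; have [g [mg g0 fg]] := strongly_measurable_version PX mD fX sf.
exists g; split => //; apply: le_lt_trans foo.
rewrite le_eqVlt; apply/orP; left; apply/eqP/ae_eq_lower_integral.
by apply: filterS fg => t h Dt; rewrite h// sqr_hnorm.
Qed.

(** Young's inequality for [g] and for [- g] bounds [|<f, g>|] by [|f|^2 + |g|^2], which is
    integrable against the weight. *)
Lemma hip_integrable (D : set T) f g :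
  measurable D -> hmeas X f -> hmeas X g ->
  (\int[nu]_(t in D) (c t * hip X (f t) (f t))%:E < +oo)%E ->
  (\int[nu]_(t in D) (c t * hip X (g t) (g t))%:E < +oo)%E ->
  nu.-integrable D (EFin \o (fun t => c t * hip X (f t) (g t))).
Proof.
move=> mD mf mg fi gi.
have mm f' g' : hmeas X f' -> hmeas X g' ->
    measurable_fun D (fun t => c t * hip X (f' t) (g' t)).
  move=> mf' mg'; apply: measurable_funTS; apply: measurable_funM => //.
  exact: hmeas_hip.
have II f' : hmeas X f' -> (\int[nu]_(t in D) (c t * hip X (f' t) (f' t))%:E < +oo)%E ->
    nu.-integrable D (EFin \o (fun t => c t * hip X (f' t) (f' t))).
  move=> mf' fi'; apply/integrableP; split; first by apply/measurable_EFinP; exact: mm.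
  apply: le_lt_trans fi'; rewrite le_eqVlt; apply/orP; left; apply/eqP.
  by apply: eq_integral => t _ /=; rewrite ger0_norm// mulr_ge0// hip_ge0.
apply: le_integrable (integrableD _ (II _ mf fi) (II _ mg gi)) => //.
  by apply/measurable_EFinP; exact: mm.
move=> t Dt; have fX := mf.1 t; have gX := mg.1 t.
rewrite /= lee_fin -mulrDr !normrM (ger0_norm (c0 t)) ler_wpM2l//.
rewrite [leRHS]ger0_norm ?addr_ge0 ?hip_ge0//.
have := hip_young PX fX gX; have := hip_young PX (hinN PX fX) gX.
rewrite (hipNl PX)// (hipNr PX)//; last exact: hinN.
rewrite (hipNl PX)// opprK ler_norml.
have := hip_ge0 PX (f t); have := hip_ge0 PX (g t); lra.
Qed.

(** The form of [Mspace] over an arbitrary measure space and value space; [Mspace] is an instance of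
    it up to conversion. *)
Definition bspace : hspace (T -> E) :=
  {| hin := bochnerL2 X nu setT c ;
     hip := fun w z => \int[nu]_r (c r * hip X (w r) (z r)) |}.

Lemma bspace_hipE w z w' z' : ae_eq nu setT w w' -> ae_eq nu setT z z' ->
  hip bspace w z = \int[nu]_r (c r * hip X (w' r) (z' r)).
Proof.
move=> ww zz; apply: ae_eq_lower_Rintegral.
by apply: filterS2 ww zz => t + + _ => /(_ I) e /(_ I) e' /=; rewrite e e'.
Qed.

(** Elements are limits of simple functions only almost everywhere. Passing to a version that is
    such a limit everywhere makes the inner products measurable, so that integrals of sums can be
    split. *)
Lemma bspaceP w : bochnerL2 X nu setT c w <-> (forall t, hin X (w t)) /\
  exists w', [/\ hmeas X w', ae_eq nu setT w w' &
    nu.-integrable setT (EFin \o (fun t => c t * hip X (w' t) (w' t)))].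
Proof.
split=> [hw|[wX [w' [mw ww /integrableP[_ wi]]]]].
  have [w' [mw w0 ww wi]] := bochnerL2_version measurableT hw.
  split; first by case: hw => h _ _ t; exact: h.
  by exists w'; split => //; exact: hip_integrable.
split => //.
- have [wX' [s ss sf]] := mw; exists s => //.
  by apply: filterS ww => t /(_ I) -> _; exact: sf.
- apply: le_lt_trans wi; apply: ae_ge0_le_lower_integral => //.
  + by move=> t _; rewrite lee_fin mulr_ge0// sqr_ge0.
  + apply: filterS ww => t /(_ I) -> _ /=; rewrite (sqr_hnorm PX).
    by rewrite lee_fin; exact: ler_norm.
Qed.

Lemma bspace_lin k w z : hin bspace w -> hin bspace z -> hin bspace (k *: w + z).
Proof.
move=> /bspaceP[wX [w' [mw ww wi]]] /bspaceP[zX [z' [mz zz zi]]].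
apply/bspaceP; split; first by move=> t; apply: hinD => //; exact: hinZ.
exists (fun t => k *: w' t + z' t); split; first exact: hmeas_lin.
  by apply: filterS2 ww zz => t /(_ I) ew /(_ I) ez _; rewrite -ew -ez.
pose F t := k ^+ 2 * (c t * hip X (w' t) (w' t)) +
  (2 * k) * (c t * hip X (w' t) (z' t)) + c t * hip X (z' t) (z' t).
have wzi : nu.-integrable setT (EFin \o (fun t => c t * hip X (w' t) (z' t))).
  apply: hip_integrable => //.
    exact: integrable_lty wi.
  exact: integrable_lty zi.
apply: (@eq_integrable _ _ _ _ _ measurableT (EFin \o F)).
  move=> t _ /=; congr EFin; rewrite /F.
  have wX' := mw.1 t; have zX' := mz.1 t; have kX := hinZ PX k wX'.
  by rewrite (hip_addE PX)// !(hipZl PX)// ?(hipZr PX)//; ring.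
rewrite /F; apply: (@integrableD _ _ _ _ _ measurableT (fun t =>
  (k ^+ 2 * (c t * hip X (w' t) (w' t)) + 2 * k * (c t * hip X (w' t) (z' t)))%:E) (fun t =>
  (c t * hip X (z' t) (z' t))%:E)) => //.
apply: (@integrableD _ _ _ _ _ measurableT (fun t =>
  (k ^+ 2 * (c t * hip X (w' t) (w' t)))%:E) (fun t =>
  (2 * k * (c t * hip X (w' t) (z' t)))%:E)) => //.
  exact: (@integrableZl _ _ _ _ _ measurableT (k ^+ 2) _ wi).
exact: (@integrableZl _ _ _ _ _ measurableT (2 * k) _ wzi).
Qed.

Lemma bspace_prehilb : prehilb bspace.
Proof.
have h0 : hin bspace 0.
  apply/bspaceP; split; first by move=> t; exact: hin0.
  exists (fun=> 0); split.
  - by apply: hmeas_cst => //; exact: hin0.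
  - exact: aeW.
  - apply: (@eq_integrable _ _ _ _ _ measurableT (cst 0%E)); last exact: integrable0.
    by move=> t _ /=; rewrite (hip0l PX) ?mulr0//; exact: hin0.
have hZ k w : hin bspace w -> hin bspace (k *: w).
  by move=> hw; have := bspace_lin k hw h0; rewrite addr0.
have ippi w z : hmeas X w -> hmeas X z ->
    nu.-integrable setT (EFin \o (fun t => c t * hip X (w t) (w t))) ->
    nu.-integrable setT (EFin \o (fun t => c t * hip X (z t) (z t))) ->
    nu.-integrable setT (EFin \o (fun t => c t * hip X (w t) (z t))).
  move=> mw mz wi zi; apply: hip_integrable => //.
    exact: integrable_lty wi.
  exact: integrable_lty zi.
split => //.
- by move=> w z hw hz; have := bspace_lin 1 hw hz; rewrite scale1r.
- by move=> w z; apply: eq_Rintegral => t _; rewrite (hipC PX).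
- move=> x y z /bspaceP[_ [x' [mx xx xi]]] /bspaceP[_ [y' [my yy yi]]].
  move=> /bspaceP[_ [z' [mz zz zi]]].
  rewrite (bspace_hipE xx zz) (bspace_hipE yy zz).
  rewrite (@bspace_hipE (x + y) z (fun t => x' t + y' t) z')//; last first.
    by apply: filterS2 xx yy => t /(_ I) ex /(_ I) ey _; rewrite -ex -ey.
  rewrite -RintegralD//; [|exact: ippi..].
  apply: eq_Rintegral => t _; rewrite (hipDl PX) ?mulrDr//.
  + exact: mx.1.
  + exact: my.1.
  + exact: mz.1.
- move=> k x z /bspaceP[_ [x' [mx xx xi]]] /bspaceP[_ [z' [mz zz zi]]].
  rewrite (bspace_hipE xx zz) (@bspace_hipE (k *: x) z (fun t => k *: x' t) z')//; last first.
    by apply: filterS xx => t /(_ I) ex _; rewrite -ex.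
  rewrite -RintegralZl//; last exact: ippi.
  apply: eq_Rintegral => t _; rewrite (hipZl PX) 1?mulrCA//.
  + exact: mx.1.
  + exact: mz.1.
- by move=> w; apply: Rintegral_ge0 => t _; rewrite mulr_ge0// hip_ge0.
Qed.

(** Provides the test directions that are constant in the parameter; the factor in front of [|x|^2]
    becomes [Sc]. *)
Lemma bspace_cst x : hin X x -> (\int[nu]_r (c r)%:E < +oo)%E ->
  hin bspace (fun=> x) /\ hip bspace (fun=> x) (fun=> x) = (\int[nu]_r c r) * hip X x x.
Proof.
move=> xX ci.
have ic : nu.-integrable setT (EFin \o c).
  apply/integrableP; split; first exact/measurable_EFinP.
  apply: le_lt_trans ci; rewrite le_eqVlt; apply/orP; left; apply/eqP.
  by apply: eq_integral => t _ /=; rewrite ger0_norm.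
split; last by rewrite /= RintegralZr.
apply/bspaceP; split => //; exists (fun=> x); split => //; first exact: hmeas_cst.
  exact: aeW.
exact: (@integrableZr _ _ _ _ _ measurableT (hip X x x) _ ic).
Qed.

End bochner_space.

(** * The product space of the flow *)

Section flow_space.
Variables (R : realType) (d : nat) (Om : polytope R d).
Context dX (X : measurableType dX) (mu : {finite_measure set X -> \bar R}).
Variables (a : R) (c : X -> R).
Hypotheses (a_ge0 : 0 <= a) (c_meas : measurable_fun setT c) (c_gt0 : forall r, 0 < c r).

Lemma Mspace_prehilb : prehilb (Mspace Om mu c).
Proof. by apply: (bspace_prehilb (L2space_prehilb Om)) => // t; exact: ltW. Qed.

Lemma Hspace_prehilb : prehilb (Hspace Om mu a c).
Proof.
have PL := L2space_prehilb Om; have PM := Mspace_prehilb.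
have k0 : 0 <= kappa a by rewrite /kappa addr_ge0.
have hL u : hin (L2space Om) u by [].
(* Both factors are made abstract, so that only a weighted sum of two semidefinite forms remains. *)
rewrite /Hspace; move: (Mspace _ _ _) PM (L2space Om) hL PL => M PM L hL PL.
split => /=.
- exact: (hin0 PM).
- by move=> x y; exact: (hinD PM).
- by move=> k x; exact: (hinZ PM).
- by move=> x y; rewrite (hipC PL) (hipC PM).
- by move=> x y z hx hy hz; rewrite (hipDl PL)// (hipDl PM)//; ring.
- by move=> k x z hx hz; rewrite (hipZl PL)// (hipZl PM)//; ring.
- by move=> x; rewrite addr_ge0 ?mulr_ge0 ?(hip_ge0 PL) ?(hip_ge0 PM).
Qed.

End flow_space.

(** * Bochner integrals tested against vectors *)

Section bochner_weak.
Variables (R : realType) (E : lmodType R) (X : hspace E).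
Hypothesis PX : prehilb X.
Context dT (T : measurableType dT) (nu : {measure set T -> \bar R}).
Variable D : set T.
Hypothesis mD : measurable D.

Lemma hip_cst_integrable (h : T -> E) (z : E) : hmeas X h -> hin X z ->
  nu.-integrable D (EFin \o (fun t => hnorm X (h t))) ->
  nu.-integrable D (EFin \o (fun t => hip X (h t) z)).
Proof.
move=> mh zX hi; apply: (le_integrable mD _ _ (@integrableZl _ _ _ _ _ mD (hnorm X z) _ hi)).
  apply/measurable_EFinP; apply: measurable_funTS; apply: (hmeas_hip PX) => //.
  exact: hmeas_cst.
move=> t Dt; rewrite /= lee_fin [leRHS]ger0_norm ?mulr_ge0 ?hnorm_ge0// mulrC.
by apply: (cauchy_schwarz PX) => //; exact: mh.1.
Qed.

Hypothesis D_fin : (nu D < +oo)%E.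

Lemma finitely_valued_integrable (A : choiceType) (s : T -> A) (g : A -> R) :
  finitely_valued s -> nu.-integrable D (EFin \o (g \o s)).
Proof.
move=> fs; have fg := finitely_valued_comp g fs.
apply: measurable_bounded_integrable => //.
  by apply: measurable_funTS; exact: finitely_valued_measurable.
have [M [_ Mg]] : bounded_set (range (g \o s)) by apply: compact_bounded; exact: finite_compact fg.1.
exists M; split => [|e Me t Dt]; first exact: num_real.
by apply: Mg => //=; exists t.
Qed.

Lemma finitely_valued_Rintegral (A : choiceType) (s : T -> A) (g : A -> R) :
  finitely_valued s ->
  \sum_(y \in range s) fine (nu (D `&` s @^-1` [set y])) * g y =
  \int[nu]_(t in D) g (s t).
Proof.
move=> [fs ms]; rewrite fsbig_finite//=.
have mI y : measurable (D `&` s @^-1` [set y]) by exact: measurableI.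
have ind y : nu.-integrable D (fun t => (g y * \1_(s @^-1` [set y]) t)%:E).
  apply: (@integrableZl _ _ _ _ _ mD (g y) (fun t => (\1_(s @^-1` [set y]) t)%:E)).
  apply: measurable_bounded_integrable => //.
  exists 1; split => // e e1 t _; rewrite /= indicE ger0_norm ?ler0n//.
  by rewrite (le_trans _ (ltW e1))// lern1 leq_b1.
rewrite /Rintegral (eq_integral (fun t => (\sum_(y <- fset_set (range s))
    (g y * \1_(s @^-1` [set y]) t)%:E)%E)); last first.
  move=> t _; rewrite sumEFin; congr EFin.
  have st : s t \in fset_set (range s) by rewrite in_fset_set//; apply: mem_set; exists t.
  rewrite (big_fsetD1 _ st)/= indicE mem_set// mulr1 big1_fset ?addr0// => y.
  rewrite !inE => /andP[/eqP yst _] _; rewrite indicE memNset ?mulr0//=.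
  by move=> e; apply: yst.
rewrite (integral_sum _ _ _ _)//.
have e y : (\int[nu]_(t in D) (g y * \1_(s @^-1` [set y]) t)%:E =
    (fine (nu (D `&` s @^-1` [set y])) * g y)%:E)%E.
  have f : nu (D `&` s @^-1` [set y]) \is a fin_num.
    rewrite ge0_fin_numE// (le_lt_trans _ D_fin)//.
    by apply: le_measure => //; apply: mem_set; [exact: mI|exact: mD].
  under eq_integral do rewrite EFinM.
  rewrite integralZl//; last first.
    apply: measurable_bounded_integrable => //.
    exists 1; split => // e e1 t _; rewrite /= indicE ger0_norm ?ler0n//.
    by rewrite (le_trans _ (ltW e1))// lern1 leq_b1.
  by rewrite integral_indic// setIC -[in LHS](fineK f) -EFinM mulrC.
by under [in RHS]eq_bigr do rewrite e; rewrite sumEFin.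
Qed.

(** For simple functions this is linearity. Both sides then pass to the limit: the left one by
    continuity of the form, the right one because the error is at most [|z|] times the integral of
    [|s n - g|]. Later arguments use the Bochner integral only in this tested form. *)
Lemma bochner_integral_hip (f g : T -> E) (y z : E) :
  hmeas X g -> ae_eq nu D f g -> nu.-integrable D (EFin \o (fun t => hnorm X (g t))) ->
  bochner_integral X nu D f y -> hin X y -> hin X z ->
  hip X y z = \int[nu]_(t in D) hip X (g t) z.
Proof.
move=> mg fg gi [s [ss sf sy]] yX zX.
have gX t : hin X (g t) by exact: mg.1.
have sX n t : hin X (s n t) by case: (ss n).
have fvs n : finitely_valued (s n) by case/(simpleP X): (ss n).
set I := fun n => \sum_(x \in range (s n)) fine (nu (D `&` s n @^-1` [set x])) *: x.
have IE n : I n = \sum_(x <- fset_set (range (s n)))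
    fine (nu (D `&` s n @^-1` [set x])) *: x.
  by rewrite /I fsbig_finite//; exact: (fvs n).1.
have rX n x : x \in fset_set (range (s n)) -> hin X x.
  by rewrite in_fset_set; [move=> /set_mem[t _ <-]|exact: (fvs n).1].
have IX n : hin X (I n).
  rewrite IE big_seq; apply: hinsum => // x /rX xX; exact: hinZ.
have Iz n : hip X (I n) z = \int[nu]_(t in D) hip X (s n t) z.
  rewrite -(finitely_valued_Rintegral (fun x => hip X x z) (fvs n)).
  rewrite fsbig_finite /=; last exact: (fvs n).1.
  rewrite IE big_seq (hip_suml PX)//; last by move=> x /rX xX; exact: hinZ.
  by rewrite [RHS]big_seq; apply: eq_bigr => x /rX xX; rewrite (hipZl PX).
have Iy : hip X (I n) z @[n --> \oo] --> hip X y z.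
  apply: (hip_cvg PX) => //.
  by under eq_fun do rewrite subrr (hnorm0 PX); exact: cvg_cst.
apply: (cvg_unique _ Iy) => //.
have mN n : measurable_fun setT (fun t => hnorm X (s n t - g t)).
  by apply: (hmeas_hnorm PX); apply: (hmeasB PX) => //; apply: hmeas_simple.
have si n : nu.-integrable D (EFin \o (fun t => hnorm X (s n t - g t))).
  have h := @finitely_valued_integrable _ (s n) (hnorm X) (fvs n).
  apply: (le_integrable mD _ _ (integrableD mD h gi)).
    by apply/measurable_EFinP; exact: measurable_funTS.
  move=> t Dt; rewrite /= lee_fin !ger0_norm ?addr_ge0 ?hnorm_ge0//.
  have := ler_hnormD PX (sX n t) (hinN PX (gX t)).
  by rewrite (hnormN PX).
have zi h : hmeas X h -> nu.-integrable D (EFin \o (fun t => hnorm X (h t))) ->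
    nu.-integrable D (EFin \o (fun t => hip X (h t) z)).
  by move=> mh hi; exact: hip_cst_integrable.
have b0 : hnorm X z * \int[nu]_(t in D) hnorm X (s n t - g t) @[n --> \oo] --> 0.
  rewrite -[X in _ --> X](mulr0 (hnorm X z)); apply: cvgM; first exact: cvg_cst.
  rewrite [X in X @ _ --> _](_ : _ = fine \o (fun n =>
      \int[nu]_(t in D) (hnorm X (s n t - f t))%:E)%E); first exact: fine_cvg sf.
  apply/funext => n /=; congr fine; apply: ae_eq_lower_integral.
  by apply: filterS fg => t h Dt; rewrite h.
apply/cvgrPdist_le => e e0; have /cvgrPdist_le/(_ e e0) := b0.
apply: filterS => n; rewrite sub0r normrN => h; apply: le_trans h.
have simi : nu.-integrable D (EFin \o (fun t => hip X (s n t) z)).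
  exact: (@finitely_valued_integrable _ (s n) (fun x => hip X x z) (fvs n)).
rewrite Iz -RintegralB//; last exact: zi.
rewrite (@eq_Rintegral _ _ _ _ _ (fun t => hip X (g t - s n t) z)); last first.
  by move=> t _; rewrite (hipBl PX).
have mgs : hmeas X (fun t => g t - s n t).
  by apply: (hmeasB PX) => //; apply: hmeas_simple.
have gsi : nu.-integrable D (EFin \o (fun t => hnorm X (g t - s n t))).
  by apply: eq_integrable (si n) => // t _ /=; rewrite (hnormBC PX).
apply: (le_trans (le_normr_Rintegral mD (zi _ mgs gsi))).
rewrite ger0_norm; last first.
  by rewrite mulr_ge0 ?hnorm_ge0// Rintegral_ge0// => t _; exact: hnorm_ge0.
rewrite -RintegralZl//; apply: le_Rintegral => //.
- exact: integrable_norm (zi _ mgs gsi).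
- exact: (@integrableZl _ _ _ _ _ mD (hnorm X z) _ (si n)).
- move=> t _; rewrite mulrC (hnormBC PX)//; apply: (cauchy_schwarz PX) => //.
  exact: hinB.
Qed.

End bochner_weak.

(** * Functions in H^1(0,T;X) *)

Section h1line.
Variables (R : realType) (E : lmodType R) (X : hspace E).
Hypothesis PX : prehilb X.
Local Notation leb := (@lebesgue_measure R).
Local Notation ip := (hip X).
Local Notation N := (hnorm X).

Definition clamp (T t : R) : R := Num.max 0 (Num.min t T).

Lemma clamp_itv (T t : R) : 0 <= T -> clamp T t \in `[0, T].
Proof. by move=> T0; rewrite in_itv/= /clamp le_max lexx/= ge_max T0 ge_min lexx orbT. Qed.

Lemma clamp_id (T t : R) : t \in `[0, T] -> clamp T t = t.
Proof. by rewrite in_itv/= /clamp => /andP[t0 tT]; rewrite (min_idPl tT) (max_idPr t0). Qed.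

Lemma clamp_clamp (T t : R) : 0 <= T -> clamp T (clamp T t) = clamp T t.
Proof. by move=> T0; apply: clamp_id; exact: clamp_itv. Qed.

Lemma clamp_le0 (T t : R) : t <= 0 -> 0 <= T -> clamp T t = 0.
Proof. by move=> t0 T0; apply/max_idPl; rewrite ge_min t0. Qed.

(* [U] in H^1(0,T), extended to the real line by its end values, with
   derivative [V]; the fundamental theorem is kept in weak form. *)
Record h1line (T : R) (U V : R -> E) : Prop := H1line {
  h1U : forall t, hin X (U t) ;
  h1V : hmeas X (V : measurableTypeR R -> E) ;
  h1V0 : forall t, ~ `]0, T[%classic t -> V t = 0 ;
  h1fin : (\int[leb]_t (ip (V t) (V t))%:E < +oo)%E ;
  h1ftc : forall a b z, a <= b -> hin X z ->
    ip (U b - U a) z = \int[leb]_(r in `]a, b]) ip (V r) z ;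
  h1clamp : forall t, U t = U (clamp T t)
}.

Section support.
Variables (T : R) (V : R -> E).
Hypotheses (mV : hmeas X (V : measurableTypeR R -> E)).
Hypotheses (V0 : forall t, ~ `]0, T[%classic t -> V t = 0).
Hypotheses (Vfin : (\int[leb]_t (ip (V t) (V t))%:E < +oo)%E).

Lemma sqr_hnorm_integrable : leb.-integrable setT (EFin \o (fun t => ip (V t) (V t))).
Proof.
have := @hip_integrable _ _ _ PX _ (measurableTypeR R) leb (cst 1) (@measurable_cst _ _ _ _ _ _)
  (fun=> ler01) setT V V measurableT mV mV.
under eq_integral do rewrite /= mul1r.
move=> /(_ Vfin Vfin); apply: eq_integrable => // t _ /=; by rewrite mul1r.
Qed.

(** On []0, T[] one has [|V| <= |V|^2 + 1], and [V] vanishes elsewhere. *)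
Lemma hnorm_integrable : leb.-integrable setT (EFin \o (fun t => N (V t))).
Proof.
have i1 := sqr_hnorm_integrable.
have i2 := @integrable_indic_itv R 0 T false true.
apply: (le_integrable measurableT _ _ (integrableD measurableT i1 i2)).
  by apply/measurable_EFinP; exact: (hmeas_hnorm PX).
move=> t _; rewrite /= lee_fin ger0_norm ?hnorm_ge0//.
rewrite ger0_norm ?addr_ge0 ?(hip_ge0 PX)// indicE.
have [tT|tT] := pselect (`]0, T[%classic t).
  by rewrite mem_set// -(sqr_hnorm PX); have := sqr_ge0 (N (V t) - 1); rewrite sqrrB1/=;
     have := hnorm_ge0 X (V t); rewrite -mulr_natl; nra.
by rewrite V0// (hnorm0 PX) addr_ge0 ?(hip_ge0 PX).
Qed.

Lemma h1_hip_integrable (D : set R) z : measurable D -> hin X z ->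
  leb.-integrable D (EFin \o (fun t => ip (V t) z)).
Proof.
move=> mD zX; apply: (@integrableS _ _ _ leb setT D _ measurableT mD (@subsetT _ D)).
apply: (@hip_cst_integrable _ _ _ PX _ (measurableTypeR R) leb setT measurableT V z mV zX).
exact: hnorm_integrable.
Qed.

End support.

(** The version [V] of [U'] vanishes off []0, T[], so the integral over []0, clamp T t[] can be
    taken over []-oo, t]] instead. Increments between arbitrary times then follow by subtraction,
    with no case distinction on their position relative to [[0, T]]. *)
Lemma H1_timeP (T : R) (U U' : R -> E) : 0 < T -> H1_time X T U U' ->
  exists2 V, h1line T (U \o clamp T) V & ae_eq leb `]0, T[%classic U' V.
Proof.
move=> T0 [UX U'b Ui].
have mI : measurable (`]0, T[%classic : set (measurableTypeR R)) by exact: measurable_itv.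
have [V [mV V0 U'V Vfin]] := bochnerL2_version PX mI U'b.
have {}Vfin : (\int[leb]_t (ip (V t) (V t))%:E < +oo)%E.
  apply: le_lt_trans Vfin; rewrite [leRHS]integral_mkcond.
  rewrite le_eqVlt; apply/orP; left; apply/eqP.
  apply: eq_integral => t _; rewrite patchE; case: ifPn => [_|]; first by rewrite /= mul1r.
  by rewrite notin_setE => /V0 ->; rewrite (hip0l PX)//; exact: hin0.
exists V => //.
have Uc t : hin X (U (clamp T t)) by apply: UX; apply: clamp_itv; exact: ltW.
have Ucl t : (U \o clamp T) t = (U \o clamp T) (clamp T t)
  by rewrite /= clamp_clamp// ltW.
split => // a b z ab zX /=.
- have gi D (mD : measurable D) := h1_hip_integrable mV V0 Vfin mD zX.
  have U0X : hin X (U 0) by apply: UX; rewrite in_itv/= lexx ltW.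
  have H t : ip (U (clamp T t) - U 0) z = \int[leb]_(r in `]-oo, t]) ip (V r) z.
    have cT := clamp_itv t (ltW T0).
    pose D := `]0, clamp T t[%classic : set (measurableTypeR R).
    have mD : measurable D by exact: measurable_itv.
    have Dfin : (leb D < +oo)%E.
      by rewrite lebesgue_measure_itv/=; case: ifP => // _; rewrite -EFinB ltry.
    have U'VD : ae_eq leb D U' V.
      apply: ae_eq_subset U'V => r; rewrite /D /= !in_itv/= => /andP[-> rc]/=.
      by apply: (lt_le_trans rc); move: cT; rewrite in_itv/= => /andP[].
    have Ni : leb.-integrable D (EFin \o (fun r => N (V r))).
      apply: (@integrableS _ _ _ leb setT D _ measurableT mD (@subsetT _ D)).
      exact: hnorm_integrable V0 Vfin.
    rewrite (bochner_integral_hip PX mD Dfin mV U'VD Ni (Ui _ cT) (hinB PX (Uc t) U0X) zX).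
    rewrite Rintegral_itv_bndo_bndc; last exact: gi.
    rewrite Rintegral_mkcond [RHS]Rintegral_mkcond; apply: eq_Rintegral => r _.
    rewrite !patchE.
    have [rT|/V0 ->] := pselect (`]0, T[%classic r); last first.
      by rewrite (hip0l PX)//; case: ifP; case: ifP.
    congr (if _ then _ else _); apply/idP/idP => /set_mem/=; rewrite in_itv/= => h;
      apply/mem_set; rewrite /= in_itv/=; move: rT h;
      rewrite /= !in_itv/= /clamp le_max le_min.
    + by move=> /andP[r0 rT] /andP[_]; rewrite leNgt r0/= => /andP[].
    + by move=> /andP[r0 rT] ->; rewrite r0 (ltW rT) orbT.
  rewrite (_ : U (clamp T b) - _ = (U (clamp T b) - U 0) - (U (clamp T a) - U 0)); last first.
    by rewrite opprB addrA subrK.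
  rewrite (hipBl PX) ?H//; [|exact: hinB..].
  rewrite Rintegral_itvB//; exact: gi.
Qed.

End h1line.

Section h1line_theory.
Variables (R : realType) (E : lmodType R) (X : hspace E).
Hypothesis PX : prehilb X.
Local Notation leb := (@lebesgue_measure R).
Local Notation ip := (hip X).
Local Notation N := (hnorm X).
Local Notation mR := (measurableTypeR R).
Variables (T : R) (U V : R -> E).
Hypotheses (T0 : 0 < T) (UV : h1line X T U V).

Lemma measurable_ocitv (a b : R) : measurable (`]a, b]%classic : set mR).
Proof. exact: measurable_itv. Qed.

Lemma lebesgue_ocitv (a b : R) : a <= b -> leb (`]a, b]%classic : set mR) = (b - a)%:E.
Proof.
rewrite lebesgue_measure_itv/= lte_fin le_eqVlt => /predU1P[->|->]; last by rewrite EFinB.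
by rewrite ltxx subrr.
Qed.

Lemma Rintegral_ocitv_cst (a b k : R) : a <= b -> \int[leb]_(r in `]a, b]) k = k * (b - a).
Proof.
move=> ab; rewrite Rintegral_cst; last exact: measurable_ocitv.
by congr (_ * _); exact: (congr1 fine (lebesgue_ocitv ab)).
Qed.

Lemma lebesgue_ocitv_lty (a b : R) : (leb (`]a, b]%classic : set mR) < +oo)%E.
Proof. by rewrite lebesgue_measure_itv/=; case: ifP => // _; rewrite -EFinB ltry. Qed.

Lemma h1_hip_int (D : set mR) z : measurable D -> hin X z ->
  leb.-integrable D (EFin \o (fun t => ip (V t) z)).
Proof. by case: UV => *; apply: h1_hip_integrable; eauto. Qed.

Lemma h1_norm_int (D : set mR) : measurable D ->
  leb.-integrable D (EFin \o (fun t => N (V t))).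
Proof.
case: UV => _ mV V0 Vf _ _ mD.
apply: (@integrableS _ _ _ leb setT D _ measurableT mD (@subsetT _ D)).
exact: hnorm_integrable V0 Vf.
Qed.

Lemma h1_sqr_int (D : set mR) : measurable D ->
  leb.-integrable D (EFin \o (fun t => ip (V t) (V t))).
Proof.
case: UV => _ mV V0 Vf _ _ mD.
apply: (@integrableS _ _ _ leb setT D _ measurableT mD (@subsetT _ D)).
exact: sqr_hnorm_integrable.
Qed.

Lemma h1_ftcE a b z : a <= b -> hin X z ->
  (\int[leb]_(r in `]a, b]) (ip (V r) z)%:E)%E = (ip (U b - U a) z)%:E.
Proof.
move=> ab zX; rewrite (h1ftc UV)// fineK//; apply: integrable_fin_num => //.
by apply: h1_hip_int => //; exact: measurable_ocitv.
Qed.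

Let VX t : hin X (V t). Proof. exact: (h1V UV).1. Qed.
Let UX t : hin X (U t). Proof. exact: (h1U UV). Qed.

(** The increment [x] is used as its own test vector, and Young's inequality with weight [b - a]
    gives [|x|^2 <= |x|^2 / 2 + (b - a) / 2] times the integral of [|V|^2]; the first term is
    absorbed. *)
Lemma h1_incr_le a b : a <= b ->
  ip (U b - U a) (U b - U a) <= (b - a) * \int[leb]_(r in `]a, b]) ip (V r) (V r).
Proof.
move=> ab; set x := U b - U a; have xX : hin X x by exact: hinB.
have mI := measurable_ocitv a b.
move: ab; rewrite le_eqVlt => /predU1P[ab|ab].
  by rewrite /x ab !subrr mul0r (hip0l PX)//; exact: hin0.
have ba : 0 < b - a by rewrite subr_gt0.
have h : ip x x <= \int[leb]_(r in `]a, b])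
   ((2 * (b - a))^-1 * ip x x + (b - a) / 2 * ip (V r) (V r)).
  rewrite [leLHS](h1ftc UV (ltW ab) xX); apply: le_Rintegral => //.
  - exact: h1_hip_int.
  - apply: Rintegrable_D => //; first exact/Rintegrable_cst/lebesgue_ocitv_lty.
    exact/Rintegrable_Z/h1_sqr_int.
  - move=> r _; have := hip_young PX (hinZ PX (b - a) (VX r)) xX.
    rewrite !(hipZl PX) ?(hipZr PX)//; last exact: hinZ.
    move=> y; rewrite -(ler_pM2l (_ : 0 < 2 * (b - a))) ?mulr_gt0//.
    rewrite [leRHS](_ : _ = ip x x + (b - a) * ((b - a) * ip (V r) (V r))).
      by rewrite -mulrA; lra.
    by field; rewrite lt0r_neq0.
rewrite RintegralD// in h; last 2 first.
  - exact/Rintegrable_cst/lebesgue_ocitv_lty.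
  - exact/Rintegrable_Z/h1_sqr_int.
rewrite (Rintegral_ocitv_cst _ (ltW ab)) RintegralZl// in h; last exact: h1_sqr_int.
rewrite (_ : (2 * (b - a))^-1 * ip x x * (b - a) = ip x x / 2) in h; last by field; rewrite lt0r_neq0.
lra.
Qed.

Lemma h1_cst_int (D : set mR) y : measurable D -> (leb D < +oo)%E -> hin X y ->
  leb.-integrable D (EFin \o (fun r => N (V r - y))).
Proof.
move=> mD Dfin yX.
have ci := Rintegrable_cst mD (N y) Dfin.
apply: (le_integrable mD _ _ (Rintegrable_D mD (h1_norm_int mD) ci)).
  apply/measurable_EFinP; apply: measurable_funTS; apply: (hmeas_hnorm PX).
  by apply: (hmeasB PX) => //; [exact: (h1V UV)|exact: hmeas_cst].
move=> r _; rewrite /= lee_fin !ger0_norm ?addr_ge0 ?hnorm_ge0//.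
by have := ler_hnormD PX (VX r) (hinN PX yX); rewrite (hnormN PX).
Qed.

(** The triangle inequality for the integral of [V - y], recovered from the weak form: the vector on
    the left is taken as test vector, and its norm is divided out. *)
Lemma h1_incr_cst a b y : a <= b -> hin X y ->
  N (U b - U a - (b - a) *: y) <= \int[leb]_(r in `]a, b]) N (V r - y).
Proof.
move=> ab yX; set x := U b - U a - (b - a) *: y.
have mI := measurable_ocitv a b; have fI := lebesgue_ocitv_lty a b.
have ByX : hin X (U b - U a) by exact: hinB.
have xX : hin X x by apply: hinB => //; exact: hinZ.
have [x0|x0] := eqVneq (N x) 0.
  by rewrite x0; apply: Rintegral_ge0 => r _; exact: hnorm_ge0.
have {}x0 : 0 < N x by rewrite lt_def x0 hnorm_ge0.
rewrite -(ler_pM2l x0) -expr2 (sqr_hnorm PX).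
have ci := Rintegrable_cst mI (ip y x) fI.
have -> : ip x x = \int[leb]_(r in `]a, b]) ip (V r - y) x.
  rewrite (@eq_Rintegral _ _ _ leb _ (fun r : mR => ip (V r) x - ip y x)); last first.
    by move=> r _; rewrite (hipBl PX).
  rewrite RintegralB//; last exact: h1_hip_int.
  rewrite -(h1ftc UV)// Rintegral_ocitv_cst// {1}/x (hipBl PX)//; last exact: hinZ.
  by rewrite (hipZl PX)// mulrC.
rewrite -RintegralZl//; last exact: h1_cst_int.
apply: le_Rintegral => //.
- apply: (@eq_integrable _ _ _ _ _ mI (EFin \o (fun r => ip (V r) x - ip y x))).
    by move=> r _ /=; rewrite (hipBl PX).
  exact: Rintegrable_B (h1_hip_int mI xX) ci.
- exact: (Rintegrable_Z mI (N x) (h1_cst_int mI fI yX)).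
- by move=> r _; rewrite mulrC; apply: (hip_le_norm PX) => //; exact: hinB.
Qed.

Let W := \int[leb]_r ip (V r) (V r).

(** Hoelder continuity of exponent 1/2. It yields strong measurability and boundedness of [U], and
    later the existence of a time of maximal error. *)
Lemma h1_hoelder a b : ip (U b - U a) (U b - U a) <= `|b - a| * W.
Proof.
wlog ab : a b / a <= b.
  move=> H; have [/H//|/ltW/H] := leP a b.
  by rewrite distrC -(sqr_hnorm PX) (hnormBC PX)// (sqr_hnorm PX).
rewrite ger0_norm ?subr_ge0//; apply: (le_trans (h1_incr_le ab)).
rewrite ler_wpM2l ?subr_ge0// /W -lee_fin.
have mI := measurable_ocitv a b.
have mT : measurable (setT : set mR) by [].
rewrite (fineK (integrable_fin_num mI (h1_sqr_int mI))).
rewrite (fineK (integrable_fin_num mT (h1_sqr_int mT))).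
apply: ge0_subset_integral => //; last by move=> r _; rewrite lee_fin (hip_ge0 PX).
exact: measurable_int (h1_sqr_int mT).
Qed.

Import HBNNSimple.

(** [U t] depends on [t] only through [clamp T t], which is nonnegative and measurable, hence a
    limit of simple functions [q n]. The functions [U \o q n] have finitely many values and converge
    to [U] by Hoelder continuity. *)
Lemma h1_hmeas : hmeas X (U : mR -> E).
Proof.
split => //.
have mc : measurable_fun setT (EFin \o (clamp T : mR -> mR)).
  apply/measurable_EFinP; apply: measurable_maxr => //; apply: measurable_minr => //.
have W0 : 0 <= W by apply: Rintegral_ge0 => r _; exact: (hip_ge0 PX).
pose q := nnsfun_approx measurableT mc.
have qc (t : mR) : q n t @[n --> \oo] --> clamp T t.
  have h : (EFin \o q^~ t) n @[n --> \oo] --> (clamp T t)%:E.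
    apply: (@cvg_nnsfun_approx _ _ _ _ measurableT _ mc) => // x _.
    by rewrite /= lee_fin; have := clamp_itv x (ltW T0); rewrite in_itv/= => /andP[].
  exact: (fine_cvg h).
exists (fun n t => U (q n t)).
  move=> n; apply/simpleP; split => //.
  by apply: (finitely_valued_comp U); split.
move=> t.
have h0 : Num.sqrt (`|q n t - clamp T t| * W) @[n --> \oo] --> 0.
  rewrite -[X in _ --> X]sqrtr0; apply: continuous_cvg; first exact: sqrt_continuous.
  rewrite [X in _ --> X](_ : 0 = 0 * W); last by rewrite mul0r.
  apply: cvgM; last exact: cvg_cst.
  rewrite (_ : 0 = `|clamp T t - clamp T t|); last by rewrite subrr normr0.
  by apply: cvg_norm; apply: cvgB; [exact: qc|exact: cvg_cst].
apply: (squeeze_cvgr _ (cvg_cst 0) h0); apply: nearW => n.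
rewrite hnorm_ge0/= (h1clamp UV t) ler_wsqrtr//; exact: h1_hoelder.
Qed.

Lemma h1_bounded : exists M, forall t, N (U t) <= M.
Proof.
exists (N (U 0) + Num.sqrt (T * W)) => t; rewrite (h1clamp UV t).
have := ler_hnormD PX (UX 0) (hinB PX (UX (clamp T t)) (UX 0)); rewrite subrKC.
move=> /le_trans; apply; rewrite lerD2l ler_wsqrtr// (le_trans (h1_hoelder _ _))//.
have := clamp_itv t (ltW T0); rewrite in_itv/= => /andP[c0 cT].
rewrite subr0 ger0_norm// ler_wpM2r//; apply: Rintegral_ge0 => r _; exact: (hip_ge0 PX).
Qed.

Lemma h1_VU_int (D : set mR) : measurable D ->
  leb.-integrable D (EFin \o (fun t => ip (V t) (U t))).
Proof.
move=> mD; have [M UM] := h1_bounded.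
apply: (le_integrable mD _ _ (Rintegrable_Z mD M (h1_norm_int mD))).
  apply/measurable_EFinP; apply: measurable_funTS; apply: (hmeas_hip PX).
    exact: (h1V UV).
  exact: h1_hmeas.
move=> t _; rewrite /= lee_fin (le_trans (cauchy_schwarz PX (VX t) (UX t)))//.
by rewrite (le_trans _ (ler_norm _))// mulrC ler_wpM2r ?hnorm_ge0.
Qed.

End h1line_theory.

(** * Chain rule for the squared norm *)

Section chain_rule.
Variables (R : realType) (E : lmodType R) (X : hspace E).
Hypothesis PX : prehilb X.
Local Notation leb := (@lebesgue_measure R).
Local Notation ip := (hip X).
Local Notation N := (hnorm X).
Local Notation mR := (measurableTypeR R).
Variables (T : R) (U V : R -> E).
Hypotheses (T0 : 0 < T) (UV : h1line X T U V).
Let VX t : hin X (V t). Proof. exact: (h1V UV).1. Qed.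
Let UX t : hin X (U t). Proof. exact: (h1U UV). Qed.

Section fubini.
Variables a b : R.

Let tri : set (mR * mR) := [set p | [/\ a < p.2, p.2 <= p.1 & p.1 <= b]].

Let G (p : mR * mR) : \bar R := (\1_tri p * ip (V p.1) (V p.2))%:E.

Let mtri : measurable tri.
Proof.
have m1 : measurable_fun setT (fst : mR * mR -> mR) := measurable_fst.
have m2 : measurable_fun setT (snd : mR * mR -> mR) := measurable_snd.
have -> : tri = ([set p | a < p.2] `&` [set p | p.2 <= p.1]) `&` [set p | p.1 <= b].
  by apply/seteqP; split => [p [? ? ?]|p [[? ?] ?]].
rewrite -[X in measurable X]setTI.
apply: measurableI => //; apply: measurableI; first apply: measurableI.
- have := measurable_fun_ltr (measurable_cst a : measurable_fun setT (cst a : mR * mR -> R)) m2.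
  by move=> /(_ measurableT [set true] _); rewrite setTI; apply.
- have := measurable_fun_ler m2 m1.
  by move=> /(_ measurableT [set true] _); rewrite setTI; apply.
- have := measurable_fun_ler m1 (measurable_cst b : measurable_fun setT (cst b : mR * mR -> R)).
  by move=> /(_ measurableT [set true] _); rewrite setTI; apply.
Qed.

Let mG : measurable_fun setT G.
Proof.
apply/measurable_EFinP; apply: measurable_funM; first exact: measurable_indic.
apply: (hmeas_hip PX).
- exact: (hmeas_comp measurable_fst (h1V UV)).
- exact: (hmeas_comp measurable_snd (h1V UV)).
Qed.

Let G_integrable : (leb \x leb)%E.-integrable setT G.
Proof.
have mN : measurable_fun setT (fun t : mR => N (V t)).
  by apply: (hmeas_hnorm PX); exact: (h1V UV).
pose F (p : mR * mR) : \bar R := (N (V p.1) * N (V p.2))%:E.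
have mF : measurable_fun setT F.
  apply/measurable_EFinP; apply: measurable_funM.
  - exact: (measurableT_comp mN measurable_fst).
  - exact: (measurableT_comp mN measurable_snd).
have FI : (leb \x leb)%E.-integrable setT F.
  apply/(integrable12ltyP _ _ mF).
  have /integrableP[_ Ni] := h1_norm_int PX UV (@measurableT _ mR).
  have Nfin : (\int[leb]_t `|(N (V t))%:E| \is a fin_num)%E.
    by rewrite ge0_fin_numE// integral_ge0.
  have mNa : measurable_fun setT (fun t : mR => `|(N (V t))%:E|%E).
    by apply: measurableT_comp => //; apply/measurable_EFinP.
  rewrite (eq_integral (fun x : mR => `|(N (V x))%:E| * \int[leb]_t `|(N (V t))%:E|)%E).
    rewrite (ge0_integralZr leb measurableT mNa)//; last exact: integral_ge0.
    by rewrite -(fineK Nfin) -EFinM ltry.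
  move=> x _; rewrite -(ge0_integralZl leb measurableT mNa)//.
  by apply: eq_integral => y _; rewrite /F -abseM.
apply: (le_integrable measurableT mG _ FI) => -[s r] _.
rewrite /G /F /= lee_fin normrM [leRHS]ger0_norm ?mulr_ge0 ?hnorm_ge0//.
rewrite indicE ger0_norm ?ler0n//.
case: (_ \in _); rewrite ?mul0r ?mulr_ge0 ?hnorm_ge0// mul1r.
exact: (cauchy_schwarz PX).
Qed.

(** Both sides are the integral of [<V s, V r>] over the triangle [a < r <= s <= b], integrated
    first in [r] or first in [s]. *)
Lemma h1_fubini :
  \int[leb]_(s in `]a, b]) ip (V s) (U s - U a) =
  \int[leb]_(r in `]a, b]) ip (V r) (U b - U r).
Proof.
rewrite /Rintegral; congr fine.
transitivity (\int[leb]_s \int[leb]_r G (s, r))%E.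
  rewrite integral_mkcond; apply: eq_integral => s _; rewrite patchE.
  case: ifPn => [/set_mem/=|].
    rewrite in_itv/= => /andP[sa sb].
    have uX : hin X (U s - U a) by exact: hinB.
    rewrite (hipC PX) -(h1_ftcE PX UV (ltW sa) (VX s)) integral_mkcond.
    apply: eq_integral => r _; rewrite patchE /G indicE.
    have -> : (r \in `]a, s]%classic) = ((s, r) \in tri).
      apply/idP/idP => /set_mem.
        by rewrite /= in_itv/= => /andP[ar rs]; apply/mem_set.
      by move=> [/= ar rs _]; apply/mem_set; rewrite /= in_itv/= ar.
    by case: ifP => _; rewrite ?mul0r// mul1r (hipC PX).
  rewrite notin_setE/= in_itv/= => sab.
  rewrite integral0_eq// => r _; rewrite /G indicE memNset ?mul0r// => -[/= ar rs sb].
  by apply: sab; rewrite (lt_le_trans ar rs).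
rewrite (Fubini G_integrable) [RHS]integral_mkcond.
apply: eq_integral => r _; rewrite patchE.
case: ifPn => [/set_mem/=|].
  rewrite in_itv/= => /andP[ra rb].
  rewrite (hipC PX) -(h1_ftcE PX UV rb (VX r)).
  transitivity (\int[leb]_(s in `[r, b]) (ip (V s) (V r))%:E)%E.
    rewrite [RHS]integral_mkcond.
    apply: eq_integral => s _; rewrite patchE /G indicE.
    have -> : (s \in `[r, b]%classic) = ((s, r) \in tri).
      apply/idP/idP => /set_mem.
        by rewrite /= in_itv/= => /andP[rs sb']; apply/mem_set.
      by move=> [/= _ rs sb']; apply/mem_set; rewrite /= in_itv/= rs.
    by case: ifP => _; rewrite ?mul0r// mul1r.
  (* The triangle contains its diagonal, whereas the fundamental theorem speaks of []r, b]]; a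
     single point is negligible. *)
  symmetry; apply: integral_itv_obnd_cbnd.
  have mI : measurable (`]r, b]%classic : set mR) by exact: measurable_itv.
  exact: measurable_int (h1_hip_int PX UV mI (VX r)).
rewrite notin_setE/= in_itv/= => rab.
rewrite integral0_eq// => s _; rewrite /G indicE memNset ?mul0r// => -[/= ar rs sb].
by apply: rab; rewrite ar (le_trans rs).
Qed.

End fubini.

(** Fubini gives [int <V, U - U a> = int <V, U b - U>]. Collecting the two integrals of [<V, U>]
    leaves [<U b - U a, U a + U b>], a difference of squares. *)
Lemma h1_chain_rule a b : a <= b ->
  ip (U b) (U b) - ip (U a) (U a) = 2 * \int[leb]_(r in `]a, b]) ip (V r) (U r).
Proof.
move=> ab; have mI : measurable (`]a, b]%classic : set mR) by exact: measurable_itv.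
have iz z : hin X z -> leb.-integrable `]a, b] (EFin \o (fun r => ip (V r) z)).
  exact: (h1_hip_int PX UV mI).
have iU := h1_VU_int PX T0 UV mI.
have := h1_fubini a b.
rewrite (@eq_Rintegral _ _ _ leb _ (fun s : mR => ip (V s) (U s) - ip (V s) (U a))); last first.
  by move=> s _; rewrite (hipBr PX).
rewrite [X in _ = X](@eq_Rintegral _ _ _ leb _ (fun s : mR => ip (V s) (U b) - ip (V s) (U s))); last first.
  by move=> s _; rewrite (hipBr PX).
rewrite !RintegralB//; [|exact: iz..].
rewrite -!(h1ftc UV)// !(hipBl PX)// (hipC PX (U b) (U a)).
by move=> h; lra.
Qed.

End chain_rule.

(** * Energy estimate for gradient flows *)

Section lebesgue_shift.
Variable R : realType.
Local Notation leb := (@lebesgue_measure R).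
Local Notation mR := (measurableTypeR R).

Let shiftr (c : R) : mR -> mR := fun t => t + c.

Let measurable_shiftr c : measurable_fun setT (shiftr c).
Proof.
apply: (@measurable_funD _ mR R setT idfun (cst c)); first exact: measurable_id.
exact: measurable_cst.
Qed.

(** The image measure under the translation agrees with Lebesgue measure on half-open intervals, and
    these determine it. *)
Lemma lebesgue_measure_shift (c : R) (A : set mR) : measurable A ->
  leb ((fun t => t + c) @^-1` A) = leb A.
Proof.
move=> mA; have ms := measurable_shiftr c.
pose nu : {measure set mR -> \bar R} :=
    measure_function_pushforward__canonical__measure_function_Measure leb ms.
apply/esym; apply: (@lebesgue_measure_unique R nu) => // _ [[a b] _ <-].
change (leb `]a, b]%classic = leb (shiftr c @^-1` `]a, b]%classic)).
rewrite (_ : shiftr c @^-1` _ = `]a - c, b - c]%classic).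
  rewrite !lebesgue_measure_itv/= !lte_fin ltrD2r -!EFinB.
  by rewrite (_ : b - c - (a - c) = b - a)//; ring.
by apply/seteqP; split => t /=; rewrite !in_itv/= ltrBlDr lerBrDr.
Qed.

Lemma ae_shift (c : R) (P : R -> Prop) :
  {ae leb, forall t, P t} -> {ae leb, forall t, P (t + c)}.
Proof.
move=> [N [mN N0 PN]]; exists ((fun t => t + c) @^-1` N); split => //.
- by rewrite -[X in measurable X]setTI; exact: (measurable_shiftr c).
- by rewrite lebesgue_measure_shift.
- by move=> t /= h; exact: PN.
Qed.

Lemma Rintegral_shift (c a b : R) (g : mR -> R) : leb.-integrable setT (EFin \o g) ->
  leb.-integrable setT (EFin \o (fun t => g (t + c))) /\
  \int[leb]_(t in `]a, b]) g (t + c) = \int[leb]_(t in `]a + c, b + c]) g t.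
Proof.
move=> gi; have ms := measurable_shiftr c.
have mg : measurable_fun setT (EFin \o g) by exact: measurable_int gi.
have mgc : measurable_fun setT (EFin \o (fun t => g (t + c))).
  exact: (measurableT_comp mg ms).
pose nu : {measure set mR -> \bar R} :=
    measure_function_pushforward__canonical__measure_function_Measure leb ms.
have nuE (D : set mR) (f : mR -> \bar R) : measurable D ->
    (\int[nu]_(t in D) f t = \int[leb]_(t in D) f t)%E.
  by move=> mD; apply: eq_measure_integral => A mA _; exact: lebesgue_measure_shift.
have gci : leb.-integrable setT (EFin \o (fun t => g (t + c))).
  apply/integrableP; split => //.
  have /integrableP[_] := gi; rewrite -nuE// ge0_integral_pushforward//.
  exact: measurableT_comp.
split => //; rewrite /Rintegral; congr fine.
have mI : measurable (`]a + c, b + c]%classic : set mR) by exact: measurable_itv.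
have mP : measurable (shiftr c @^-1` `]a + c, b + c]%classic).
  by rewrite -[X in measurable X]setTI; exact: (ms measurableT _ mI).
rewrite -(nuE _ _ mI) (integral_pushforward ms mg)//; last first.
  exact: (integrableS measurableT mP (@subsetT _ _)).
congr (integral _ _ _); apply/seteqP; split => t /=; rewrite /shiftr !in_itv/=;
  by rewrite ltrD2r lerD2r.
Qed.

(** Each of the [n] cells is translated back to []0, s]]. The variable [t] on the right is the
    offset of the grid [t + k s], and statements about almost every grid can thus be integrated. *)
Lemma Rintegral_grid (s : R) (n : nat) (g : mR -> R) : 0 <= s ->
  leb.-integrable setT (EFin \o g) ->
  \int[leb]_(t in `]0, n%:R * s]) g t =
  \int[leb]_(t in `]0, s]) \sum_(k < n) g (t + k%:R * s).
Proof.
move=> s0 gi.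
have gS (D : set mR) (f : mR -> R) : measurable D -> leb.-integrable setT (EFin \o f) ->
    leb.-integrable D (EFin \o f).
  by move=> mD; apply: (@integrableS _ _ _ leb setT D _ measurableT mD (@subsetT _ D)).
have mI a b : measurable (`]a, b]%classic : set mR) by exact: measurable_itv.
have gk (k : nat) := (Rintegral_shift (k%:R * s) 0 s gi).
have si (m : nat) : leb.-integrable setT (EFin \o (fun t => \sum_(k < m) g (t + k%:R * s))).
  elim: m => [|m IH].
    apply: (@eq_integrable _ _ _ _ _ measurableT (cst 0%E)); last exact: integrable0.
    by move=> t _ /=; rewrite big_ord0.
  apply: eq_integrable (Rintegrable_D measurableT IH (gk m).1) => // t _ /=.
  by rewrite big_ord_recr.
elim: n => [|n IH].
  rewrite mul0r set_itvoc0 Rintegral_set0; under eq_Rintegral do rewrite big_ord0.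
  by rewrite Rintegral_cst ?mul0r//; exact: mI.
have n0 : 0 <= n%:R * s by rewrite mulr_ge0.
have nn : n%:R * s <= n.+1%:R * s by rewrite ler_wpM2r// ler_nat.
have -> : \int[leb]_(t in `]0, n.+1%:R * s]) g t =
    \int[leb]_(t in `]0, n%:R * s]) g t + \int[leb]_(t in `]n%:R * s, n.+1%:R * s]) g t.
  rewrite -(@Rintegral_itvB _ g (BRight 0) (BRight (n.+1%:R * s)) (n%:R * s)) ?bnd_simp//.
    by rewrite subrKC.
  exact: gS.
rewrite IH [RHS](@eq_Rintegral _ _ _ leb _ (fun t : mR => \sum_(k < n) g (t + k%:R * s) + g (t + n%:R * s))).
  rewrite RintegralD//; [|exact: gS|exact: gS _ _ (gk n).1].
  by rewrite (gk n).2 add0r -addn1 natrD mulrDl mul1r [s + _]addrC.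
by move=> t _; rewrite big_ord_recr.
Qed.

Lemma Rintegral_grid_itv (T : R) (n : nat) (f : mR -> R) (s := T / n.+1%:R) : 0 < T ->
  leb.-integrable `]0, T] (EFin \o f) ->
  leb.-integrable `]0, s] (EFin \o (fun t => \sum_(k < n.+1) f (t + k%:R * s))) /\
  \int[leb]_(t in `]0, T]) f t = \int[leb]_(t in `]0, s]) \sum_(k < n.+1) f (t + k%:R * s).
Proof.
move=> T0 fi; have s0 : 0 < s by rewrite divr_gt0.
have mI a b : measurable (`]a, b]%classic : set mR) by exact: measurable_itv.
(* [f] is integrable on []0, T]] only, so it is extended by 0; grid points with offset in []0, s]]
   never leave []0, T]]. *)
pose G : mR -> R := f \_ `]0, T]%classic.
have Gi : leb.-integrable setT (EFin \o G).
  by move/(integrable_mkcond _ (mI 0 T)) : fi; rewrite restrict_EFin.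
have GE t (k : 'I_n.+1) : `]0, s]%classic t -> G (t + k%:R * s) = f (t + k%:R * s).
  rewrite /= in_itv/= => /andP[t0 ts]; rewrite /G patchE mem_set//= in_itv/=.
  have ks0 : 0 <= k%:R * s by apply: mulr_ge0 => //; exact: ltW.
  rewrite ltr_wpDr//=.
  have : k.+1%:R * s <= T.
    by rewrite /s mulrA ler_pdivrMr// [leRHS]mulrC ler_wpM2r ?ler_nat// ltW.
  by rewrite -natr1 mulrDl mul1r; lra.
have sumE t : `]0, s]%classic t ->
    \sum_(k < n.+1) G (t + k%:R * s) = \sum_(k < n.+1) f (t + k%:R * s).
  by move=> ts; apply: eq_bigr => k _; exact: GE.
have Ts : n.+1%:R * s = T by rewrite /s mulrC divfK.
split.
  apply: (@eq_integrable _ _ _ _ _ (mI 0 s) (EFin \o (fun t => \sum_(k < n.+1) G (t + k%:R * s)))).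
    by move=> t /set_mem ts /=; rewrite sumE.
  apply: (@integrableS _ _ _ leb setT _ _ measurableT (mI 0 s) (@subsetT _ _)).
  elim: (n.+1) => [|m IH].
    apply: (@eq_integrable _ _ _ _ _ measurableT (cst 0%E)); last exact: integrable0.
    by move=> t _ /=; rewrite big_ord0.
  apply: eq_integrable (Rintegrable_D measurableT IH (Rintegral_shift (m%:R * s) 0 s Gi).1) => //.
  by move=> t _ /=; rewrite big_ord_recr.
transitivity (\int[leb]_(t in `]0, n.+1%:R * s]) G t).
  by rewrite Ts; apply: eq_Rintegral => t tT; rewrite /G patchE tT.
rewrite (Rintegral_grid _ (ltW s0) Gi); apply: eq_Rintegral => t /set_mem ts.
exact: sumE.
Qed.

End lebesgue_shift.

(** * Left Lebesgue points *)

Section lebesgue_point.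
Variables (R : realType) (T : R).
Hypothesis T0 : 0 < T.
Local Notation leb := (@lebesgue_measure R).
Local Notation mR := (measurableTypeR R).

Let step (n : nat) : R := T / n.+1%:R.

Let step_gt0 n : 0 < step n. Proof. by rewrite divr_gt0. Qed.

Lemma step_cvg0 : T / n.+1%:R @[n --> \oo] --> (0 : R).
Proof.
rewrite [X in _ --> X](_ : 0 = T * 0); last by rewrite mulr0.
by apply: cvgM; [exact: cvg_cst|exact: cvg_harmonic].
Qed.

(** One-sided averages are needed because the difference quotients below look backwards. The
    intervals are not centred at [x], but they shrink to it nicely. *)
Lemma left_lebesgue_point (f : R -> R) : locally_integrable setT f ->
  {ae leb, forall x, (T / n.+1%:R)^-1 * (\int[leb]_(t in `]x - T / n.+1%:R, x]) f t)
     @[n --> \oo] --> f x}.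
Proof.
move=> locf; have := lebesgue_differentiation locf.
apply: (@filterS _ _ (ae_filter_ringOfSetsType leb)) => x fx.
pose I (x : R) (n : nat) := `]x - step n, x]%classic.
have leI y n : leb (I y n) = (step n)%:E.
  by rewrite /I lebesgue_ocitv ?lerBlDr ?lerDl ?ltW// opprB addrC subrK.
have nI y : nicely_shrinking y (I y).
  split; first by move=> n; exact: measurable_itv.
  have h n : 0 < 2 * step n by rewrite mulr_gt0.
  (* The interval lies in the ball of radius [2 * step n], whose length is four times its own. *)
  exists (4, fun n => PosNum (h n)); split => //=.
  - rewrite [X in _ --> X](_ : 0 = 2 * 0); last by rewrite mulr0.
    by apply: cvgM; [exact: cvg_cst|exact: step_cvg0].
  - move=> n t; rewrite /I /= in_itv/= => /andP[h1 h2]; rewrite ball_itv/= in_itv/=.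
    by have := step_gt0 n; lra.
  - move=> n; rewrite leI lebesgue_measure_ball; last exact/ltW/h.
    by rewrite -EFinM lee_fin; lra.
have := nice_lebesgue_differentiation nI locf fx.
move=> /fine_cvg; apply: cvg_trans; apply: near_eq_cvg; apply: nearW => n /=.
rewrite leI inver gt_eqF// fineM//.
have mI : measurable (I x n) by exact: measurable_itv.
apply: integrable_fin_num => //; apply/integrableP; split.
  by apply/measurable_EFinP; case: locf => + _ _; exact: measurable_funTS.
have cI : compact (`[x - step n, x]%classic : set R) by exact: segment_compact.
case: locf => mf _ /(_ _ (@subsetT _ _) cI).
apply: le_lt_trans; apply: ge0_subset_integral => //.
- by apply: measurableT_comp => //; apply/measurable_EFinP; exact: measurable_funTS.
- by move=> t; rewrite /I /= !in_itv/= => /andP[/ltW -> ->].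
Qed.

End lebesgue_point.

Section square_integrable.
Variables (R : realType) (E : lmodType R) (X : hspace E).
Hypothesis PX : prehilb X.
Context dT (T : measurableType dT) (nu : {measure set T -> \bar R}) (D : set T).
Hypothesis mD : measurable D.

Definition sqint (f : T -> E) :=
  hmeas X f /\ nu.-integrable D (EFin \o (fun t => hip X (f t) (f t))).

Lemma sqint_hip f g : sqint f -> sqint g ->
  nu.-integrable D (EFin \o (fun t => hip X (f t) (g t))).
Proof.
move=> [mf fi] [mg gi].
have L h : nu.-integrable D (EFin \o (fun t => hip X (h t) (h t))) ->
    (\int[nu]_(t in D) (cst 1 t * hip X (h t) (h t))%:E < +oo)%E.
  by move=> hi; under eq_integral do rewrite /= mul1r; exact: integrable_lty hi.
have := hip_integrable PX (@measurable_cst _ _ _ _ _ _) (fun=> ler01) mD mf mg (L _ fi) (L _ gi).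
by apply: eq_integrable => // t _ /=; rewrite mul1r.
Qed.

Lemma sqintD f g : sqint f -> sqint g -> sqint (fun t => f t + g t).
Proof.
move=> sf sg; split; first by apply: hmeasD => //; [exact: sf.1|exact: sg.1].
have fg := Rintegrable_Z mD 2 (sqint_hip sf sg).
apply: eq_integrable (Rintegrable_D mD (Rintegrable_D mD sf.2 fg) sg.2) => // t _ /=.
by rewrite (hip_addE PX)//; [exact: sf.1.1|exact: sg.1.1].
Qed.

Lemma sqintZ k f : sqint f -> sqint (fun t => k *: f t).
Proof.
move=> sf; split; first by apply: hmeasZ => //; exact: sf.1.
apply: eq_integrable (Rintegrable_Z mD (k ^+ 2) sf.2) => // t _ /=.
have fX := sf.1.1 t.
by rewrite (hipZl PX) ?(hipZr PX)// ?mulrA ?expr2//; exact: hinZ.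
Qed.

Lemma sqintB f g : sqint f -> sqint g -> sqint (fun t => f t - g t).
Proof.
move=> sf sg; have := sqintD sf (sqintZ (-1) sg).
by congr sqint; apply/funext => t; rewrite scaleN1r.
Qed.

Lemma bounded_sqint f (M : R) : (nu D < +oo)%E -> hmeas X f ->
  (forall t, D t -> hnorm X (f t) <= M) -> sqint f.
Proof.
move=> fD mf fM; split => //.
apply: measurable_bounded_integrable => //.
  by apply: measurable_funTS; exact: hmeas_hip.
exists (M ^+ 2); split => [|e Me t Dt]; first exact: num_real.
rewrite /= ger0_norm ?(hip_ge0 PX)// -(sqr_hnorm PX) (le_trans _ (ltW Me))//.
by rewrite ler_sqr ?nnegrE ?hnorm_ge0 ?fM// (le_trans _ (fM t Dt))// hnorm_ge0.
Qed.

End square_integrable.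

(** * Backward difference quotients *)

Section difference_quotient.
Variables (R : realType) (E : lmodType R) (X : hspace E).
Hypothesis PX : prehilb X.
Local Notation leb := (@lebesgue_measure R).
Local Notation ip := (hip X).
Local Notation N := (hnorm X).
Local Notation mR := (measurableTypeR R).
Variables (T : R) (U V : R -> E).
Hypotheses (T0 : 0 < T) (UV : h1line X T U V).
Let VX t : hin X (V t). Proof. exact: (h1V UV).1. Qed.
Let UX t : hin X (U t). Proof. exact: (h1U UV). Qed.

(** Backward, because the inclusion at time [t] will be tested with the earlier state [U (t - s)];
    [U] is constant before time 0, so that state exists for every [t]. *)
Definition diffq (s t : R) : E := s^-1 *: (U t - U (t - s)).

Lemma diffqX s t : hin X (diffq s t).
Proof. by apply: hinZ => //; exact: hinB. Qed.

Lemma diffq_near s t y : 0 < s -> hin X y ->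
  N (diffq s t - y) <= s^-1 * \int[leb]_(r in `]t - s, t]) N (V r - y).
Proof.
move=> s0 yX; have ts : t - s <= t by rewrite lerBlDr lerDl ltW.
have := h1_incr_cst PX UV ts yX; rewrite (_ : t - (t - s) = s) => [h|]; last by ring.
have -> : diffq s t - y = s^-1 *: (U t - U (t - s) - s *: y).
  by rewrite scalerBr scalerA mulVf ?scale1r// lt0r_neq0.
have BX : hin X (U t - U (t - s) - s *: y).
  by apply: hinB => //; [exact: hinB|exact: hinZ].
by rewrite (hnormZ PX)// gtr0_norm ?invr_gt0// ler_wpM2l// invr_ge0 ltW.
Qed.

Lemma diffq_sqr s t : 0 < s ->
  ip (diffq s t) (diffq s t) <= s^-1 * \int[leb]_(r in `]t - s, t]) ip (V r) (V r).
Proof.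
move=> s0; have ts : t - s <= t by rewrite lerBlDr lerDl ltW.
have := h1_incr_le PX UV ts; rewrite (_ : t - (t - s) = s) => [h|]; last by ring.
have BX : hin X (U t - U (t - s)) by exact: hinB.
rewrite /diffq (hipZl PX) ?(hipZr PX)//; last exact: hinZ.
by rewrite ler_wpM2l ?invr_ge0 ?(ltW s0)// -ler_pdivlMl ?invr_gt0// invrK.
Qed.

(* Vector-valued Lebesgue differentiation: it suffices to use the Lebesgue
   points of the countably many functions [|V - y|], [y] a value of one of the
   simple functions converging to [V]. *)
Lemma diffq_cvg : {ae leb, forall t,
  N (diffq (T / n.+1%:R) t - V t) @[n --> \oo] --> 0}.
Proof.
have [_ [s ss sV]] := h1V UV.
pose y m i := nth 0 (fset_set (range (s m)) : seq E) i.
have sm m : finite_set (range (s m)) by case: (ss m).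
have yX m i : hin X (y m i).
  rewrite /y; have [im|im] := ltnP i (size (fset_set (range (s m)))); last first.
    by rewrite nth_default//; exact: hin0.
  have := mem_nth 0 im; rewrite in_fset_set// => /set_mem[t _ <-].
  by case: (ss m).
have loc m i : locally_integrable setT (fun r => N (V r - y m i)).
  split.
  - apply: (hmeas_hnorm PX); apply: (hmeasB PX); first exact: (h1V UV).
    exact: hmeas_cst.
  - exact: openT.
  - move=> K _ cK; have mK := compact_measurable cK.
    have /integrableP[_] := h1_cst_int PX UV mK (compact_finite_measure cK) (yX m i).
    by [].
have := @ae_foralln _ mR _ leb _ (fun m => @ae_foralln _ mR _ leb _ (fun i =>
  left_lebesgue_point T0 (loc m i))).
apply: (@filterS _ _ (ae_filter_ringOfSetsType leb)) => t ht.
apply/cvgrPdist_le => e e0.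
have e30 : 0 < e / 3 by rewrite divr_gt0.
have /cvgrPdist_lt/(_ _ e30) := sV t; move=> [m _ /(_ m (leqnn m))] /=.
rewrite sub0r normrN ger0_norm ?hnorm_ge0// => sm3.
have [i yi] : exists i, y m i = s m t.
  exists (index (s m t) (fset_set (range (s m)) : seq E)); rewrite /y nth_index//.
  by rewrite in_fset_set//; apply/mem_set; exists t.
have sX : hin X (s m t) by rewrite -yi.
have /cvgrPdist_lt/(_ _ e30) := ht m i; rewrite yi.
apply: filterS => n hn; rewrite sub0r normrN ger0_norm ?hnorm_ge0//.
have dq := diffq_near t (divr_gt0 T0 (ltr0Sn _ n)) sX.
apply: (le_trans (ler_hnormB_trans PX (diffqX _ _) sX (VX t))).
move: hn; rewrite distrC ltr_norml => /andP[_ hn].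
rewrite (hnormBC PX (VX t))// in hn; lra.
Qed.

Lemma hmeas_diffq s : hmeas X (diffq s : mR -> E).
Proof.
have mU := h1_hmeas PX T0 UV.
apply: (hmeasZ PX); apply: (hmeasB PX) => //.
apply: (hmeas_comp (phi := (fun t : mR => t - s) : mR -> mR) _ mU).
apply: (@measurable_funD _ mR R setT idfun (cst (- s))); first exact: measurable_id.
exact: measurable_cst.
Qed.

End difference_quotient.

Section energy_estimate.
Variables (R : realType) (E : lmodType R) (X : hspace E).
Hypothesis PX : prehilb X.
Local Notation leb := (@lebesgue_measure R).
Local Notation ip := (hip X).
Local Notation N := (hnorm X).
Local Notation mR := (measurableTypeR R).
Variables (T : R) (U V F : R -> E) (Psi : E -> \bar R) (U0 : E) (phi0 : R).
Hypotheses (T0 : 0 < T) (UV : h1line X T U V).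
Hypotheses (mF : hmeas X (F : mR -> E)).
Hypotheses (Ffin : (\int[leb]_t (ip (F t) (F t))%:E < +oo)%E).
Hypotheses (Psi0 : forall x, (0 <= Psi x)%E) (PsiU0 : Psi U0 = phi0%:E).
Hypotheses (U0X : hin X U0) (UU0 : N (U 0 - U0) = 0).
Hypothesis flow : {ae leb, forall t, `]0, T[%classic t ->
  subdifferential X Psi (U t) (F t - V t)}.
Let VX t : hin X (V t). Proof. exact: (h1V UV).1. Qed.
Let UX t : hin X (U t). Proof. exact: (h1U UV). Qed.
Let FX t : hin X (F t). Proof. exact: mF.1. Qed.
Let xiX t : hin X (F t - V t). Proof. exact: hinB. Qed.

Section one_step.
Variable n : nat.
Let s : R := T / n.+1%:R.
Let s0 : 0 < s. Proof. exact: divr_gt0. Qed.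
Let A := diffq U s.
Let AX t : hin X (A t). Proof. by apply: (diffqX PX UV). Qed.
Let g t := ip (F t - V t) (A t).

(* Telescoping eliminates the (possibly non-measurable) energies [Psi (U t)]
   at the intermediate grid points. *)
Lemma grid_telescope : {ae leb, forall t, `]0, s[%classic t ->
  - phi0 <= s * \sum_(k < n.+1) g (t + k%:R * s)}.
Proof.
have := @ae_foralln _ mR _ leb _ (fun k : nat => ae_shift (k%:R * s) flow).
apply: (@filterS _ _ (ae_filter_ringOfSetsType leb)) => t ht.
rewrite /= in_itv/= => /andP[t0 ts].
have hk k : (k < n.+1)%N -> subdifferential X Psi (U (t + k%:R * s))
    (F (t + k%:R * s) - V (t + k%:R * s)).
  move=> kn; have ks0 : 0 <= k%:R * s by apply: mulr_ge0 => //; exact: ltW.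
  apply: ht; rewrite /= in_itv/= ltr_wpDr//=.
  have : k.+1%:R * s <= T.
    by rewrite /s mulrA ler_pdivrMr// [leRHS]mulrC ler_wpM2r ?ler_nat// ltW.
  by rewrite -natr1 mulrDl mul1r; lra.
have sA r : s *: A r = U r - U (r - s).
  by rewrite /A /diffq scalerA mulfV ?scale1r// lt0r_neq0.
have H m : (m < n.+1)%N ->
    (Psi (U (t + m%:R * s)) <= (phi0 + s * \sum_(k < m.+1) g (t + k%:R * s))%:E)%E.
  elim: m => [|m IH] mn.
    (* At the first grid point [t < s], so [U (t - s)] is the value of [U] at 0. The inclusion is
       tested with [U0], where the energy is known; the two vectors are at distance 0. *)
    have [_ _ /(_ _ U0X)] := hk _ mn.
    rewrite PsiU0 big_ord1 mul0r addr0.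
    set P := Psi (U t); set x := ip _ _ => h.
    have -> : s * g t = - x.
      rewrite /g -(hipZr PX)// sA (h1clamp UV (t - s)) clamp_le0 ?(ltW T0)//; last by lra.
      rewrite /x -(hipNr PX)//; last exact: hinB.
      rewrite opprB !(hipBr PX)//; congr (_ - _).
      have := hip_eq0l PX (hinB PX (UX 0) U0X) (xiX t) UU0.
      by rewrite (hipC PX) (hipBr PX)// => /eqP; rewrite subr_eq0 => /eqP.
    by rewrite EFinD EFinN leeBrDr.
  have [_ _ /(_ _ (UX (t + m%:R * s)))] := hk _ mn.
  set P := Psi _; set x := ip _ _ => h.
  have xE : s * g (t + m.+1%:R * s) = - x.
    rewrite /g -(hipZr PX)// sA /x -(hipNr PX)//; last exact: hinB.
    rewrite opprB; congr (ip _ (_ - U _)).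
    by rewrite -natr1 mulrDl mul1r; ring.
  rewrite big_ord_recr/= mulrDr xE addrA EFinD EFinN leeBrDr//.
  by apply: (le_trans h); exact: (IH (ltnW mn)).
have := le_trans (Psi0 _) (H n (ltnSn n)).
by rewrite lee_fin; lra.
Qed.

Let mI a b : measurable (`]a, b]%classic : set mR). Proof. exact: measurable_itv. Qed.

Let sqV (D : set mR) : measurable D -> sqint X leb D V.
Proof. by move=> mD; split; [exact: (h1V UV)|exact: (h1_sqr_int PX UV mD)]. Qed.

Let sqF (D : set mR) : measurable D -> sqint X leb D F.
Proof.
move=> mD; split => //.
apply: (@integrableS _ _ _ leb setT D _ measurableT mD (@subsetT _ D)).
exact: sqr_hnorm_integrable.
Qed.

Let sqA : sqint X leb `]0, T] A.
Proof.
have [M UM] := h1_bounded PX T0 UV.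
apply: (@bounded_sqint _ _ _ PX _ _ leb _ (mI 0 T) A (s^-1 * (M + M))).
- exact: lebesgue_ocitv_lty.
- exact: hmeas_diffq UV s.
- move=> t _; rewrite /A /diffq (hnormZ PX); last exact: hinB.
  rewrite gtr0_norm ?invr_gt0// ler_wpM2l ?invr_ge0 ?(ltW s0)//.
  apply: (le_trans (ler_hnormD PX (UX _) (hinN PX (UX _)))).
  by rewrite (hnormN PX)// lerD.
Qed.

Let W := \int[leb]_t ip (V t) (V t).

(** [|A|^2] is at most the mean of [|V|^2] over the preceding cell. Along one grid these cells are
    adjacent, so the sum of the means is at most [s^-1 * W] for every offset, and the offset runs
    through an interval of length [s]. *)
Lemma diffq_L2_le : \int[leb]_(t in `]0, T]) ip (A t) (A t) <= W.
Proof.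
have [Si ->] := Rintegral_grid_itv n T0 sqA.2.
pose v t := ip (V t) (V t).
have vi (D : set mR) : measurable D -> leb.-integrable D (EFin \o v).
  by move=> mD; exact: (sqV mD).2.
have v0 t : 0 <= v t by exact: hip_ge0.
have tele m t : \sum_(k < m) \int[leb]_(r in `]t + k%:R * s - s, t + k%:R * s]) v r =
    \int[leb]_(r in `]t - s, t + m%:R * s - s]) v r.
  elim: m => [|m IH]; first by rewrite big_ord0 mul0r addr0 set_itvoc0 Rintegral_set0.
  rewrite big_ord_recr/= IH.
  have ms : 0 <= m%:R * s by apply: mulr_ge0 => //; exact: ltW.
  have e : t + m.+1%:R * s - s = t + m%:R * s by rewrite -natr1 mulrDl mul1r; ring.
  rewrite e -(@Rintegral_itvB _ v (BRight (t - s)) (BRight (t + m%:R * s)) (t + m%:R * s - s)) ?bnd_simp.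
  - by rewrite subrKC.
  - exact: vi.
  - by rewrite lerD2r lerDl.
  - by rewrite lerBlDr lerDl ltW.
have leW a b : \int[leb]_(r in `]a, b]) v r <= W.
  have mT : measurable (setT : set mR) by [].
  rewrite -lee_fin (fineK (integrable_fin_num (mI a b) (vi _ (mI a b)))).
  rewrite (fineK (integrable_fin_num mT (vi _ mT))).
  apply: ge0_subset_integral => //; last by move=> r _; rewrite lee_fin.
  exact: measurable_int (vi _ mT).
have Wi := Rintegrable_cst (mI 0 s) (s^-1 * W) (lebesgue_ocitv_lty 0 s).
apply: (@le_trans _ _ (\int[leb]_(t in `]0, s]) (s^-1 * W))).
  apply: le_Rintegral => // t _.
  rewrite (le_trans _ (ler_wpM2l _ (leW (t - s) (t + n.+1%:R * s - s))))//; last first.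
    by rewrite invr_ge0 ltW.
  rewrite -tele mulr_sumr; apply: ler_sum => k _; exact: (diffq_sqr PX UV).
by rewrite Rintegral_ocitv_cst ?(ltW s0)// subr0 mulrC mulrA mulfV ?mul1r// lt0r_neq0.
Qed.

Let F2 := \int[leb]_t ip (F t) (F t).

Let leT (f : mR -> R) : (forall t, 0 <= f t) -> leb.-integrable setT (EFin \o f) ->
  \int[leb]_(t in `]0, T]) f t <= \int[leb]_t f t.
Proof.
move=> f0 fi; have fT := @integrableS _ _ _ leb setT _ _ measurableT (mI 0 T) (@subsetT _ _) fi.
have mT : measurable (setT : set mR) by [].
rewrite -lee_fin (fineK (integrable_fin_num (mI 0 T) fT)) (fineK (integrable_fin_num mT fi)).
apply: ge0_subset_integral => //; last by move=> r _; rewrite lee_fin.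
exact: measurable_int fi.
Qed.

(* Integrates [2 <F - V, A> <= |F|^2 + 2 |A|^2 + |V|^2 - |V + A|^2]. *)
Lemma one_step_bound :
  leb.-integrable `]0, T] (EFin \o (fun t => ip (V t + A t) (V t + A t))) /\
  \int[leb]_(t in `]0, T]) ip (V t + A t) (V t + A t) <= F2 + 3 * W + 2 * phi0.
Proof.
have mT : measurable (setT : set mR) by [].
have [sV sF sA] := And3 (sqV (mI 0 T)) (sqF (mI 0 T)) sqA.
have gi := sqint_hip PX (mI 0 T) (sqintB PX (mI 0 T) sF sV) sA.
have h1 : - phi0 <= \int[leb]_(t in `]0, T]) g t.
  have [Si e] := Rintegral_grid_itv n T0 gi; rewrite {}e.
  have mIo : measurable (`]0, s[%classic : set mR) by exact: measurable_itv.
  have sub : `]0, s[%classic `<=` `]0, s]%classic.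
    by move=> t /=; rewrite !in_itv/= => /andP[-> /ltW].
  have Sio := integrableS (mI 0 s) mIo sub Si.
  rewrite -Rintegral_itv_bndo_bndc//.
  have ci := Rintegrable_cst (mI 0 s) (s^-1 * - phi0) (lebesgue_ocitv_lty 0 s).
  have cio := integrableS (mI 0 s) mIo sub ci.
  have -> : - phi0 = \int[leb]_(t in `]0, s[) (s^-1 * - phi0).
    rewrite Rintegral_itv_bndo_bndc// Rintegral_ocitv_cst ?(ltW s0)// subr0.
    by rewrite mulrC mulrA mulfV ?mul1r// lt0r_neq0.
  apply: ae_le_Rintegral => //.
  apply: (@filterS _ _ (ae_filter_ringOfSetsType leb)) grid_telescope => t /[apply].
  by rewrite ler_pdivrMl.
(* [h2] enters with factor 2 and [h3] with factor 1, which makes [3 * W]; [h1] contributes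
   [2 * phi0]. *)
have h2 := diffq_L2_le.
have h3 : \int[leb]_(t in `]0, T]) ip (V t) (V t) <= W.
  by apply: leT => [t|]; [exact: hip_ge0|exact: (sqV mT).2].
have h4 : \int[leb]_(t in `]0, T]) ip (F t) (F t) <= F2.
  by apply: leT => [t|]; [exact: hip_ge0|exact: (sqF mT).2].
have sVA := sqintD PX (mI 0 T) sV sA.
split; first exact: sVA.2.
have m := mI 0 T.
have iA := Rintegrable_Z m 2 sA.2; have iG := Rintegrable_Z m (-2) gi.
have iFA := Rintegrable_D m sF.2 iA; have iFAV := Rintegrable_D m iFA sV.2.
have h5 : \int[leb]_(t in `]0, T]) ip (V t + A t) (V t + A t) <=
    \int[leb]_(t in `]0, T]) (ip (F t) (F t) + 2 * ip (A t) (A t) + ip (V t) (V t) + (- 2) * g t).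
  apply: le_Rintegral => //; [exact: sVA.2|exact: Rintegrable_D| ].
  move=> t _; rewrite /g (hip_addE PX)// (hipBl PX)//.
  by have := hip_young PX (FX t) (AX t); lra.
rewrite (RintegralD m iFAV iG) (RintegralD m iFA sV.2) (RintegralD m sF.2 iA) in h5.
rewrite (RintegralZl _ m sA.2) (RintegralZl _ m gi) in h5.
lra.
Qed.

End one_step.

(** The quotients [A n] tend to [V] almost everywhere, so Fatou's lemma for [|V + A n|^2] gives
    [4 W <= F2 + 3 W + 2 phi0], and [3 W] cancels. Completing the square is what makes convergence
    almost everywhere sufficient. *)
Lemma energy_estimate :
  \int[leb]_t ip (V t) (V t) <= \int[leb]_t ip (F t) (F t) + 2 * phi0.
Proof.
set W := \int[leb]_t ip (V t) (V t); set F2 := \int[leb]_t ip (F t) (F t).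
have mI a b : measurable (`]a, b]%classic : set mR) by exact: measurable_itv.
have mT : measurable (setT : set mR) by [].
pose A n := diffq U (T / n.+1%:R).
have mA n : hmeas X (A n : mR -> E) by exact: hmeas_diffq UV _.
have AX n t : hin X (A n t) by apply: (diffqX PX UV).
pose f n t := (ip (V t + A n t) (V t + A n t))%:E.
have mf n : measurable_fun `]0, T]%classic (f n : mR -> \bar R).
  have mVA : hmeas X (fun t : mR => V t + A n t) := hmeasD PX (h1V UV) (mA n).
  apply/measurable_EFinP; apply: measurable_funTS; exact: (hmeas_hip PX mVA mVA).
have f0 n t : `]0, T]%classic t -> (0 <= f n t)%E by rewrite lee_fin hip_ge0.
have := @fatou _ mR _ leb _ (mI 0 T) f mf f0.
have -> : (\int[leb]_(t in `]0%R, T]) limn_einf (f^~ t) = (4 * W)%:E)%E.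
  transitivity (\int[leb]_(t in `]0%R, T]) (4 * ip (V t) (V t))%:E)%E.
    apply: ae_eq_lower_integral.
    apply: (@filterS _ _ (ae_filter_ringOfSetsType leb)) (diffq_cvg PX T0 UV) => t ht _.
    have c : f n t @[n --> \oo] --> (4 * ip (V t) (V t))%:E.
      apply: cvg_EFin; first exact: nearW.
      have h := hip_cvg PX (fun n => AX n t) (fun n => AX n t) (VX t) (VX t) ht ht.
      have c0 : N (V t - V t) @[n --> \oo] --> (0 : R).
        by rewrite subrr (hnorm0 PX); exact: cvg_cst.
      have h' := hip_cvg PX (fun n => VX t) (fun n => AX n t) (VX t) (VX t) c0 ht.
      rewrite (_ : fine \o _ = fun n => ip (V t) (V t) + 2 * ip (V t) (A n t) + ip (A n t) (A n t)).
        rewrite (_ : 4 * _ = ip (V t) (V t) + 2 * ip (V t) (V t) + ip (V t) (V t)); last by ring.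
        apply: cvgD => //; apply: cvgD; first exact: cvg_cst.
        by apply: cvgM => //; exact: cvg_cst.
      by apply/funext => n /=; rewrite (hip_addE PX).
    by rewrite (cvg_limn_einf_sup c).1.
  have Vi := h1_sqr_int PX UV mT.
  have ViT := h1_sqr_int PX UV (mI 0 T).
  under eq_integral do rewrite EFinM.
  rewrite integralZl// /W EFinM (fineK (integrable_fin_num mT Vi)); congr (_ * _)%E.
  rewrite integral_mkcond; apply: eq_integral => t _; rewrite patchE.
  case: ifPn => //; rewrite notin_setE => tT.
  have Vt : V t = 0; last by rewrite /= Vt (hip0l PX)//; exact: hin0.
  apply: (h1V0 UV) => h; apply: tT; by move: h; rewrite /= !in_itv/= => /andP[-> /ltW].
move=> h; suff : 4 * W <= F2 + 3 * W + 2 * phi0 by lra.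
rewrite -lee_fin (le_trans h)//.
have bnd n : (\int[leb]_(t in `]0%R, T]) f n t <= (F2 + 3 * W + 2 * phi0)%:E)%E.
  have [VAi] := one_step_bound n.
  by rewrite -lee_fin (fineK (integrable_fin_num (mI 0 T) VAi)).
rewrite limn_einf_lim; apply: lime_le; first exact: is_cvg_einfs.
by apply: nearW => n; apply: (le_trans _ (bnd n)); apply: ereal_inf_lbound; exists n => /=.
Qed.

End energy_estimate.

(** * The fundamental lemma of the calculus of variations *)

Section smooth_real.
Variable R : realType.
Implicit Types (f g : R -> R) (k : nat) (p : {poly R}).

Fixpoint Cn (k : nat) f : Prop :=
  match k with
  | 0%N => continuous f
  | k'.+1 => (forall x, derivable f x 1) /\ Cn k' (derive1 f)
  end.

Definition smooth f := forall k, Cn k f.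

Lemma derivable_continuous f : (forall x, derivable f x 1) -> continuous f.
Proof. by move=> df x; apply: differentiable_continuous; apply/derivable1_diffP. Qed.

Lemma CnW k f : Cn k.+1 f -> Cn k f.
Proof.
elim: k f => [|k IH] f [df Cf]; first exact: derivable_continuous.
by split => //; exact: IH.
Qed.

Lemma CnD k f g : Cn k f -> Cn k g -> Cn k (fun x => f x + g x).
Proof.
elim: k f g => [|k IH] f g; first by move=> cf cg x; apply: cvgD; [exact: cf|exact: cg].
move=> [df Cf] [dg Cg]; split; first by move=> x; exact: derivableD.
rewrite (_ : derive1 _ = fun x => derive1 f x + derive1 g x); first exact: IH.
by apply/funext => x; rewrite !derive1E deriveD.
Qed.

Lemma CnM k f g : Cn k f -> Cn k g -> Cn k (fun x => f x * g x).
Proof.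
elim: k f g => [|k IH] f g; first by move=> cf cg x; apply: cvgM; [exact: cf|exact: cg].
move=> Cf Cg; have [df Cf'] := Cf; have [dg Cg'] := Cg.
split; first by move=> x; exact: derivableM.
rewrite (_ : derive1 _ = fun x => f x * derive1 g x + g x * derive1 f x).
  by apply: CnD; apply: IH => //; exact: CnW.
by apply/funext => x; rewrite !derive1E deriveM.
Qed.

Lemma Cn_affine k f (a b : R) : Cn k f -> Cn k (fun x => f (a * x + b)).
Proof.
have daf (x : R) : is_derive x (1 : R) (fun y : R => a * y + b) a.
  have h := is_deriveD (is_deriveZ a (is_derive_id x (1 : R))) (is_derive_cst b x (1 : R)).
  by apply: is_derive_eq h _; rewrite addr0 [LHS]mulr1.
elim: k f => [|k IH] f.
  move=> cf x; apply: continuous_comp; last exact: cf.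
  by apply: derivable_continuous => y; case: (daf y).
move=> [df Cf].
have dfa (x : R) : is_derive x (1 : R) (fun x : R => f (a * x + b)) (a * derive1 f (a * x + b)).
  have h : is_derive (a * x + b) (1 : R) f (derive1 f (a * x + b)).
    by rewrite derive1E; exact: derivableP.
  by rewrite mulrC; exact: (@is_derive1_comp R f (fun y => a * y + b) x _ _ h (daf x)).
split; first by move=> x; by case: (dfa x).
rewrite (_ : derive1 _ = fun x => a * derive1 f (a * x + b)).
  apply: (@CnM k (cst a)); last exact: IH.
  elim: k {Cf IH} => [|k IH]; first by move=> x; exact: cst_continuous.
  split; first by move=> x; exact: derivable_cst.
  rewrite (_ : derive1 _ = cst 0); last by apply/funext => x; rewrite derive1_cst.
  elim: k {IH} => [|k IH]; first by move=> x; exact: cst_continuous.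
  split; first by move=> x; exact: derivable_cst.
  by rewrite (_ : derive1 _ = cst 0)//; apply/funext => x; rewrite derive1_cst.
by apply/funext => x; rewrite derive1E; by case: (dfa x).
Qed.

(** [exp y = (exp (y / k)) ^ k >= (y / k) ^ k], whence the constant [k ^ k]. *)
Lemma expr_expRN_bound k : exists C : R, forall y : R, 0 <= y -> y ^+ k * expR (- y) <= C.
Proof.
exists (k%:R ^+ k) => y y0; rewrite expRN ler_pdivrMr ?expR_gt0//.
case: k => [|k]; first by rewrite !expr0 mul1r -expR0 ler_expR.
have -> : expR y = expR (y / k.+1%:R) ^+ k.+1.
  by rewrite -expRM_natl -mulr_natl mulrCA mulfV ?mulr1.
rewrite -exprMn lerXn2r ?nnegrE ?mulr_ge0 ?expR_ge0//.
rewrite mulrC -ler_pdivrMr// (le_trans _ (expR_ge1Dx _))// lerDr//.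
Qed.

Lemma poly_expRN_bound p : exists C : R, forall y : R, 0 <= y -> `|p.[y]| * expR (- y) <= C.
Proof.
have [C Ck] := choice expr_expRN_bound.
exists (\sum_(i < size p) `|p`_i| * C i) => y y0.
rewrite horner_coef (le_trans (ler_wpM2r (expR_ge0 _) (ler_norm_sum _ _ _)))//.
rewrite mulr_suml; apply: ler_sum => i _.
rewrite normrM -mulrA ler_wpM2l// normrX (ger0_norm y0); exact: Ck.
Qed.

(* Derivatives of [exp (- 1 / x)], extended by 0, are of this form. *)
Definition flat p (x : R) : R := if 0 < x then p.[x^-1] * expR (- x^-1) else 0.

(** With [y = 1 / x] and [dy/dx = - y^2], the derivative of [p(y) exp(-y)] is
    [y^2 (p(y) - p'(y)) exp(-y)]. *)
Definition flat_deriv p : {poly R} := 'X^2 * (p - p^`()).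

Lemma is_derive_flat p (x : R) : is_derive x (1 : R) (flat p) (flat (flat_deriv p) x).
Proof.
have [x0|x0|->] := ltgtP x 0.
- rewrite /flat [X in is_derive _ _ _ X]ifF; last by apply/negbTE; rewrite -leNgt ltW.
  apply: (@near_eq_is_derive _ _ _ (cst 0)) => //.
  near=> y; rewrite ifF//; apply/negbTE; rewrite -leNgt; near: y.
  by apply: filterS (lt_nbhsl x0) => y /ltW.
- rewrite /flat [X in is_derive _ _ _ X]ifT//.
  refine (near_eq_is_derive (f := fun y : R => p.[y^-1] * expR (- y^-1)) _ _).
    near=> y; rewrite ifT//; near: y; exact: lt_nbhsr.
  have xn0 : x != 0 by rewrite gt_eqF.
  have dV : is_derive x (1 : R) (fun y : R => y^-1) (- x ^- 2).
    by apply: is_derive_eq (@is_deriveV R id x 1 1 xn0 (is_derive_id x (1 : R))) _; rewrite [LHS]mulr1.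
  have dp : is_derive x (1 : R) (fun y => p.[y^-1]) (p^`().[x^-1] * - x ^- 2).
    exact: (@is_derive1_comp R (horner p) (fun y => y^-1) x _ _ (is_derive_poly _ _) dV).
  have de : is_derive x (1 : R) (fun y => expR (- y^-1)) (expR (- x^-1) * x ^- 2).
    have dN : is_derive x (1 : R) (fun y : R => - y^-1) (x ^- 2).
      by apply: is_derive_eq (is_deriveN dV) _; rewrite opprK.
    exact: (@is_derive1_comp R expR (fun y => - y^-1) x _ _ (is_derive_expR _) dN).
  apply: is_derive_eq (is_deriveM dp de) _.
  by rewrite /flat_deriv !(hornerM, hornerX, hornerD, hornerN) /GRing.scale/=; field.
- have -> : flat (flat_deriv p) 0 = 0 by rewrite /flat ltxx.
  (* Of the two extra powers of [1 / h], one absorbs the division by [h] in the difference quotient,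
     and the other leaves the bound [C h], which tends to 0. *)
  have [C Cp] := poly_expRN_bound ('X^2 * p).
  have lim0 : h^-1 *: (flat p (h *: 1 + 0) - flat p 0) @[h --> 0^'] --> (0 : R).
    have C0 : `|h| * C @[h --> (0:R)^'] --> (0 : R).
      rewrite [X in _ --> X](_ : 0 = `|0 : R| * C); last by rewrite normr0 mul0r.
      apply: cvgM; last exact: cvg_cst.
      by apply: cvg_norm; exact: cvg_within.
    apply/cvgrPdist_le => e e0; have /cvgrPdist_le/(_ e e0) := C0.
    apply: filterS2 (nbhs_dnbhs_neq (0 : R)) => h h0.
    rewrite !sub0r !normrN => le; apply: le_trans le; apply: le_trans (ler_norm _).
    have -> : h^-1 *: (flat p (h *: 1 + 0) - flat p 0) = h^-1 * flat p h.
      by rewrite {2}/flat ltxx subr0 addr0 [h *: 1]mulr1.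
    rewrite /flat.
    have [hp|hn] := ltP 0 h; last first.
      by rewrite mulr0 normr0 mulr_ge0// (le_trans _ (Cp 0 (lexx _)))// mulr_ge0 ?expR_ge0.
    have := Cp h^-1; rewrite invr_ge0 (ltW hp) => /(_ isT).
    rewrite hornerM hornerXn !normrM (ger0_norm (expR_ge0 _)).
    rewrite normfV (gtr0_norm hp) => /(ler_wpM2l (ltW hp)).
    congr (_ <= _); field; exact: lt0r_neq0.
  have d0 : derivable (flat p) 0 1 by apply/cvg_ex; exists 0; exact: lim0.
  by apply: (DeriveDef d0); apply/cvg_lim => //; exact: lim0.
Unshelve. all: by end_near. Qed.

Lemma flat_smooth p : smooth (flat p).
Proof.
move=> k; elim: k p => [|k IH] p.
  by apply: derivable_continuous => x; case: (is_derive_flat p x).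
split; first by move=> x; by case: (is_derive_flat p x).
rewrite (_ : derive1 _ = flat (flat_deriv p)); first exact: IH.
by apply/funext => x; rewrite derive1E; by case: (is_derive_flat p x).
Qed.

(** The polynomial 1 gives [exp (-1/x)]. The factor [n.+1] makes both flanks steeper, so that the
    bumps tend to the indicator of []a, b[] while remaining zero outside that interval. *)
Definition bump (a b : R) (n : nat) (x : R) : R :=
  flat 1 (n.+1%:R * (x - a)) * flat 1 (n.+1%:R * (b - x)).

Lemma bump_smooth a b n : smooth (bump a b n).
Proof.
move=> k; apply: CnM.
  have := Cn_affine n.+1%:R (- (n.+1%:R * a)) (flat_smooth 1 k).
  by congr Cn; apply/funext => x; rewrite mulrBr.
have := Cn_affine (- n.+1%:R) (n.+1%:R * b) (flat_smooth 1 k).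
by congr Cn; apply/funext => x; rewrite mulrBr mulNr addrC.
Qed.

Lemma flat1_01 x : 0 <= flat 1 x <= 1.
Proof.
rewrite /flat; case: ifPn => x0; last by rewrite lexx ler01.
by rewrite hornerC mul1r expR_ge0/= -expR0 ler_expR oppr_le0 invr_ge0 ltW.
Qed.

Lemma bump_01 a b n x : 0 <= bump a b n x <= 1.
Proof.
have /andP[p0 p1] := flat1_01 (n.+1%:R * (x - a)).
have /andP[q0 q1] := flat1_01 (n.+1%:R * (b - x)).
by rewrite mulr_ge0//= mulr_ile1.
Qed.

Lemma bump_out a b n x : ~~ (a < x < b) -> bump a b n x = 0.
Proof.
rewrite negb_and -!leNgt => /orP[xa|bx]; rewrite /bump /flat.
  by rewrite ifF ?mul0r//; apply/negbTE; rewrite -leNgt mulr_ge0_le0// subr_le0.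
by rewrite [X in _ * X]ifF ?mulr0//; apply/negbTE; rewrite -leNgt mulr_ge0_le0// subr_le0.
Qed.

Lemma flat1_cvg (y : R) : 0 < y -> flat 1 (n.+1%:R * y) @[n --> \oo] --> (1 : R).
Proof.
move=> y0.
rewrite [X in _ --> X](_ : 1 = expR (0 * - y^-1)); last by rewrite mul0r expR0.
rewrite (_ : (fun n => _) = fun n => expR (n.+1%:R^-1 * - y^-1)); last first.
  by apply/funext => n; rewrite /flat mulr_gt0// hornerC mul1r invfM mulrN.
apply: continuous_cvg; first exact: continuous_expR.
by apply: cvgM; [exact: cvg_harmonic|exact: cvg_cst].
Qed.

Lemma bump_cvg a b x : bump a b n x @[n --> \oo] --> ((a < x < b)%R%:R : R).
Proof.
have [/andP[ax xb]|h] := boolP (a < x < b); last first.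
  by under eq_fun do rewrite bump_out//; exact: cvg_cst.
rewrite [X in _ --> X](_ : _ = 1 * 1); last by rewrite mulr1.
by apply: cvgM; apply: flat1_cvg; rewrite subr_gt0.
Qed.

End smooth_real.

(** * Test functions as products of bumps *)

Section product_testfun.
Variables (R : realType) (d : nat).
Implicit Types (g : 'I_d -> R -> R) (x : 'rV[R]_d).

Definition prodf g x : R := \prod_i g i (x ord0 i).

Lemma prodf_continuous g : (forall i, continuous (g i)) -> continuous (prodf g).
Proof.
move=> cg; rewrite /prodf; elim: (index_enum _) => [|i r IH].
  by under eq_fun do rewrite big_nil; exact: cst_continuous.
under eq_fun do rewrite big_cons.
move=> x; have c : (fun y : 'rV[R]_d => g i (y ord0 i)) @ x --> g i (x ord0 i).
  have := continuous_comp (@coord_continuous R 1 d ord0 i x) (cg i (x ord0 i)). exact.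
exact: cvgM c (IH x).
Qed.

Lemma prodf_pderiv g (i : 'I_d) x : (forall y, derivable (g i) y 1) ->
  derivable (prodf g) x (delta_mx ord0 i) /\
  pderiv i (prodf g) x = prodf (fun j => if j == i then derive1 (g i) else g j) x.
Proof.
move=> dg; pose c := \prod_(j | j != i) g j (x ord0 j).
have e : (fun h => h^-1 *: ((prodf g \o shift x) (h *: delta_mx ord0 i) - prodf g x)) =
    (fun h => h^-1 *: ((g i \o shift (x ord0 i)) (h *: 1) - g i (x ord0 i)) * c).
  apply/funext => h; rewrite /prodf /= (bigD1 i)//= [X in _ - X](bigD1 i)//=.
  rewrite !mxE !eqxx /=.
  rewrite (eq_bigr (fun j => g j (x ord0 j))); last first.
    by move=> j ji; rewrite !mxE eqxx (negbTE ji) mulr0 add0r.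
  by rewrite -/c -mulrBl scalerAl.
have cv : h^-1 *: ((prodf g \o shift x) (h *: delta_mx ord0 i) - prodf g x) @[h --> 0^']
    --> derive1 (g i) (x ord0 i) * c.
  rewrite e; apply: cvgM; last exact: cvg_cst.
  by rewrite derive1E; exact: dg.
split; first by apply/cvg_ex; exists (derive1 (g i) (x ord0 i) * c); exact: cv.
rewrite /pderiv /derive; have -> := cvg_lim _ cv => //.
rewrite /prodf [RHS](bigD1 i)//= eqxx; congr (_ * _).
by apply: eq_bigr => j ji; rewrite (negbTE ji).
Qed.

Lemma prodf_Ck k g : (forall i, smooth (g i)) -> Ck k (prodf g).
Proof.
elim: k g => [|k IH] g sg.
  by apply: prodf_continuous => i; exact: (sg i 0%N).
split; first by apply: prodf_continuous => i; exact: (sg i 0%N).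
move=> i; have dg : forall y, derivable (g i) y 1 by case: (sg i 1%N).
split; first by move=> x; case: (prodf_pderiv x dg).
rewrite (_ : pderiv i (prodf g) = prodf (fun j => if j == i then derive1 (g i) else g j)).
  apply: IH => j; case: ifP => // _ n.
  by case: (sg i n.+1).
by apply/funext => x; case: (prodf_pderiv x dg).
Qed.

Lemma box_testfun (Om : polytope R d) (a b : 'I_d -> R) (n : nat) :
  [set x : 'rV[R]_d | forall i, a i <= x ord0 i <= b i] `<=` Om ->
  testfun Om (prodf (fun i => bump (a i) (b i) n)).
Proof.
move=> Q; split; first by move=> k; apply: prodf_Ck => i; exact: bump_smooth.
exists [set x : 'rV[R]_d | forall i, a i <= x ord0 i <= b i]; split => //.
  have := @rV_compact R d (fun i => `[a i, b i]%classic) (fun i => @segment_compact _ _ _).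
  by congr compact; apply/seteqP; split => x /= h i; have := h i; rewrite in_itv.
move=> x /= /existsNP[i /negP xi]; rewrite /prodf (bigD1 i)//= bump_out ?mul0r//.
by apply: contra xi => /andP[/ltW -> /ltW ->].
Qed.

Lemma prodf_bump_cvg (a b : 'I_d -> R) x :
  prodf (fun i => bump (a i) (b i) n) x @[n --> \oo] -->
  ([forall i, a i < x ord0 i < b i]%R%:R : R).
Proof.
rewrite /prodf; have [h|] := boolP [forall i, a i < x ord0 i < b i].
  rewrite [X in _ --> X](_ : _ = \prod_(i < d) 1); last by rewrite big1.
  elim: (index_enum _) => [|i r IH].
    by under eq_fun do rewrite big_nil; rewrite big_nil; exact: cvg_cst.
  under eq_fun do rewrite big_cons.
  rewrite big_cons; apply: cvgM => //.
  by have := @bump_cvg R (a i) (b i) (x ord0 i); rewrite (forallP h).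
rewrite negb_forall => /existsP[i xi].
under eq_fun do rewrite (bigD1 i)//= bump_out// mul0r.
exact: cvg_cst.
Qed.

Lemma prodf_bump_01 (a b : 'I_d -> R) n x : 0 <= prodf (fun i => bump (a i) (b i) n) x <= 1.
Proof.
apply/andP; split; first by apply: prodr_ge0 => i _; case/andP: (bump_01 (a i) (b i) n (x ord0 i)).
by apply: prodr_ile1 => i _; exact: bump_01.
Qed.

Lemma prodf_bump_out (a b : 'I_d -> R) n x : ~~ [forall i, a i < x ord0 i < b i] ->
  prodf (fun i => bump (a i) (b i) n) x = 0.
Proof.
by rewrite negb_forall => /existsP[i xi]; rewrite /prodf (bigD1 i)//= bump_out ?mul0r.
Qed.

End product_testfun.

(** * Boxes and their volume *)

Section box_measure.
Variable R : realType.

Definition obox (d : nat) (a b : 'I_d -> R) : set 'rV[R]_d :=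
  [set x | forall i, a i < x ord0 i < b i].

Lemma measurable_rV_forall d (A : 'I_d -> set R) : (forall i, measurable (A i)) ->
  measurable [set x : 'rV[R]_d | forall i, A i (x ord0 i)].
Proof.
move=> mA; rewrite (_ : [set _ | _] = \bigcap_(i in [set: 'I_d]) (rV_coord i @^-1` A i)).
  apply: fin_bigcap_measurable => // i _.
  by rewrite -[X in measurable X]setTI; exact: measurable_rV_coord.
by apply/seteqP; split => x /= h i; [move=> _|]; exact: h.
Qed.

Lemma measurable_obox d (a b : 'I_d -> R) : measurable (obox a b).
Proof.
have := @measurable_rV_forall d (fun i => `]a i, b i[%classic) (fun i => measurable_itv _).
by congr measurable; apply/seteqP; split => x /= h i; have := h i; rewrite in_itv.
Qed.

Lemma obox_lty d (a b : 'I_d -> R) : (lebesgue_rV R d (obox a b) < +oo)%E.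
Proof.
elim: d a b => [|d IH] a b.
  by rewrite /= /dirac_rV0 diracE ltry.
rewrite /= /lebesgue_rV_step /pushforward.
have -> : @cons_rV R d @^-1` obox a b =
    `]a ord0, b ord0[%classic `*` obox (a \o lift ord0) (b \o lift ord0).
  apply/seteqP; split => -[t x] /=.
    move=> h; split; first by have := h ord0; rewrite mxE unlift_none in_itv.
    by move=> i; have := h (lift ord0 i); rewrite mxE liftK.
  rewrite in_itv/= => -[ht hx] i; rewrite mxE; case: unliftP => [j ->|->]; [exact: hx|exact: ht].
rewrite product_measure1E//; last exact: measurable_obox.
have bfin := IH (a \o lift ord0) (b \o lift ord0).
have afin : (@lebesgue_measure R `]a ord0, b ord0[%classic < +oo)%E.
  by rewrite lebesgue_measure_itv/=; case: ifP => // _; rewrite -EFinB ltry.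
by apply: (lte_mul_pinfty _ _ bfin) => //; rewrite ge0_fin_numE.
Qed.

End box_measure.

(** * Integrals that vanish on a pi-system *)

Section pi_system_integral.
Context dT (T : measurableType dT) (R : realType).
Variables (mu : {measure set T -> \bar R}) (G : set (set T)) (g : T -> R).
Hypotheses (GI : setI_closed G) (mG : measurable `<=` <<s G >>) (Gm : G `<=` measurable).
Hypothesis gi : mu.-integrable setT (EFin \o g).
Local Open Scope ereal_scope.
Hypothesis gT : \int[mu]_x (g x)%:E = 0.
Hypothesis gG : forall A, G A -> \int[mu]_(x in A) (g x)%:E = 0.

(** The sets over which [g] integrates to 0 form a lambda-system: differences by additivity,
    increasing unions by dominated convergence. The whole space is a separate assumption, as it need
    not belong to [G]. *)
Lemma pi_system_integral_eq0 A : measurable A -> \int[mu]_(x in A) (g x)%:E = 0.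
Proof.
pose H := [set A : set T | measurable A /\ \int[mu]_(x in A) (g x)%:E = 0].
have gS (B : set T) : measurable B -> mu.-integrable B (EFin \o g).
  by move=> mB; apply: (integrableS measurableT mB (@subsetT _ B)).
have lH : lambda_system setT H.
  split => //.
  - move=> B C CB [mB B0] [mC C0]; split; first exact: measurableD.
    have := @integral_setU _ _ _ mu C (B `\` C) (EFin \o g) mC (measurableD mB mC).
    rewrite setDUK// => h; move: B0; rewrite h; last 2 first.
    + exact: measurable_int (gS _ mB).
    + by apply/disj_setPS => x [Cx []].
    by rewrite C0 add0e.
  - move=> F ndF HF; have mF n : measurable (F n) by case: (HF n).
    have mU : measurable (\bigcup_i F i) by exact: bigcupT_measurable.
    split => //.
    have mg (B : set T) : measurable B -> measurable_fun setT ((EFin \o g) \_ B).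
      by move=> mB; apply/(measurable_restrictT _ mB); exact: measurable_int (gS _ mB).
    have cvF : {ae mu, forall x, setT x ->
        ((EFin \o g) \_ (F n)) x @[n --> \oo] --> ((EFin \o g) \_ (\bigcup_i F i)) x}.
      apply: aeW => x _; rewrite [X in _ --> X]patchE.
      case: ifPn => [/set_mem[m _ Fmx]|].
        apply: cvg_near_cst; exists m => // n /= mn; rewrite patchE mem_set//.
        by have /subsetPset := ndF _ _ mn; exact.
      rewrite notin_setE => nF; apply: cvg_near_cst; apply: nearW => n.
      by rewrite patchE memNset// => Fx; apply: nF; exists n.
    have dom : {ae mu, forall x n, setT x -> `|((EFin \o g) \_ (F n)) x| <= `|(EFin \o g) x|}.
      by apply: aeW => x n _; rewrite patchE; case: ifP; rewrite ?abse0.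
    have [_ _ cv] := dominated_convergence measurableT (fun n => mg _ (mF n)) (mg _ mU) cvF
      (integrable_abse gi) dom.
    rewrite integral_mkcond; move: cv => /cvg_lim <- //.
    rewrite (_ : (fun n => _) = cst 0); first exact: lim_cst.
    by apply/funext => n /=; rewrite -integral_mkcond; exact: (HF n).2.
have sub := lambda_system_subset GI lH (fun B GB => conj (Gm GB) (gG GB)) (fun _ _ => @subsetT _ _).
by move=> mA; have [] := sub _ (mG mA).
Qed.

End pi_system_integral.

(** * Borel structure of row vectors *)

Section open_rV.
Variables (R : realType) (d : nat).

Definition cbox (a b : 'I_d -> R) : set 'rV[R]_d := [set x | forall i, a i <= x ord0 i <= b i].

Definition qlo (q : {ffun 'I_d -> rat * rat}) (i : 'I_d) : R := ratr (q i).1.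
Definition qhi (q : {ffun 'I_d -> rat * rat}) (i : 'I_d) : R := ratr (q i).2.

Lemma open_rat_box (U : set 'rV[R]_d) (x : 'rV[R]_d) : open U -> U x ->
  exists q, obox (qlo q) (qhi q) x /\ cbox (qlo q) (qhi q) `<=` U.
Proof.
move=> oU Ux; have /nbhs_ballP[e /= e0 eU] := open_nbhs_nbhs (conj oU Ux).
have H i : exists q : rat * rat, [/\ x ord0 i - e < ratr q.1, ratr q.1 < x ord0 i,
    x ord0 i < ratr q.2 & ratr q.2 < x ord0 i + e].
  have [|q1] := @rat_in_itvoo R (x ord0 i - e) (x ord0 i); first by rewrite ltrBlDr ltrDl.
  rewrite in_itv/= => /andP[h1 h2].
  have [|q2] := @rat_in_itvoo R (x ord0 i) (x ord0 i + e); first by rewrite ltrDl.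
  by rewrite in_itv/= => /andP[h3 h4]; exists (q1, q2).
have [q hq] := choice H.
exists [ffun i => q i]; split.
  by move=> i; rewrite /qlo /qhi ffunE; case: (hq i) => _ -> -> _.
move=> y hy; apply: eU; split => // i j; rewrite !ord1; have := hy j; rewrite /qlo /qhi ffunE.
case: (hq j) => h1 _ _ h2 /andP[h3 h4].
by rewrite /ball/= ltr_distlC; apply/andP; split; lra.
Qed.

(** A countable cover of [U] by open boxes whose closed boxes stay in [U]; closedness is what will
    make the product of bumps a test function. Numbers that code no such box give the empty set. *)
Definition rat_box (U : set 'rV[R]_d) (n : nat) : set 'rV[R]_d :=
  if choice.unpickle n is Some q then
    if `[< cbox (qlo q) (qhi q) `<=` U >] then obox (qlo q) (qhi q) else set0
  else set0.

Lemma rat_boxP (U : set 'rV[R]_d) n : rat_box U n = set0 \/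
  exists a b, cbox a b `<=` U /\ rat_box U n = obox a b.
Proof.
rewrite /rat_box; case: choice.unpickle => [q|]; last by left.
case: asboolP => [h|]; last by left.
by right; exists (qlo q), (qhi q).
Qed.

Lemma open_rat_boxE (U : set 'rV[R]_d) : open U -> U = \bigcup_n rat_box U n.
Proof.
move=> oU; apply/seteqP; split => [x Ux|x [n _]].
  have [q [xq qU]] := open_rat_box oU Ux.
  by exists (choice.pickle q) => //; rewrite /rat_box choice.pickleK asboolT.
have [->//|[a [b [abU ->]]]] := rat_boxP U n.
by move=> xab; apply: abU => i; have /andP[/ltW -> /ltW ->] := xab i.
Qed.

(** The sigma-algebra is generated by the coordinates; it contains boxes, and an open set is a
    countable union of rational ones. This makes continuous functions measurable. *)
Lemma open_measurable_rV (U : set 'rV[R]_d) : open U -> measurable U.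
Proof.
move=> oU; rewrite (open_rat_boxE oU); apply: bigcupT_measurable => n.
by have [->//|[a [b [_ ->]]]] := rat_boxP U n; exact: measurable_obox.
Qed.

Lemma continuous_measurable_rV (f : 'rV[R]_d -> R) : continuous f -> measurable_fun setT f.
Proof.
move=> cf; apply: (measurability _ (RGenOpens.measurableE R)) => _ [_ [a [b ->]] <-].
rewrite setTI; apply: open_measurable_rV.
by move/continuousP : cf; apply; exact: interval_open.
Qed.

Definition lower_orthant (al : 'I_d -> R) : set 'rV[R]_d := [set x | forall i, x ord0 i < al i].

Lemma measurable_lower_orthant :
  (measurable : set (set 'rV[R]_d)) `<=` <<s range lower_orthant >>.
Proof.
apply: smallest_sub; first exact: smallest_sigma_algebra.
pose S := <<s range lower_orthant >>.
have SS : sigma_algebra setT S by exact: smallest_sigma_algebra.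
move=> A; rewrite -bigcup_seq => -[i _ [B mB <-]] /=; rewrite setTI.
have [S0 SC SU] := SS.
have sub : [set B | S (rV_coord i @^-1` B)] `<=` setT by [].
suff h : (measurable : set (set (measurableTypeR R))) `<=` [set B | S (rV_coord i @^-1` B)].
  exact: h.
rewrite RGenInftyO.measurableE; apply: smallest_sub.
  split.
  - by rewrite /= preimage_set0.
  - by move=> C SC' /=; rewrite setTD preimage_setC -setTD; exact: SC.
  - by move=> F SF /=; rewrite preimage_bigcup; exact: SU.
move=> _ [r ->] /=.
(* A half-space in the direction [i] is exhausted by orthants: the other coordinates are bounded by
   an integer above the sum of the absolute values of all coordinates. *)
rewrite (_ : _ @^-1` _ = \bigcup_n lower_orthant (fun j => if j == i then r else n%:R)).
  by apply: SU => n; apply: sub_sigma_algebra; exists (fun j => if j == i then r else n%:R).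
apply/seteqP; split => [x|x [n _] /(_ i)]; last by rewrite eqxx /rV_coord /= in_itv.
rewrite /rV_coord /= in_itv/= => xr.
exists (Num.truncn (\sum_j `|x ord0 j|)).+1 => // j; case: ifPn => [/eqP ->//|_].
apply: (le_lt_trans _ (truncnS_gt _)); apply: (le_trans (ler_norm _)).
by rewrite (bigD1 j)//= lerDl sumr_ge0.
Qed.

Lemma lower_orthantI : setI_closed (range lower_orthant).
Proof.
move=> _ _ [a _ <-] [b _ <-]; exists (fun i => Num.min (a i) (b i)) => //.
apply/seteqP; split => [x h|x [ha hb] i]; last by rewrite /= lt_min ha hb.
by split => i; have := h i; rewrite lt_min => /andP[].
Qed.

Lemma lower_orthant_measurable : range lower_orthant `<=` measurable.
Proof.
move=> _ [a _ <-].
have := @measurable_rV_forall R d (fun i => `]-oo, a i[%classic) (fun i => measurable_itv _).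
by congr measurable; apply/seteqP; split => x /= h i; have := h i; rewrite in_itv.
Qed.

End open_rV.

(** * Functions orthogonal to all test functions *)

Section fundamental_lemma.
Variables (R : realType) (d : nat) (Om : polytope R d).
Local Notation H := (L2 Om).

Lemma polytope_open : open (Om : set 'rV[R]_d).
Proof.
have [n [A [b ->]]] := pdomain_halfspaces Om.
rewrite openE => x xA; rewrite /interior.
change (nbhs x [set y : 'rV[R]_d | forall i, \sum_j A i j * y ord0 j < b i]).
have fx : Filter (nbhs x) by exact: nbhs_filter.
apply: (@filter_forall 'rV[R]_d 'I_n (fun i y => \sum_j A i j * y ord0 j < b i) (nbhs x) fx) => i.
have cf : continuous (fun y : 'rV[R]_d => \sum_j A i j * y ord0 j).
  move=> y; elim: (index_enum _) => [|j r IH].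
    by rewrite (_ : (fun y => _) = cst 0); [exact: cst_continuous|apply/funext => z; rewrite big_nil].
  rewrite (_ : (fun z : 'rV[R]_d => _) =
      fun z : 'rV[R]_d => A i j * z ord0 j + \sum_(j <- r) A i j * z ord0 j); last first.
    by apply/funext => z; rewrite big_cons.
  have c1 : (fun z : 'rV[R]_d => A i j * z ord0 j) @ y --> A i j * y ord0 j.
    exact: (cvgM (cvg_cst (A i j)) (@coord_continuous R 1 d ord0 j y)).
  exact: (cvgD c1 IH).
exact: (cf x _ (lt_nbhsl (xA i))).
Qed.

Lemma vol_out : (vol Om (~` (Om : set 'rV[R]_d)) = 0)%E.
Proof. by rewrite /vol /mrestr setICl measure0. Qed.

Lemma vol_obox (a b : 'I_d -> R) : (vol Om (obox a b) < +oo)%E.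
Proof.
apply: le_lt_trans (obox_lty a b); rewrite /vol /mrestr.
apply: le_measure; [| |exact: subIsetl]; apply: mem_set; last exact: measurable_obox.
by apply: measurableI; [exact: measurable_obox|exact: measurable_polytope].
Qed.

Lemma L2_measurable (g : H) : measurable_fun setT (g : 'rV[R]_d -> R).
Proof. exact: measurable_funP. Qed.

Lemma L2_integrable_obox (g : H) (a b : 'I_d -> R) :
  (vol Om).-integrable (obox a b) (EFin \o (g : 'rV[R]_d -> R)).
Proof.
have mB := measurable_obox a b.
have i1 := @Rintegrable_cst _ _ R (vol Om) (obox a b) mB 1 (vol_obox a b).
have i2 : (vol Om).-integrable (obox a b) (EFin \o (fun x => g x * g x)).
  by apply: (integrableS measurableT mB (@subsetT _ _)); exact: L2_mul_integrable.
apply: (le_integrable mB _ _ (Rintegrable_D mB i1 i2)).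
  by apply/measurable_EFinP; apply: measurable_funTS; exact: L2_measurable.
move=> x _; rewrite /= lee_fin [leRHS]ger0_norm; last by rewrite addr_ge0// -expr2 sqr_ge0.
have K (y : R) : `|y| <= 1 + y * y.
  rewrite -expr2 -real_normK ?num_real//.
  by have := sqr_ge0 (`|y| - 1); rewrite sqrrB1; have := normr_ge0 y; rewrite -mulr_natl; nra.
exact: K.
Qed.

Variable g : H.
Hypothesis g_orth : forall phi, testfun Om phi -> \int[vol Om]_x (g x * phi x) = 0.

(** The products of bumps are test functions bounded by 1, and they tend to 1 on the box, which has
    finite measure; dominated convergence applies. *)
Lemma orth_obox (a b : 'I_d -> R) : cbox a b `<=` Om ->
  (\int[vol Om]_(x in obox a b) (g x)%:E = 0)%E.
Proof.
move=> abO; have mB := measurable_obox a b.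
pose phi n := prodf (fun i => bump (a i) (b i) n).
have mphi n : measurable_fun setT (phi n).
  apply: continuous_measurable_rV; apply: prodf_continuous => i.
  exact: (bump_smooth (a i) (b i) n 0%N).
have gi := L2_integrable_obox g a b.
have gphi n : (vol Om).-integrable (obox a b) (EFin \o (fun x => g x * phi n x)).
  apply: (le_integrable mB _ _ gi).
    apply/measurable_EFinP; apply: measurable_funTS.
    exact: (measurable_funM (L2_measurable g) (mphi n)).
  move=> x _; rewrite /= lee_fin normrM -[leRHS]mulr1 ler_wpM2l//.
  by have /andP[p0 p1] := prodf_bump_01 a b n x; rewrite ger0_norm.
have int0 n : (\int[vol Om]_(x in obox a b) (g x * phi n x)%:E = 0)%E.
  rewrite -(fineK (integrable_fin_num mB (gphi n))); congr EFin.
  rewrite -(g_orth (box_testfun n abO)) [RHS]/Rintegral integral_mkcond; congr fine.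
  apply: eq_integral => x _; rewrite patchE; case: ifPn => //; rewrite notin_setE => xab.
  by rewrite prodf_bump_out ?mulr0//; apply/negP => /forallP.
have cvF : {ae vol Om, forall x, obox a b x ->
    (g x * phi n x)%:E @[n --> \oo] --> (g x)%:E}.
  apply: aeW => x xab; apply: cvg_EFin; first exact: nearW.
  rewrite -[X in _ --> X]mulr1; apply: cvgM; first exact: cvg_cst.
  have := @prodf_bump_cvg R d a b x; rewrite (_ : [forall i, _] = true)//.
  by apply/forallP => i; exact: xab.
have mgb : measurable_fun (obox a b) (EFin \o (g : 'rV[R]_d -> R)).
  by apply/measurable_EFinP; apply: measurable_funTS; exact: L2_measurable.
have dom : {ae vol Om, forall x n, obox a b x ->
    (`|(g x * phi n x)%:E| <= `|(EFin \o (g : 'rV[R]_d -> R)) x|)%E}.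
  apply: aeW => x n _; rewrite /= lee_fin normrM -[leRHS]mulr1 ler_wpM2l//.
  by have /andP[p0 p1] := prodf_bump_01 a b n x; rewrite ger0_norm.
have [_ _ cv] := dominated_convergence mB (fun n => measurable_int _ (gphi n)) mgb cvF
  (integrable_abse gi) dom.
move: cv => /cvg_lim <- //.
by rewrite (_ : (fun n => _) = cst 0%E); [exact: lim_cst|apply/funext].
Qed.

(** A box cut by a lower orthant is again an open box whose closed box lies in [Om]. So [g],
    restricted to the box, has integral 0 over all orthants, hence over all measurable sets. *)
Lemma orth_ae_obox (a b : 'I_d -> R) : cbox a b `<=` Om ->
  {ae vol Om, forall x, obox a b x -> g x = 0}.
Proof.
move=> abO; have mB := measurable_obox a b; have gi := L2_integrable_obox g a b.
pose gB : 'rV[R]_d -> R := (g : 'rV[R]_d -> R) \_ (obox a b).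
have gBi : (vol Om).-integrable setT (EFin \o gB).
  by move/(integrable_mkcond _ mB) : gi; rewrite restrict_EFin.
have IE (A : set 'rV[R]_d) : (\int[vol Om]_(x in A) (gB x)%:E =
    \int[vol Om]_(x in A `&` obox a b) (g x)%:E)%E.
  by rewrite integral_mkcondr; apply: eq_integral => x _; rewrite /gB !patchE; case: ifP.
have g0 (A : set 'rV[R]_d) : measurable A -> (\int[vol Om]_(x in A) (gB x)%:E = 0)%E.
  move=> mA; apply: (pi_system_integral_eq0 (@lower_orthantI R d) (@measurable_lower_orthant R d)
    (@lower_orthant_measurable R d) gBi) => //.
    by rewrite IE setTI orth_obox.
  move=> _ [al _ <-]; rewrite IE.
  rewrite (_ : _ `&` _ = obox a (fun i => Num.min (b i) (al i))).
    apply: orth_obox => x hx; apply: abO => i; have := hx i.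
    by rewrite le_min => /andP[-> /andP[-> _]].
  apply/seteqP; split => [x [h1 h2] i|x h].
    by have /andP[-> xb] := h2 i; rewrite lt_min xb h1.
  by split => i; have := h i; rewrite lt_min => /and3P[h1 h2 h3] //; rewrite h1.
have e : ae_eq (vol Om) setT (EFin \o gB) (cst 0%E).
  apply: integral_ae_eq => // A _ mA; by rewrite g0// integral0.
apply: filterS e => x /(_ I) h xab; move: h; rewrite /gB /= patchE mem_set//.
by case.
Qed.

(** [vol] gives measure 0 to the complement of [Om], and [Om] is a countable union of rational boxes
    on which [g] vanishes almost everywhere. *)
Lemma orth_testfun_eq0 : {ae vol Om, forall x, g x = 0}.
Proof.
have inO : {ae vol Om, forall x, (Om : set 'rV[R]_d) x}.
  exists (~` (Om : set 'rV[R]_d)); split => //.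
  - by apply: measurableC; exact: measurable_polytope.
  - exact: vol_out.
have h n : {ae vol Om, forall x, rat_box (Om : set 'rV[R]_d) n x -> g x = 0}.
  have [->|[a [b [abO ->]]]] := rat_boxP (Om : set 'rV[R]_d) n; first exact: aeW.
  exact: orth_ae_obox.
apply: filterS2 inO (ae_foralln h) => x Ox hx.
move: Ox; rewrite (open_rat_boxE polytope_open) => -[n _ xn].
exact: (hx n).
Qed.

End fundamental_lemma.

(** * Weak derivatives *)

Section sobolev_theory.
Variables (R : realType) (d : nat) (Om : polytope R d).
Local Notation H := (L2 Om).
Local Notation L := (L2space Om).
Let PL := L2space_prehilb Om.
Local Notation ip := (hip L).
Local Notation N := (hnorm L).
Implicit Types (phi psi : 'rV[R]_d -> R) (u v g : H).

Lemma Ck_continuous k phi : Ck k phi -> continuous phi.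
Proof. by case: k => //= k []. Qed.

(** A test function is bounded and supported in a bounded box. Realized as an element of [L2], it
    turns the integrals in the definition of weak derivatives into inner products. *)
Lemma testfun_L2 phi : testfun Om phi -> exists Phi : H, (Phi : 'rV[R]_d -> R) = phi.
Proof.
move=> [Ckphi [K [cK KO K0]]].
have cphi := Ck_continuous (Ckphi 0%N).
have mphi := continuous_measurable_rV cphi.
have bK (f : 'rV[R]_d -> R) : continuous f -> exists M : R, forall x, K x -> `|f x| < M.
  move=> cf; have /compact_bounded[M [Mr h]] : compact (f @` K).
    by apply: continuous_compact => //; exact: continuous_subspaceT.
  exists (M + 1 + 1) => x Kx; apply: (@le_lt_trans _ _ (M + 1)); last by rewrite ltrDl.
  by apply: (h (M + 1)); [rewrite ltrDl|exists x].
have [M hM] := choice (fun i : 'I_d => bK _ (@coord_continuous R 1 d ord0 i)).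
have [C hC] := bK _ cphi.
have mB := measurable_obox (fun i => - M i) M.
have KB : K `<=` obox (fun i => - M i) M.
  by move=> x Kx i; have := hM i x Kx; rewrite ltr_norml.
have hC' x : `|phi x| <= `|C|.
  have [Kx|/K0->] := pselect (K x); last by rewrite normr0.
  by rewrite (le_trans (ltW (hC x Kx)))// ler_norm.
have i2 : (vol Om).-integrable setT (EFin \o (fun x => phi x * phi x)).
  have : (vol Om).-integrable (obox (fun i => - M i) M) (EFin \o (fun x => phi x * phi x)).
    apply: measurable_bounded_integrable => //.
    - exact: vol_obox.
    - by apply: measurable_funTS; exact: measurable_funM.
    exists (`|C| * `|C|); split => [|e Ce x _]; first exact: num_real.
    by apply: le_trans (ltW Ce); rewrite normrM ler_pM.
  move/(integrable_mkcond _ mB); apply: eq_integrable => // x _.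
  rewrite patchE; case: ifPn => // /negP xB /=; rewrite K0 ?mulr0// => Kx.
  by apply: xB; apply/mem_set/KB.
have Pphi : phi \in Lfun (vol Om) 2%:E.
  rewrite inE; apply/andP; split; apply: mem_set => //=.
  rewrite /finite_norm unlock poweR_lty//.
  apply: le_lt_trans (integrable_lty measurableT i2).
  rewrite le_eqVlt; apply/orP; left; apply/eqP; apply: eq_integral => x _ /=.
  by rewrite powR_mulrn// real_normK ?num_real// expr2.
by exists (Lfun_Sub (lee1n 2) Pphi).
Qed.

Lemma testfun_pderiv i phi : testfun Om phi -> testfun Om (pderiv i phi).
Proof.
move=> [Ckphi [K [cK KO K0]]]; split.
  by move=> k; have [_ /(_ i)[]] := Ckphi k.+1.
exists K; split => // x Kx.
have clK : closed K by apply: compact_closed => //; exact: norm_hausdorff.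
have nK : \forall y \near x, phi y = cst 0 y.
  have : nbhs x (~` K) by apply: open_nbhs_nbhs; split => //; exact: closed_openC.
  by apply: filterS => y /K0.
by rewrite /pderiv (near_eq_derive _ nK) derive_cst.
Qed.

Lemma pderiv_lin i k phi psi x : testfun Om phi -> testfun Om psi ->
  pderiv i (fun y => k * phi y + psi y) x = k * pderiv i phi x + pderiv i psi x.
Proof.
move=> [Cphi _] [Cpsi _].
have [_ /(_ i)[dphi _]] := Cphi 1%N; have [_ /(_ i)[dpsi _]] := Cpsi 1%N.
by rewrite /pderiv (@deriveD _ _ _ (k \*: phi) psi) ?deriveZ//; exact: derivableZ.
Qed.

Lemma Ck_lin n k phi psi : Ck n phi -> Ck n psi -> Ck n (fun y => k * phi y + psi y).
Proof.
elim: n phi psi => [|n IH] phi psi.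
  by move=> cphi cpsi x; apply: cvgD (cpsi x); apply: cvgM (cphi x); exact: cvg_cst.
move=> [cphi dphi] [cpsi dpsi]; split.
  by move=> x; apply: cvgD (cpsi x); apply: cvgM (cphi x); exact: cvg_cst.
move=> i; have [d1 C1] := dphi i; have [d2 C2] := dpsi i.
have dk x : derivable (k \*: phi) x (delta_mx ord0 i) by exact: derivableZ.
split; first by move=> x; exact: (derivableD (dk x) (d2 x)).
rewrite (_ : pderiv i _ = fun y => k * pderiv i phi y + pderiv i psi y); first exact: IH.
by apply/funext => x; rewrite /pderiv (@deriveD _ _ _ (k \*: phi) psi) ?deriveZ.
Qed.

Lemma testfun_lin k phi psi : testfun Om phi -> testfun Om psi ->
  testfun Om (fun y => k * phi y + psi y).
Proof.
move=> [C1 [K1 [cK1 K1O K10]]] [C2 [K2 [cK2 K2O K20]]]; split.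
  by move=> n; exact: Ck_lin.
exists (K1 `|` K2); split; first exact: compactU.
  by move=> x [/K1O|/K2O].
by move=> x /not_orP[/K10 -> /K20 ->]; rewrite mulr0 addr0.
Qed.

Lemma testfun0 : testfun Om (cst 0).
Proof.
split; last by exists set0; split => //; exact: compact0.
elim=> [|k IH]; first by move=> x; exact: cst_continuous.
split=> [x|i]; first exact: cst_continuous.
split=> [x|]; first exact: derivable_cst.
by rewrite (_ : pderiv i _ = cst 0)//; apply/funext => x; rewrite /pderiv derive_cst.
Qed.

Lemma is_wpartial_lin i k u v g g' : is_wpartial i u g -> is_wpartial i v g' ->
  is_wpartial i (k *: u + v) (k *: g + g').
Proof.
move=> ug vg phi tf.
have [Phi PE] := testfun_L2 tf; have [dPhi dPE] := testfun_L2 (testfun_pderiv i tf).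
have h1 := ug _ tf; have h2 := vg _ tf; rewrite -dPE -PE in h1 h2 *.
have -> : \int[vol Om]_x ((k *: u + v) x * dPhi x) = k * ip u dPhi + ip v dPhi.
  by rewrite -(hipZl PL)// -(hipDl PL).
have -> : \int[vol Om]_x ((k *: g + g') x * Phi x) = k * ip g Phi + ip g' Phi.
  by rewrite -(hipZl PL)// -(hipDl PL).
rewrite /ip /= h1 h2; ring.
Qed.

Lemma ae_hnorm0 g : {ae vol Om, forall x, g x = 0} -> N g = 0.
Proof.
move=> g0; rewrite /hnorm /= (_ : Rintegral _ _ _ = 0) ?sqrtr0//.
rewrite (@ae_eq_lower_Rintegral _ _ _ (vol Om) setT _ (cst 0)).
  by rewrite /Rintegral integral0.
by apply: filterS g0 => x gx _; rewrite /= gx mulr0.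
Qed.

(** This is the purpose of the fundamental lemma: [wpartial] is an arbitrary choice, and uniqueness
    makes it linear up to distance 0. *)
Lemma is_wpartial_unique i v g g' : is_wpartial i v g -> is_wpartial i v g' ->
  N (g - g') = 0.
Proof.
move=> vg vg'; apply: ae_hnorm0; apply: orth_testfun_eq0 => phi tf.
have [Phi PE] := testfun_L2 tf; have h1 := vg _ tf; have h2 := vg' _ tf.
rewrite -PE in h1 h2 *; have := hipBl PL (x := g) (y := g') (z := Phi) I I I.
rewrite /= => ->; apply/eqP; rewrite subr_eq0; apply/eqP/oppr_inj.
by rewrite -h1 -h2.
Qed.

Lemma wpartialP i v : sobH1 v -> is_wpartial i v (wpartial i v).
Proof. by move=> /(_ i) h; exact: (@xgetPex _ 0 [set g | is_wpartial i v g]). Qed.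

Lemma sobH1_lin k u v : sobH1 u -> sobH1 v -> sobH1 (k *: u + v).
Proof.
move=> hu hv i; exists (k *: wpartial i u + wpartial i v).
by apply: is_wpartial_lin; exact: wpartialP.
Qed.

Lemma wpartial_lin i k u v : sobH1 u -> sobH1 v ->
  N (wpartial i (k *: u + v) - (k *: wpartial i u + wpartial i v)) = 0.
Proof.
move=> hu hv; apply: is_wpartial_unique; first by apply: wpartialP; exact: sobH1_lin.
by apply: is_wpartial_lin; exact: wpartialP.
Qed.

Lemma hip_congr u v g : N (u - v) = 0 -> ip u g = ip v g.
Proof.
move=> uv; have := hip_eq0l PL (x := u - v) (z := g) I I uv.
by rewrite (hipBl PL)// => /eqP; rewrite subr_eq0 => /eqP.
Qed.

Lemma sobH1_0 : sobH1 (0 : H).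
Proof.
move=> i; exists 0 => phi tf.
have [Phi PE] := testfun_L2 tf; have [dPhi dPE] := testfun_L2 (testfun_pderiv i tf).
rewrite -dPE -PE; have := hip0l PL (z := Phi) I; have := hip0l PL (z := dPhi) I.
by rewrite /= => -> ->; rewrite oppr0.
Qed.

Lemma L2_sqrE v : (\int[vol Om]_x ((v x) ^+ 2)%:E = (N v ^+ 2)%:E)%E.
Proof.
rewrite (sqr_hnorm PL) /= fineK.
  by apply: eq_integral => x _; rewrite expr2.
by apply: integrable_fin_num => //; exact: L2_mul_integrable.
Qed.

Lemma L2_cvgE (s : H^nat) v :
  (\int[vol Om]_x ((s n x - v x) ^+ 2)%:E)%E @[n --> \oo] --> 0%E <->
  N (s n - v) @[n --> \oo] --> 0.
Proof.
rewrite (_ : (fun n => _) = fun n => (N (s n - v) ^+ 2)%:E); last first.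
  by apply/funext => n; rewrite -L2_sqrE.
split=> h.
  rewrite (_ : (fun n => _) = fun n => Num.sqrt (N (s n - v) ^+ 2)); last first.
    by apply/funext => n; rewrite sqrtr_sqr ger0_norm// hnorm_ge0.
  rewrite [X in _ --> X](_ : 0 = Num.sqrt 0); last by rewrite sqrtr0.
  by apply: continuous_cvg; [exact: sqrt_continuous|exact: (fine_cvg h)].
apply: cvg_EFin; first exact: nearW.
rewrite /comp /= [X in _ --> X](_ : 0 = 0 * 0); last by rewrite mulr0.
by under eq_fun do rewrite expr2; apply: cvgM.
Qed.

End sobolev_theory.

(** * The gradient form on H_0^1 *)

Section gradient_space.
Variables (R : realType) (d : nat) (Om : polytope R d).
Local Notation H := (L2 Om).
Local Notation L := (L2space Om).
Let PL := L2space_prehilb Om.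
Local Notation ip := (hip L).
Local Notation N := (hnorm L).
Implicit Types (u v g : H).

(** The approximating test functions and their derivatives are carried as elements of [L2], so that
    limits of linear combinations are handled by the seminorm. *)
Lemma sobH10P v : sobH10 v <-> sobH1 v /\
  exists (phi : ('rV[R]_d -> R)^nat) (Phi : H^nat) (dPhi : 'I_d -> H^nat),
  [/\ (forall n, testfun Om (phi n)), (forall n, (Phi n : 'rV[R]_d -> R) = phi n),
      (forall i n, (dPhi i n : 'rV[R]_d -> R) = pderiv i (phi n)),
      N (Phi n - v) @[n --> \oo] --> 0 &
      forall i, N (dPhi i n - wpartial i v) @[n --> \oo] --> 0].
Proof.
split=> [[v1 [phi tf [cv cdv]]]|[v1 [phi [Phi [dPhi [tf PE dPE cv cdv]]]]]].
  split => //; have [Phi PE] := choice (fun n => testfun_L2 (tf n)).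
  pose D i := choice (fun n => testfun_L2 (testfun_pderiv i (tf n))).
  have dPE i n : (projT1 (D i) n : 'rV[R]_d -> R) = pderiv i (phi n) := projT2 (D i) n.
  exists phi, Phi, (fun i => projT1 (D i)); split => //.
    by apply/L2_cvgE; move: cv; under eq_fun do rewrite -PE.
  by move=> i; apply/L2_cvgE; move: (cdv i); under eq_fun do rewrite -dPE.
split => //; exists phi => //; split.
  by under eq_fun do rewrite -PE; exact/L2_cvgE.
by move=> i; under eq_fun do rewrite -dPE; exact/L2_cvgE.
Qed.

Lemma hnorm_congr u v : N (u - v) = 0 -> N u = N v.
Proof.
move=> uv; rewrite /hnorm (hip_congr u uv) (hipC PL v u) (hip_congr v uv).
by [].
Qed.

Lemma sobH10_lin k u v : sobH10 u -> sobH10 v -> sobH10 (k *: u + v).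
Proof.
move=> /sobH10P[u1 [phi [Phi [dPhi [tf PE dPE cu cdu]]]]].
move=> /sobH10P[v1 [psi [Psi [dPsi [tg QE dQE cv cdv]]]]].
apply/sobH10P; split; first exact: sobH1_lin.
exists (fun n y => k * phi n y + psi n y), (fun n => k *: Phi n + Psi n),
  (fun i n => k *: dPhi i n + dPsi i n); split.
- by move=> n; exact: testfun_lin.
- by move=> n; apply/funext => x; rewrite -PE -QE.
- by move=> i n; apply/funext => x; rewrite (pderiv_lin _ _ _ (tf n) (tg n)) -dPE -dQE.
- exact: (cvg_hnorm_lin PL).
move=> i.
have c := cvg_hnorm_lin PL k (s := dPhi i) (s' := dPsi i) (x := wpartial i u)
  (y := wpartial i v) (fun=> I) (fun=> I) I I (cdu i) (cdv i).
apply: cvg_trans c; apply: near_eq_cvg; apply: nearW => n.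
apply: hnorm_congr; rewrite opprB addrC addrA subrK.
exact: wpartial_lin.
Qed.

Lemma sobH10_0 : sobH10 (0 : H).
Proof.
apply/sobH10P; split; first exact: sobH1_0.
have tf := testfun0 Om.
exists (fun=> cst 0), (fun=> 0), (fun _ _ => 0); split => //.
- by move=> i n; apply/funext => x; rewrite /pderiv derive_cst.
- by under eq_fun do rewrite subrr (hnorm0 PL); exact: cvg_cst.
move=> i.
have h : N (0 - wpartial i (0 : H)) = 0.
  apply: (@is_wpartial_unique _ _ _ i 0); last by apply: wpartialP; exact: sobH1_0.
  move=> phi tphi.
  have [Phi PE] := testfun_L2 tphi; have [dPhi dPE] := testfun_L2 (testfun_pderiv i tphi).
  rewrite -dPE -PE; have := hip0l PL (z := Phi) I; have := hip0l PL (z := dPhi) I.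
  by rewrite /= => -> ->; rewrite oppr0.
by under eq_fun do rewrite h; exact: cvg_cst.
Qed.

(** With this structure [hnorm] is [grad_norm], and the lemmas on pre-Hilbert spaces apply to
    gradients. *)
Definition gradspace : hspace H := {| hin := @sobH10 R d Om ; hip := @grad_ip R d Om |}.

Lemma grad_ip_lin k u v z : sobH1 u -> sobH1 v ->
  grad_ip (k *: u + v) z = k * grad_ip u z + grad_ip v z.
Proof.
move=> u1 v1; rewrite /grad_ip mulr_sumr -big_split; apply: eq_bigr => i _.
rewrite (hip_congr _ (wpartial_lin i k u1 v1)).
by rewrite (hipDl PL)// (hipZl PL).
Qed.

Lemma grad_prehilb : prehilb gradspace.
Proof.
have ip0 z : grad_ip (0 : H) z = 0.
  have := @grad_ip_lin (-1) 0 0 z (sobH1_0 Om) (sobH1_0 Om).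
  by rewrite scaler0 addr0 => h; lra.
split => /=.
- exact: sobH10_0.
- by move=> x y hx hy; have := sobH10_lin 1 hx hy; rewrite scale1r.
- by move=> k x hx; have := sobH10_lin k hx sobH10_0; rewrite addr0.
- by move=> x y; apply: eq_bigr => i _; rewrite (hipC PL).
- move=> x y z [x1 _] [y1 _] _.
  by have := grad_ip_lin 1 z x1 y1; rewrite scale1r mul1r.
- move=> k x z [x1 _] _; have := grad_ip_lin k z x1 (sobH1_0 Om).
  by rewrite addr0 ip0 addr0.
- by move=> x; apply: sumr_ge0 => i _; exact: (hip_ge0 PL).
Qed.

Lemma sqr_grad_norm v : grad_norm v ^+ 2 = grad_ip v v.
Proof. exact: (sqr_hnorm grad_prehilb v). Qed.

Lemma grad_norm_segment u v th : sobH10 u -> sobH10 v ->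
  grad_norm (u + th *: v) ^+ 2 =
  grad_norm u ^+ 2 + 2 * (th * grad_ip u v) + th ^+ 2 * grad_ip v v.
Proof. exact: (hnorm_segment grad_prehilb). Qed.

Lemma findim_subspace_lin (W : set H) k u v : findim_subspace W -> W u -> W v -> W (k *: u + v).
Proof.
move=> [n [e ->]] [a au] [b bv]; exists (fun i => k * a i + b i).
apply/eqP; rewrite eq_le hnorm_ge0 andbT.
have -> : k *: u + v - \sum_i (k * a i + b i) *: e i =
    k *: (u - \sum_i a i *: e i) + (v - \sum_i b i *: e i).
  under eq_bigr do rewrite scalerDl -scalerA.
  by rewrite big_split/= -scaler_sumr scalerBr opprD addrACA.
apply: (le_trans (ler_hnormD PL _ _)) => //.
by rewrite (hnormZ PL)// au bv mulr0 addr0.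
Qed.

End gradient_space.

(** * Pointwise error inequality *)

Section variational_inequality.
Variables (R : realType) (d : nat) (Om : polytope R d).
Local Notation H := (L2 Om).
Context dX (X : measurableType dX) (mu : {finite_measure set X -> \bar R}).
Variables (a : R) (c : X -> R).
Hypotheses (a_ge0 : 0 <= a) (c_meas : measurable_fun setT c) (c_gt0 : forall r, 0 < c r).
Local Notation HH := (Hspace Om mu a c).
Let PH : prehilb HH := Hspace_prehilb Om mu a_ge0 c_meas c_gt0.
Let PG := @grad_prehilb R d Om.

Let divide_segment (th gU A gZ B D : R) : 0 < th -> 2^-1 * gU + th * A <= 2^-1 * gZ ->
  gZ = gU + 2 * (th * B) + th ^+ 2 * D -> A <= B + th / 2 * D.
Proof. by move=> th0 h gE; rewrite -(ler_pM2l th0); lra. Qed.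

(** The inclusion is tested with [U + th (Y - U)]. The energy is quadratic along the segment, so
    division by [th] leaves [hip xi (Y - U) <= B + th / 2 * D], and [th] tends to 0. Finite energy
    at [Y] forces finite energy at [U]. *)
Lemma energy_variational (C : set (H * (X -> H))) U Y xi :
  subdifferential HH (energy C) U xi -> sobH10 Y.1 -> hin HH Y ->
  (forall th, 0 <= th <= 1 -> C (U + th *: (Y - U)) ) ->
  sobH10 U.1 /\ (C U /\ hip HH xi (Y - U) <= grad_ip U.1 (Y.1 - U.1)).
Proof.
move=> [UX xiX sub] Y10 YX Cth.
have CY : C Y by have := Cth 1; rewrite ler01 lexx scale1r subrKC => /(_ isT).
have U10 : sobH10 U.1 /\ C U.
  have := sub Y YX; rewrite /energy (asboolT (conj Y10 CY)).
  case: asboolP => // _.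
have [{}U10 CU] := U10; split => //; split => //.
set B := grad_ip U.1 _; set D := grad_ip (Y.1 - U.1) (Y.1 - U.1).
have BX : hin HH (Y - U) by exact: hinB.
have D10 : sobH10 (Y.1 - U.1) := hinB PG Y10 U10.
have D0 : 0 <= D := hip_ge0 PG _.
have key th : 0 < th <= 1 -> hip HH xi (Y - U) <= B + th / 2 * D.
  move=> /andP[th0 th1]; set Z := U + th *: (Y - U).
  have ZX : hin HH Z := hinD PH UX (hinZ PH th BX).
  have Z10 : sobH10 Z.1 := hinD PG U10 (hinZ PG th D10).
  have CZ : C Z by apply: Cth; rewrite ltW.
  have := sub Z ZX; rewrite /energy (asboolT (conj U10 CU)) (asboolT (conj Z10 CZ)).
  have -> : Z - U = th *: (Y - U) by rewrite /Z addrC addKr.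
  have hZ := hipZr PH th BX xiX.
  rewrite hZ -EFinD lee_fin.
  move=> h; exact: (divide_segment th0 h (grad_norm_segment th U10 D10)).
apply/ler_addgt0Pr => e e0.
have [th [th0 th1 thD]] : exists th, [/\ 0 < th, th <= 1 & th / 2 * D <= e].
  (* The minimum keeps [th] on the segment, and [D + 1] avoids dividing by 0. *)
  exists (Num.min 1 (e / (D + 1))).
  have D1 : 0 < D + 1 by rewrite ltr_wpDl.
  split; [by rewrite lt_min ltr01 divr_gt0|by rewrite ge_min lexx|].
  have h : Num.min 1 (e / (D + 1)) <= e / (D + 1) by rewrite ge_min lexx orbT.
  have h2 : e / (D + 1) * D <= e.
    by rewrite mulrAC ler_pdivrMr// ler_wpM2l ?(ltW e0)// lerDl.
  have h0 : 0 <= e / (D + 1) * D by rewrite !mulr_ge0 ?invr_ge0 ?(ltW e0)// ltW.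
  have := ler_wpM2r D0 h; lra.
by apply: (le_trans (key th _)); rewrite ?th0// lerD2l.
Qed.

End variational_inequality.

(** * Algebra of the error inequality *)

Section error_algebra.
Variables (R : realType) (E : lmodType R) (X : hspace E) (PX : prehilb X).
Local Notation ip := (hip X).
Local Notation "x \inX" := (hin X x) (at level 70).

Lemma hip_young_scaled k x y : 0 < k -> x \inX -> y \inX ->
  ip x y <= 2^-1 * (k * ip x x + k^-1 * ip y y).
Proof.
move=> k0 xX yX; have kX := hinZ PX k xX.
have ki : 0 <= k^-1 by rewrite invr_ge0 ltW.
have := hip_young PX kX yX; rewrite !(hipZl PX)// (hipZr PX)// => /(ler_wpM2l ki).
rewrite mulrDr mulrCA !mulKf ?gt_eqF//; lra.
Qed.

Lemma hip_cross_diff u v : u \inX -> v \inX ->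
  ip u (v - u) + ip v (u - v) = - ip (u - v) (u - v).
Proof.
by move=> uX vX; rewrite hip_subE// !(hipBr PX)// (hipC PX v u); lra.
Qed.

Lemma hip_projection u v p : u \inX -> v \inX -> p \inX -> ip p v = ip u v ->
  ip v (p - v) = ip v (u - v).
Proof. by move=> uX vX pX e; rewrite !(hipBr PX)// (hipC PX v p) (hipC PX v u) e. Qed.

Lemma hip_sub_le x y b : x \inX -> y \inX -> hnorm X (x - y) <= b ->
  ip (y - x) (y - x) <= b ^+ 2.
Proof.
move=> xX yX h; rewrite -(sqr_hnorm PX) (hnormBC PX)// ler_sqr//.
  by rewrite nnegrE hnorm_ge0.
by rewrite nnegrE; exact: le_trans (hnorm_ge0 _ _) h.
Qed.

(** [P] is the correction that makes [U] admissible for the second inclusion; [A] and [B] will be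
    the gradient terms. After addition, [F] survives only against [P]. *)
Lemma monotone_error (F V V' U U' P : E) (A B : R) :
  F \inX -> V \inX -> V' \inX -> U \inX -> U' \inX -> P \inX ->
  ip (F - V) (U' - U) <= A -> ip (F - V') ((U + P) - U') <= B ->
  ip (V - V') (U - U') <= A + B + ip V' P - ip F P.
Proof.
move=> FX VX V'X UX U'X PX'.
have UPX := hinD PX UX PX'; have bX := hinB PX UX U'X; have b'X := hinB PX U'X UX.
have cX := hinB PX UPX U'X.
rewrite !(hipBl PX)// !(hipBr PX)// !(hipDr PX)//; lra.
Qed.

End error_algebra.

Section error_inequality.
Variables (R : realType) (d : nat) (Om : polytope R d).
Local Notation H := (L2 Om).
Local Notation L := (L2space Om).
Context dX (X : measurableType dX) (mu : {finite_measure set X -> \bar R}).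
Variables (a : R) (c : X -> R) (K : X -> set (L2 Om)).
Hypotheses (a_ge0 : 0 <= a) (c_meas : measurable_fun setT c) (c_gt0 : forall r, 0 < c r).
Hypotheses (c_int : (\int[mu]_r (c r)%:E < +oo)%E).
Hypothesis (K_convex : forall r, convex_set (K r)).
Local Notation HH := (Hspace Om mu a c).
Let PH : prehilb HH := Hspace_prehilb Om mu a_ge0 c_meas c_gt0.
Let PM : prehilb (Mspace Om mu c) := Mspace_prehilb Om mu c_meas c_gt0.
Let PG := @grad_prehilb R d Om.
Let PL := L2space_prehilb Om.

Lemma convex_set_segment (M : lmodType R) (A : set M) x y th : convex_set A -> A x -> A y ->
  0 <= th <= 1 -> A (x + th *: (y - x)).
Proof.
move=> cA Ax Ay /andP[th0 th1].
have thP : Itv.spec (@Itv.num_sem R) (Itv.Real `[0%Z, 1%Z]) th.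
  by rewrite /Itv.spec/= /Itv.num_sem/= num_real/= in_itv/= th0 th1.
have := set_mem (cA y x (Itv.mk thP) (mem_set Ay) (mem_set Ax)).
rewrite /conv/= scalerBl scale1r => h.
by have -> : x + th *: (y - x) = th *: y + (x - th *: x)
  by rewrite scalerBr addrCA addrA.
Qed.

Lemma constraint_segment U Y th : constraint mu a c K U -> constraint mu a c K Y ->
  0 <= th <= 1 -> constraint mu a c K (U + th *: (Y - U)).
Proof.
move=> [UX KU] [YX KY] th01; split; first exact: (hinD PH UX (hinZ PH th (hinB PH YX UX))).
apply: filterS2 KU KY => r KU KY.
have := convex_set_segment (K_convex (r:=r)) KU KY th01.
congr (K r _).
have -> : (U + th *: (Y - U)).2 r = U.2 r + th *: (Y.2 r - U.2 r) by [].
have -> : (U + th *: (Y - U)).1 = U.1 + th *: (Y.1 - U.1) by [].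
move: (U.1) (Y.1) (U.2 r) (Y.2 r) => u y w z.
rewrite [in RHS]opprD [in RHS]addrACA -scalerBr; congr (_ + th *: _).
by rewrite !opprB addrACA [in RHS]addrACA (addrC (- u)).
Qed.

(** The factor is Lambda: [kappa] comes from the first component and [Sc] from integrating the
    constant second one. *)
Lemma Hspace_const (rho : H) : let P : H * (X -> H) := (rho, fun=> rho) in
  hin HH P /\ hip HH P P = (kappa a + Sc mu c) * hip L rho rho.
Proof.
have [h1 h2] := bspace_cst PL c_meas (fun r => ltW (c_gt0 r)) (I : hin L rho) c_int.
split; first exact: h1.
have -> : hip HH (rho, fun=> rho) (rho, fun=> rho) =
  kappa a * hip L rho rho + hip (bspace L mu c) (fun=> rho) (fun=> rho) by [].
by rewrite h2 [RHS]mulrDl.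
Qed.

(** Lets the [|rho|^2] coming from the source, which carries no weight, be absorbed into
    [Lambda |rho|^2]. *)
Lemma Lam_ge1 : 1 <= kappa a + Sc mu c.
Proof.
have S0 : 0 <= Sc mu c by apply: Rintegral_ge0 => r _; exact: ltW.
by rewrite /kappa -addrA lerDl addr_ge0.
Qed.

(** The factor [1 / kappa] in the source cancels the weight of the first component. *)
Lemma hip_source (g : H) (P : H * (X -> H)) : hin HH P ->
  hip HH ((kappa a)^-1 *: g, 0) P = hip L g P.1.
Proof.
move=> PX; have k0 : kappa a != 0 by rewrite gt_eqF// ltr_wpDr.
have -> : hip HH ((kappa a)^-1 *: g, 0) P =
  kappa a * hip L ((kappa a)^-1 *: g) P.1 + hip (Mspace Om mu c) 0 P.2 by [].
by rewrite (hip0l PM PX) addr0 (hipZl PL)// mulrA divff// mul1r.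
Qed.


Lemma energy_inE (C : set (H * (X -> H))) U : sobH10 U.1 -> C U ->
  energy C U = (2^-1 * grad_norm U.1 ^+ 2)%:E.
Proof. by move=> U10 CU; rewrite /energy (asboolT (conj U10 CU)). Qed.

Lemma energy_lty (C : set (H * (X -> H))) U : (energy C U < +oo)%E -> sobH10 U.1 /\ C U.
Proof. by rewrite /energy; case: asboolP => [h _|_]; [exact: h|rewrite ltxx]. Qed.

Lemma energy_domain (C : set (H * (X -> H))) U Z xi :
  subdifferential HH (energy C) U xi -> hin HH Z -> sobH10 Z.1 -> C Z ->
  sobH10 U.1 /\ C U.
Proof.
move=> [_ _ sub] ZX Z10 CZ; apply: energy_lty.
have := sub Z ZX; rewrite (energy_inE Z10 CZ).
by move: (energy C U) => [y _||_]; [exact: ltry|by []|by rewrite ltNye].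
Qed.

(** Here [k] is [h^2], [q] is [<E', E>], [G] is [|grad e|^2], [Q] and [S] are the pairings of the
    correction with [V'] and the source, [r2] is [|rho|^2] and [n] the H^2 norm. The two Young
    remainders add up to [(Lam + 1) / 2 * k^-1 * r2 <= Lam * k^-1 * r2], and [r2 <= (C * k * n)^2]
    leaves one factor [k]. *)
Let combine_bounds (q G Q S A B k kV r2 Lam g2 C n : R) :
  0 < k -> q <= A + B + Q - S -> A + B = - G ->
  Q <= 2^-1 * (k * kV + k^-1 * (Lam * r2)) -> - S <= 2^-1 * (k * g2 + k^-1 * r2) ->
  1 <= Lam -> r2 <= (C * k * n) ^+ 2 ->
  q + G <= k * (2^-1 * kV + 2^-1 * g2) + k * (C ^+ 2 * Lam * n ^+ 2).
Proof.
move=> k0 h1 h2 h3 h4 Lam1 hr.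
have {hr} hr : k^-1 * r2 <= k * (C ^+ 2 * n ^+ 2).
  rewrite mulrC ler_pdivrMr//; move: hr; rewrite !exprMn; nra.
have hL : 0 <= (Lam - 1) * (k * (C ^+ 2 * n ^+ 2) - k^-1 * r2).
  by rewrite mulr_ge0// subr_ge0.
have hn : 0 <= (Lam - 1) * (k * (C ^+ 2 * n ^+ 2)).
  by rewrite mulr_ge0// ?subr_ge0// mulr_ge0 ?(ltW k0)// mulr_ge0// sqr_ge0.
have eL : k^-1 * (Lam * r2) = Lam * (k^-1 * r2) by rewrite mulrCA.
move: (k^-1 * r2) (C ^+ 2) (n ^+ 2) eL h3 h4 hr hL hn => x C2 n2 ->; nra.
Qed.

Lemma error_inequality (W : set H) (P : H -> H) (U Uh Z F V V' : H * (X -> H)) g C h n :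
  W `<=` @sobH10 R d Om -> findim_subspace W -> is_ritz W P ->
  hin HH F -> hin HH V -> hin HH V' -> F = ((kappa a)^-1 *: g, 0) ->
  constraint mu a c K Z -> W Z.1 -> 0 < h ->
  (sobH10 U.1 -> hnorm L (U.1 - P U.1) <= C * h ^+ 2 * n) ->
  subdifferential HH (Psi mu a c K) U (F - V) ->
  subdifferential HH (Psi_h mu a c K W) Uh (F - V') ->
  hip HH (V - V') (U - Uh) + grad_norm (U.1 - Uh.1) ^+ 2 <=
  h ^+ 2 * (2^-1 * hip HH V' V' + 2^-1 * hip L g g) +
  h ^+ 2 * (C ^+ 2 * (kappa a + Sc mu c) * n ^+ 2).
Proof.
move=> W10 Wfd ritz FX VX V'X Fg CZ WZ h_gt0 rho_le dU dUh.
have UX : hin HH U by case: dU.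
have UhX : hin HH Uh by case: dUh.
have Z10 := W10 _ WZ; have ZX := CZ.1.
(* Both energies are finite at [Z], so the inclusions force them to be finite at [U] and [Uh]. *)
have [U10 CU] := energy_domain dU ZX Z10 CZ.
have [_ [CUh WUh]] := energy_domain dUh ZX Z10 (conj CZ WZ).
have Uh10 := W10 _ WUh.
have [_ [_ ineq1]] := energy_variational a_ge0 c_meas c_gt0 dU Uh10 UhX
  (fun th h01 => constraint_segment CU CUh h01).
(* Adding [D] leaves [u - w(r)] unchanged and turns [u] into its Ritz projection. *)
pose rho := P U.1 - U.1; pose D : H * (X -> H) := (rho, fun=> rho).
have [DX DD] := Hspace_const rho; rewrite -/D in DX DD.
have [WP ritzU] := ritz _ U10.
have UDE : (U + D).1 = P U.1 by rewrite /= subrKC.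
have CUD : constraint mu a c K (U + D).
  split; first exact: (hinD PH UX DX).
  by apply: filterS CU.2 => r; rewrite /= opprD addrACA subrr addr0.
have UDX := CUD.1.
have UD10 : sobH10 (U + D).1 by rewrite UDE; exact: W10.
have WUD : W (U + D).1 by rewrite UDE.
have segment th : 0 <= th <= 1 ->
    [set Y | constraint mu a c K Y /\ W Y.1] (Uh + th *: (U + D - Uh)).
  move=> th01; split; first exact: (constraint_segment CUh CUD th01).
  have -> : (Uh + th *: (U + D - Uh)).1 = (- th) *: Uh.1 + (th *: (U + D).1 + Uh.1).
    by rewrite /= scalerBr scaleNr addrC addrAC addrC.
  apply: findim_subspace_lin => //; exact: findim_subspace_lin.
have [_ [_ ineq2]] := energy_variational a_ge0 c_meas c_gt0 dUh UD10 UDX segment.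
have PU10 : sobH10 (P U.1) := W10 _ WP.
have grad2 : grad_ip Uh.1 (P U.1 - Uh.1) = grad_ip Uh.1 (U.1 - Uh.1) :=
  hip_projection PG U10 Uh10 PU10 (ritzU _ WUh).
rewrite UDE grad2 in ineq2.
have key := monotone_error PH FX VX V'X UX UhX DX ineq1 ineq2.
have cross := hip_cross_diff PG U10 Uh10.
have FD : hip HH F D = hip L g rho by rewrite Fg hip_source.
rewrite FD in key.
have h2_gt0 : 0 < h ^+ 2 by rewrite exprn_gt0.
have young1 := hip_young_scaled PH h2_gt0 V'X DX.
rewrite DD in young1.
have young2 := hip_young_scaled PL h2_gt0 (I : hin L (- g)) (I : hin L rho).
rewrite (hipNl PL (I : hin L g) (I : hin L rho)) in young2.
rewrite (hipNl PL (I : hin L g) (I : hin L (- g))) in young2.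
rewrite (hipNr PL (I : hin L g) (I : hin L g)) opprK in young2.
have rho2 := hip_sub_le PL (I : hin L U.1) (I : hin L (P U.1)) (rho_le U10).
rewrite (sqr_grad_norm (U.1 - Uh.1)).
exact: (combine_bounds h2_gt0 key cross young1 young2 Lam_ge1 rho2).
Qed.

End error_inequality.

(** * Integration in time *)

Section lower_integral_add.
Context dT (T : measurableType dT) (R : realType).
Variables (mu : {measure set T -> \bar R}) (D : set T).
Hypothesis mD : measurable D.
Implicit Types (w m : T -> R).
Import HBNNSimple.

Lemma lower_integral_le m x : (forall t, D t -> 0 <= m t) ->
  (forall s : T -> R, measurable_fun setT s -> (forall t, 0 <= s t) ->
    (forall t, D t -> s t <= m t) -> (\int[mu]_(t in D) (s t)%:E <= x)%E) ->
  (\int[mu]_(t in D) (m t)%:E <= x)%E.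
Proof.
move=> m0 H; rewrite ge0_integralE; last by move=> t Dt; rewrite lee_fin m0.
apply/ge_ereal_sup => _ [s /= sf <-].
have s0 t : 0 <= s t by [].
have sD t : ~ D t -> s t = 0.
  move=> nD; apply/eqP; rewrite eq_le s0 andbT -lee_fin (le_trans (sf t))//.
  by rewrite patchE memNset.
rewrite -integralT_nnsfun; have -> : (\int[mu]_t (s t)%:E = \int[mu]_(t in D) (s t)%:E)%E.
  rewrite [RHS]integral_mkcond; apply: eq_integral => t _; rewrite patchE.
  by case: ifPn => // /negP nD; rewrite sD// => Dt; apply: nD; exact: mem_set.
apply: H => // t Dt; have := sf t.
by rewrite patchE mem_set// lee_fin.
Qed.

(** If a measurable [s] lies below [w + m], then [max 0 (s - w)] lies below [m] and is measurable,
    because [w] is. *)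
Lemma lower_integral_subadd w m : measurable_fun D w ->
  (forall t, D t -> 0 <= w t) -> (forall t, D t -> 0 <= m t) ->
  (\int[mu]_(t in D) (w t + m t)%:E <=
   \int[mu]_(t in D) (w t)%:E + \int[mu]_(t in D) (m t)%:E)%E.
Proof.
move=> mw w0 m0; apply: lower_integral_le => [t Dt|s ms s0 sle].
  by rewrite addr_ge0 ?w0 ?m0.
pose r t := Num.max 0 (s t - w t).
have mr : measurable_fun D r.
  by apply: measurable_maxr => //; apply: measurable_funB => //; exact: measurable_funTS.
have r0 t : D t -> 0 <= r t by rewrite /r le_max lexx.
apply: (@le_trans _ _ (\int[mu]_(t in D) ((w t)%:E + (r t)%:E))%E).
  apply: ge0_le_lower_integral => t Dt; rewrite lee_fin ?s0//.
  by rewrite -lerBlDl le_max lexx orbT.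
rewrite ge0_integralD//.
- rewrite leeD2l//; apply: ge0_le_lower_integral => t Dt; rewrite lee_fin ?r0//.
  by rewrite ge_max m0// lerBlDl sle.
- exact/measurable_EFinP.
- exact/measurable_EFinP.
Qed.

(** The integral of [w] is finite, so it can be moved to the other side; then each measurable [s]
    below [m] gives [w + s] below [w + m]. *)
Lemma lower_integral_superadd w m : mu.-integrable D (EFin \o w) ->
  (forall t, D t -> 0 <= w t) -> (forall t, D t -> 0 <= m t) ->
  (\int[mu]_(t in D) (w t)%:E + \int[mu]_(t in D) (m t)%:E <=
   \int[mu]_(t in D) (w t + m t)%:E)%E.
Proof.
move=> wi w0 m0; have wfin := integrable_fin_num mD wi.
have mw : measurable_fun D (EFin \o w) by case/integrableP: wi.
rewrite -leeBrDl//; apply: lower_integral_le => // s ms s0 sle.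
rewrite leeBrDl// -ge0_integralD//.
- apply: ge0_le_lower_integral => t Dt; rewrite lee_fin ?addr_ge0 ?w0 ?s0//.
  by rewrite lerD2l sle.
- by move=> t Dt; rewrite lee_fin s0.
- by apply/measurable_EFinP; exact: measurable_funTS.
Qed.

End lower_integral_add.

(** * Time integration of the error inequality *)

Section integrated_error.
Variables (R : realType) (E : lmodType R) (X : hspace E).
Hypothesis PX : prehilb X.
Local Notation leb := (@lebesgue_measure R).
Local Notation ip := (hip X).
Local Notation mR := (measurableTypeR R).
Variables (T : R) (U V : R -> E).
Hypotheses (T0 : 0 < T) (UV : h1line X T U V).
Variables (g w m : R -> R).
Local Notation D := (`]0, T[%classic : set mR).
Hypotheses (wi : leb.-integrable D (EFin \o w)).
Hypotheses (g0 : forall t, 0 <= g t) (w0 : forall t, 0 <= w t) (m0 : forall t, 0 <= m t).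
Hypothesis ineq : {ae leb, forall t, D t -> ip (V t) (U t) + g t <= w t + m t}.

Let B := (\int[leb]_(t in D) (w t)%:E + \int[leb]_(t in D) (m t)%:E)%E.
Let q (t : mR) := ip (V t) (U t).
Let qp (t : mR) := Num.max 0 (q t).
Let qn (t : mR) := Num.max 0 (- q t).

Let mD : measurable D. Proof. exact: measurable_itv. Qed.

Let qi (A : set mR) : measurable A -> leb.-integrable A (EFin \o q).
Proof. exact: (h1_VU_int PX T0 UV). Qed.

Let qpi (A : set mR) : measurable A -> leb.-integrable A (EFin \o qp).
Proof.
move=> mA; apply: (le_integrable mA _ _ (qi mA)).
  apply/measurable_EFinP; apply: measurable_maxr => //.
  by apply/measurable_EFinP; case/integrableP: (qi mA).
move=> t _ /=; rewrite lee_fin ger0_norm ?le_max ?lexx//.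
by rewrite ge_max normr_ge0 ler_norm.
Qed.

Let qni (A : set mR) : measurable A -> leb.-integrable A (EFin \o qn).
Proof.
move=> mA; apply: (le_integrable mA _ _ (qi mA)).
  apply/measurable_EFinP; apply: measurable_maxr => //; apply: measurable_funN => //.
  by apply/measurable_EFinP; case/integrableP: (qi mA).
move=> t _ /=; rewrite lee_fin ger0_norm ?le_max ?lexx//.
by rewrite ge_max normr_ge0 -normrN ler_norm.
Qed.

Let mw : measurable_fun D w.
Proof. by apply/measurable_EFinP; case/integrableP: wi. Qed.

Let wm_le : (\int[leb]_(t in D) (w t + m t)%:E <= B)%E.
Proof. by apply: lower_integral_subadd. Qed.

Let qp_le : (\int[leb]_(t in D) (qp t)%:E <= B)%E.
Proof.
apply: le_trans wm_le; apply: ae_ge0_le_lower_integral.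
- by move=> t _; rewrite lee_fin le_max lexx.
- by move=> t _; rewrite lee_fin addr_ge0.
apply: (@filterS _ _ (ae_filter_ringOfSetsType leb)) ineq => t + Dt => /(_ Dt) h.
rewrite lee_fin ge_max addr_ge0//=; apply: le_trans h.
by rewrite lerDl.
Qed.

(** By the chain rule, the increment of [|U|^2] is twice the integral of [q]. This is bounded by the
    integral of the positive part over the whole interval, and that part lies below [w + m] because
    [g] is nonnegative. *)
Lemma h1_sqr_le t : t \in `[0, T] ->
  ((ip (U t) (U t))%:E <= (ip (U 0) (U 0))%:E + 2%:E * B)%E.
Proof.
rewrite in_itv/= => /andP[t0 tT].
have := h1_chain_rule PX T0 UV t0; move/(canRL (subrK _)) => ->.
rewrite addrC EFinD EFinM leeD2l// lee_pmul2l//; apply: le_trans qp_le.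
have mA : measurable (`]0, t]%classic : set mR) by exact: measurable_itv.
rewrite /Rintegral fineK; last exact: (integrable_fin_num mA (qi mA)).
have mqp (A : set mR) : measurable A -> measurable_fun A (EFin \o qp).
  by move=> mA'; case/integrableP: (qpi mA').
rewrite (integral_itv_bndo_bndc (mqp _ mD)).
apply: (@le_trans _ _ (\int[leb]_(r in (`]0%R, t]%classic : set mR)) (qp r)%:E)%E).
  apply: le_integral => //; [exact: qi|exact: qpi|].
  by move=> r _; rewrite lee_fin le_max lexx orbT.
have mB : measurable (`]0, T]%classic : set mR) by exact: measurable_itv.
apply: (ge0_subset_integral _ mA mB).
- exact: mqp.
- by move=> r _; rewrite lee_fin le_max lexx.
- by move=> r; rewrite /= !in_itv/= => /andP[-> /le_trans]; exact.
Qed.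

(** [q] has no sign, so the inequality is rewritten as [qp + g <= qn + (w + m)], with nonnegative
    sides that can be compared by lower integrals. The integrals of [qp] and [qn] are finite, and
    their difference is half the increment of [|U|^2] over [[0, T]]. *)
Lemma h1_dissipation_le :
  (\int[leb]_(t in D) (g t)%:E <= (2^-1 * ip (U 0) (U 0))%:E + B)%E.
Proof.
have qp0 t : 0 <= qp t by rewrite le_max lexx.
have h1 := lower_integral_superadd (m := g) mD (qpi mD) (fun t _ => qp0 t) (fun t _ => g0 t).
have qE t : q t = qp t - qn t 
  by rewrite /qp /qn; move: (q t) => y; case: (leP 0 y) => ?; case: (leP 0 (- y)) => ?; lra.
have wm0 t : 0 <= w t + m t by rewrite addr_ge0.
have mqn : measurable_fun D qn.
  by apply/measurable_EFinP; case/integrableP: (qni mD).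
have qn0 t : 0 <= qn t by rewrite le_max lexx.
have h2 := lower_integral_subadd leb mD mqn (fun t _ => qn0 t) (fun t _ => wm0 t).
have h3 : (\int[leb]_(t in D) (qp t + g t)%:E <=
           \int[leb]_(t in D) (qn t + (w t + m t))%:E)%E.
  apply: ae_ge0_le_lower_integral.
  - by move=> t _; rewrite lee_fin addr_ge0// le_max lexx.
  - by move=> t _; rewrite lee_fin addr_ge0.
  apply: (@filterS _ _ (ae_filter_ringOfSetsType leb)) ineq => t + Dt => /(_ Dt) h.
  rewrite lee_fin; rewrite -/(q t) (qE t) in h; lra.
have h := le_trans (le_trans h1 h3) (le_trans h2 (leeD2l _ wm_le)).
have qpf := integrable_fin_num mD (qpi mD); have qnf := integrable_fin_num mD (qni mD).
move: h; rewrite -(fineK qpf) -(fineK qnf).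
set p := fine _; set n := fine _ => h.
have pn : p - n = 2^-1 * (ip (U T) (U T) - ip (U 0) (U 0)).
  rewrite (h1_chain_rule PX T0 UV (ltW T0)) mulKf//.
  rewrite /Rintegral -integral_itv_bndo_bndc; last by case/integrableP: (qi mD).
  rewrite -/(Rintegral _ _ _) /p /n -/(Rintegral _ _ _) -RintegralB//; [|exact: qpi|exact: qni].
  by apply: eq_Rintegral => t _; rewrite -qE.
have : (p%:E + \int[leb]_(t in D) (g t)%:E <= p%:E + ((n - p)%:E + B))%E.
  by rewrite [leRHS]addeA -(EFinD p) subrKC.
rewrite leeD2lE// => /le_trans; apply; rewrite leeD2r// lee_fin.
have := hip_ge0 PX (U T); lra.
Qed.

End integrated_error.

(** * Error bound for two paths *)

Section h1line_error.
Variables (R : realType) (E : lmodType R) (X : hspace E).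
Hypothesis PX : prehilb X.
Local Notation leb := (@lebesgue_measure R).
Local Notation ip := (hip X).
Local Notation N := (hnorm X).
Local Notation mR := (measurableTypeR R).
Variables (T : R) (T0 : 0 < T).

Lemma h1lineB U V U' V' : h1line X T U V -> h1line X T U' V' ->
  h1line X T (fun t => U t - U' t) (fun t => V t - V' t).
Proof.
move=> UV UV'; have mT : measurable (setT : set mR) by [].
have UX := h1U UV; have UX' := h1U UV'.
have VX t : hin X (V t) := (h1V UV).1 t; have VX' t : hin X (V' t) := (h1V UV').1 t.
have sV : sqint X leb (setT : set mR) V by split; [exact: h1V UV|exact: (h1_sqr_int PX UV)].
have sV' : sqint X leb (setT : set mR) V' by split; [exact: h1V UV'|exact: (h1_sqr_int PX UV')].
have [mVV' iVV'] := sqintB PX mT sV sV'.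
split => //.
- by move=> t; exact: hinB.
- by move=> t tD; rewrite (h1V0 UV tD) (h1V0 UV' tD) subrr.
- by have := integrable_fin_num mT iVV'; rewrite fin_numElt => /andP[].
- move=> a b z ab zX; have mI := measurable_ocitv a b.
  have -> : U b - U' b - (U a - U' a) = (U b - U a) - (U' b - U' a).
    by rewrite opprD addrACA -opprD.
  rewrite (hipBl PX) ?(h1ftc UV) ?(h1ftc UV')//; try exact: hinB.
  rewrite -RintegralB//; [|exact: (h1_hip_int PX UV mI)|exact: (h1_hip_int PX UV' mI)].
  by apply: eq_Rintegral => r _; rewrite (hipBl PX).
- by move=> t; rewrite (h1clamp UV) (h1clamp UV').
Qed.

Lemma h1_norm_max U V : h1line X T U V -> exists2 s, s \in `[0, T] &
  forall t, t \in `[0, T] -> ip (U t) (U t) <= ip (U s) (U s).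
Proof.
move=> UV; have UX := h1U UV.
have W0 : 0 <= \int[leb]_t ip (V t) (V t).
  by apply: Rintegral_ge0 => r _; exact: (hip_ge0 PX).
have cN : continuous (fun t => N (U t)).
  move=> t; apply/cvgrPdist_le => e e0; apply/nbhs_ballP.
  (* Hoelder continuity bounds the squared increment by this radius times the integral of [|V|^2],
     hence by [e^2]; adding 1 keeps the denominator positive. *)
  exists (e ^+ 2 / (\int[leb]_t ip (V t) (V t) + 1)).
    by rewrite /= divr_gt0 ?exprn_gt0// ltr_wpDl.
  move=> s; rewrite /ball/= => ts.
  apply: (le_trans (ler_dist_hnorm PX (UX t) (UX s))).
  rewrite -(ler_sqr (x := N _)) ?nnegrE ?hnorm_ge0 ?(ltW e0)// (sqr_hnorm PX).
  apply: (le_trans (h1_hoelder PX UV s t)).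
  move: ts; rewrite ltr_pdivlMr ?ltr_wpDl// => /ltW; apply: le_trans.
  by rewrite ler_wpM2l// lerDl.
have [s sT smax] := EVT_max (ltW T0) (continuous_subspaceT cN).
exists s => // t tT; rewrite -!(sqr_hnorm PX) ler_sqr ?nnegrE ?hnorm_ge0//.
exact: smax.
Qed.

(** Replaces the derivative and the source by versions equal almost everywhere; the inclusion
    survives for almost every time. *)
Lemma gradient_flow_h1 (Psi : E -> \bar R) (F F' : R -> E) U0 U :
  gradient_flow X T Psi F U0 U -> ae_eq leb `]0, T[%classic F F' ->
  exists V, [/\ h1line X T (U \o clamp T) V, N (U 0 - U0) = 0 &
    {ae leb, forall t, `]0, T[%classic t -> subdifferential X Psi (U t) (F' t - V t)}].
Proof.
move=> [U' [UU' U00 flow]] FF'; have [V UV U'V] := H1_timeP PX T0 UU'.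
exists V; split => //.
apply: (@filterS3 _ _ (ae_filter_ringOfSetsType leb)) flow FF' U'V => t h1 h2 h3 Dt.
by rewrite -(h2 Dt) -(h3 Dt); apply: h1.
Qed.

Lemma flow_energy_estimate (Psi : E -> \bar R) (F : R -> E) U0 phi0 U V :
  h1line X T (U \o clamp T) V -> hmeas X (F : mR -> E) ->
  (\int[leb]_t (ip (F t) (F t))%:E < +oo)%E ->
  (forall x, (0 <= Psi x)%E) -> Psi U0 = phi0%:E -> hin X U0 -> N (U 0 - U0) = 0 ->
  {ae leb, forall t, `]0, T[%classic t -> subdifferential X Psi (U t) (F t - V t)} ->
  \int[leb]_t ip (V t) (V t) <= \int[leb]_t ip (F t) (F t) + 2 * phi0.
Proof.
move=> UV mF Ffin Psi0 PsiU0 U0X UU0 flow.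
apply: (energy_estimate PX T0 UV mF Ffin Psi0 PsiU0 U0X).
  by rewrite /= clamp_id// in_itv/= lexx ltW.
apply: (@filterS _ _ (ae_filter_ringOfSetsType leb)) flow => t + Dt => /(_ Dt).
by rewrite /= clamp_id//; move: Dt; rewrite /= !in_itv/= => /andP[/ltW-> /ltW->].
Qed.

Lemma hip_dist_congr x x0 y y0 : hin X x -> hin X x0 -> hin X y -> hin X y0 ->
  N (x - x0) = 0 -> N (y - y0) = 0 -> ip (x - y) (x - y) = ip (x0 - y0) (x0 - y0).
Proof.
move=> xX x0X yX y0X xx yy; rewrite -!(sqr_hnorm PX); congr (_ ^+ 2).
apply/eqP; rewrite -subr_eq0 -normr_le0.
have h1 := hinB PX xX yX; have h2 := hinB PX x0X y0X.
apply: (le_trans (ler_dist_hnorm PX h1 h2)).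
have -> : x - y - (x0 - y0) = (x - x0) - (y - y0).
  by rewrite opprD addrACA -opprD.
apply: (le_trans (ler_hnormD PX _ _)); [exact: hinB|exact/(hinN PX)/hinB|].
by rewrite (hnormN PX) ?xx ?yy ?addr0//; exact: hinB.
Qed.

(** Sum of the bounds on the maximum and on the dissipation: [3 / 2 = 1 + 1 / 2] for the initial
    error and [3 = 2 + 1] for the data. *)
Lemma h1line_error U V U0 U' V' U0' (g w m : R -> R) :
  h1line X T (U \o clamp T) V -> h1line X T (U' \o clamp T) V' ->
  hin X U0 -> hin X U0' -> N (U 0 - U0) = 0 -> N (U' 0 - U0') = 0 ->
  leb.-integrable (`]0, T[%classic : set mR) (EFin \o w) ->
  (forall t, 0 <= g t) -> (forall t, 0 <= w t) -> (forall t, 0 <= m t) ->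
  {ae leb, forall t, `]0, T[%classic t ->
     ip (V t - V' t) (U t - U' t) + g t <= w t + m t} ->
  exists s, [/\ s \in `[0, T],
    (forall t, t \in `[0, T] -> ip (U t - U' t) (U t - U' t) <= ip (U s - U' s) (U s - U' s)) &
    ((ip (U s - U' s) (U s - U' s))%:E + \int[leb]_(t in `]0%R, T[%classic) (g t)%:E
     <= (3 / 2 * ip (U0 - U0') (U0 - U0'))%:E +
        3%:E * (\int[leb]_(t in `]0%R, T[%classic) (w t)%:E +
                \int[leb]_(t in `]0%R, T[%classic) (m t)%:E))%E].
Proof.
move=> UV UV' U0X U0X' U00 U00' wi g0 w0 m0 ineq.
have EV := h1lineB UV UV'.
have cl0 : clamp T 0 = 0 by apply: clamp_id; rewrite in_itv/= lexx ltW.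
have e0 : ip (U 0 - U' 0) (U 0 - U' 0) = ip (U0 - U0') (U0 - U0').
  have h := h1U UV 0; have h' := h1U UV' 0; rewrite /= cl0 in h h'.
  exact: hip_dist_congr.
have {}ineq : {ae leb, forall t, (`]0, T[%classic : set mR) t ->
    ip (V t - V' t) ((U \o clamp T) t - (U' \o clamp T) t) + g t <= w t + m t}.
  apply: (@filterS _ _ (ae_filter_ringOfSetsType leb)) ineq => t + Dt => /(_ Dt).
  by rewrite /= clamp_id//; move: Dt; rewrite /= !in_itv/= => /andP[/ltW-> /ltW->].
have [s sT smax] := h1_norm_max EV.
have h1 := h1_sqr_le PX T0 EV wi g0 w0 m0 ineq sT.
have h2 := h1_dissipation_le PX T0 EV wi g0 w0 m0 ineq.
rewrite /= cl0 e0 clamp_id// in h1 h2.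
exists s; split => // [t tT|]; first by have := smax t tT; rewrite /= !clamp_id.
apply: (le_trans (leeD h1 h2)).
have : (0 <= \int[leb]_(t in `]0%R, T[%classic) (w t)%:E +
             \int[leb]_(t in `]0%R, T[%classic) (m t)%:E)%E.
  by rewrite adde_ge0// integral_ge0// => t _; rewrite lee_fin.
move: (_ + _)%E (ip _ _) => [b|//|//] e b0.
  by rewrite -!EFinM -!EFinD lee_fin; lra.
by rewrite !gt0_muley ?lte_fin// !addey// leey.
Qed.

End h1line_error.

Lemma lower_integral_Zl_le dT (T : measurableType dT) (R : realType)
    (mu : {measure set T -> \bar R}) (D : set T) (k : R) (m : T -> R) :
  measurable D -> 0 < k -> (forall t, D t -> 0 <= m t) ->
  (\int[mu]_(t in D) (k * m t)%:E <= k%:E * \int[mu]_(t in D) (m t)%:E)%E.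
Proof.
move=> mD k0 m0; apply: lower_integral_le => // [t Dt|s ms s0 sle].
  by rewrite mulr_ge0 ?m0 ?ltW.
have mks : measurable_fun D (EFin \o (fun t => k^-1 * s t)).
  by apply/measurable_EFinP; apply: measurable_funM => //; exact: measurable_funTS.
have -> : (\int[mu]_(t in D) (s t)%:E = k%:E * \int[mu]_(t in D) (k^-1 * s t)%:E)%E.
  rewrite -ge0_integralZl_EFin ?ltW//.
    by apply: eq_integral => t _; rewrite -EFinM mulVKf// gt_eqF.
  by move=> t _; rewrite lee_fin mulr_ge0// invr_ge0 ltW.
rewrite lee_pmul2l//; apply: ge0_le_lower_integral => t Dt; rewrite lee_fin.
  by rewrite mulr_ge0// invr_ge0 ltW.
by rewrite ler_pdivrMl// sle.
Qed.

(** An additive map that multiplies norms by a fixed factor carries simple approximations to simple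
    approximations. *)
Lemma hmeas_map (R : realType) (E E' : lmodType R) (X : hspace E) (X' : hspace E')
    (A : E -> E') (k : R) dT (T : measurableType dT) (f : T -> E) :
  prehilb X -> (forall x, hin X x -> hin X' (A x)) -> (forall x y, A x - A y = A (x - y)) ->
  (forall x, hin X x -> hnorm X' (A x) = k * hnorm X x) ->
  hmeas X f -> hmeas X' (A \o f).
Proof.
move=> PX AX AB AN [fX [s ss sf]]; split; first by move=> t; exact: AX.
exists (fun n => A \o s n) => [n|t].
  apply/simpleP; have /simpleP[fs sX] := ss n; split; last by move=> t; exact: AX.
  exact: finitely_valued_comp.
have sX n : hin X (s n t) by have [_ + _] := ss n; exact.
have -> : (fun n => hnorm X' ((A \o s n) t - (A \o f) t)) = (fun n => k * hnorm X (s n t - f t)).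
  by apply/funext => n; rewrite /= AB AN//; exact: hinB.
by rewrite -(mulr0 k); apply: cvgM (sf t); exact: cvg_cst.
Qed.

Lemma Rintegral_support dT (T : measurableType dT) (R : realType)
    (mu : {measure set T -> \bar R}) (D : set T) (m : T -> R) :
  (forall t, ~ D t -> m t = 0) -> \int[mu]_(t in D) m t = \int[mu]_t m t.
Proof.
move=> m0; rewrite Rintegral_mkcond; apply: eq_Rintegral => t _; rewrite patchE.
by case: ifPn => // /negP tD; rewrite m0// => Dt; apply: tD; exact: mem_set.
Qed.

(** The square of the sum in [Msp] dominates [Lam * A + phi + Lam * G^2], since its cross terms are
    nonnegative. The factor 3 comes from time integration; in [1 + C^2], the 1 covers [phi] and [G],
    and [C^2] covers the H^2 term. *)
Lemma final_bound (R : realType) (C Lam h2 e0 es W phi G : R) (I M A : \bar R) :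
  1 <= Lam -> 0 < h2 -> 0 <= e0 -> 0 <= phi -> 0 <= G -> (0 <= A)%E ->
  (es%:E + I <= (3 / 2 * e0)%:E + 3%:E * (W%:E + M))%E ->
  W <= h2 * (phi + 2^-1 * G ^+ 2) ->
  (M <= (h2 * (C ^+ 2 * Lam))%:E * A)%E ->
  (es%:E + I <= (3 * (1 + C ^+ 2))%:E * (e0%:E + h2%:E *
    ((Num.sqrt Lam)%:E * sqrte A + sqrte phi%:E + (Num.sqrt Lam * G)%:E) ^+ 2))%E.
Proof.
move=> L1 h20 e00 phi0 G0 A0 le1 le2 le3.
have L0 : 0 < Num.sqrt Lam by rewrite sqrtr_gt0; lra.
have C0 : 0 < 3 * (1 + C ^+ 2) by have := sqr_ge0 C; lra.
(* The infinite case left is [A = +oo], where the right-hand side is infinite as well. *)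
move: A A0 le3 => [A| |] A0 le3 //; last first.
  rewrite /= gt0_muley ?lte_fin// !addye// mulyy gt0_muley ?lte_fin//.
  by rewrite addey// gt0_muley ?lte_fin// leey.
rewrite lee_fin in A0.
have : (es%:E + I <= (3 / 2 * e0)%:E + 3%:E * (W%:E + ((h2 * (C ^+ 2 * Lam))%:E * A%:E)))%E.
  by apply: (le_trans le1); rewrite leeD2l// lee_pmul2l// leeD2l.
move=> /le_trans; apply.
rewrite /= -!(EFinM, EFinD) lee_fin -expr2.
set S := _ + _ * G.
have hS : Lam * A + phi + Lam * G ^+ 2 <= S ^+ 2.
  have e1 : Lam = Num.sqrt Lam ^+ 2 by rewrite sqr_sqrtr//; lra.
  have e2 : A = Num.sqrt A ^+ 2 by rewrite sqr_sqrtr.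
  have e3 : phi = Num.sqrt phi ^+ 2 by rewrite sqr_sqrtr.
  rewrite {1 2}e1 {1}e2 {1}e3 /S.
  have := sqrtr_ge0 A; have := sqrtr_ge0 phi.
  move: (Num.sqrt Lam) (Num.sqrt A) (Num.sqrt phi) L0 => l x y l0 y0 x0.
  have := mulr_ge0 (mulr_ge0 (ltW l0) x0) y0.
  have := mulr_ge0 (mulr_ge0 (ltW l0) x0) (mulr_ge0 (ltW l0) G0).
  have := mulr_ge0 y0 (mulr_ge0 (ltW l0) G0).
  nra.
have hL : 0 <= (Lam - 2^-1) * G ^+ 2 by rewrite mulr_ge0 ?sqr_ge0//; lra.
have LA : 0 <= Lam * A by rewrite mulr_ge0//; lra.
have h1 : W + h2 * (C ^+ 2 * Lam) * A <= h2 * ((1 + C ^+ 2) * S ^+ 2).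
  have k1 : phi + 2^-1 * G ^+ 2 <= S ^+ 2 by lra.
  have k2 : C ^+ 2 * (Lam * A) <= C ^+ 2 * S ^+ 2 by rewrite ler_wpM2l ?sqr_ge0//; nra.
  have k3 := ler_wpM2l (ltW h20) (lerD k1 k2).
  lra.
have := mulr_ge0 (sqr_ge0 C) e00; lra.
Qed.

(** * The source term in the product space *)

Section source.
Variables (R : realType) (d : nat) (Om : polytope R d).
Local Notation H := (L2 Om).
Local Notation L := (L2space Om).
Context dX (X : measurableType dX) (mu : {finite_measure set X -> \bar R}).
Variables (a : R) (c : X -> R).
Hypotheses (a_ge0 : 0 <= a) (c_meas : measurable_fun setT c) (c_gt0 : forall r, 0 < c r).
Local Notation HH := (Hspace Om mu a c).
Let PH : prehilb HH := Hspace_prehilb Om mu a_ge0 c_meas c_gt0.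
Let PM : prehilb (Mspace Om mu c) := Mspace_prehilb Om mu c_meas c_gt0.
Let PL := L2space_prehilb Om.

Let source (g : H) : H * (X -> H) := ((kappa a)^-1 *: g, 0).

Lemma source_in g : hin HH (source g).
Proof. exact: (hin0 PM). Qed.

Lemma hip_source_sqr g : hip HH (source g) (source g) = (kappa a)^-1 * hip L g g.
Proof.
have -> : hip HH (source g) (source g) = hip L g (source g).1.
  exact: (hip_source a_ge0 c_meas c_gt0 g (source_in g)).
exact: (hipZr PL).
Qed.

(** Since [kappa >= 1], the energy estimate can be stated with [|g|^2], free of [kappa]. *)
Lemma hip_source_le g : hip HH (source g) (source g) <= hip L g g.
Proof.
rewrite hip_source_sqr ler_piMl ?(hip_ge0 PL)// invf_le1 /kappa ?lerDl//.
by rewrite ltr_wpDr.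
Qed.

Lemma source_hmeas dT (T : measurableType dT) (g : T -> H) :
  hmeas L g -> hmeas HH (fun t => source (g t)).
Proof.
move=> mg; apply: (hmeas_map (X := L) (A := source) (k := Num.sqrt (kappa a)^-1) PL _ _ _ mg).
- by move=> x _; exact: source_in.
- by move=> x y; rewrite /source scalerBr; congr pair; rewrite /= subr0.
move=> x _; rewrite {1}/hnorm hip_source_sqr sqrtrM// invr_ge0 /kappa addr_ge0//.
Qed.

Lemma energy_ge0 (C : set (H * (X -> H))) U : (0 <= energy C U)%E.
Proof.
by rewrite /energy; case: asboolP => _; rewrite ?leey// lee_fin mulr_ge0 ?sqr_ge0.
Qed.

Lemma Hspace_sqrB U U' : hip HH (U - U') (U - U') =
  kappa a * hnorm L (U.1 - U'.1) ^+ 2 + hnorm (Mspace Om mu c) (U.2 - U'.2) ^+ 2.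
Proof. by rewrite (sqr_hnorm PL) (sqr_hnorm PM). Qed.

End source.

(** With [x], [y], [z] the quantities [int |U_h'|^2], [int |f|^2] and [|grad u_h^0|^2], it turns the
    energy estimate into the bound on the measurable part of the right-hand side. *)
Lemma half_sum_le (R : realFieldType) (x y z : R) : x <= y + z ->
  2^-1 * x + 2^-1 * y <= y + 2^-1 * z.
Proof. lra. Qed.

Lemma integral_support dT (T : measurableType dT) (R : realType)
    (mu : {measure set T -> \bar R}) (D : set T) (m : T -> R) :
  measurable D -> mu.-integrable setT (EFin \o m) -> (forall t, ~ D t -> m t = 0) ->
  (\int[mu]_(t in D) (m t)%:E = (\int[mu]_t m t)%:E)%E.
Proof.
move=> mD mi m0; rewrite -(Rintegral_support _ m0) fineK//.
exact: (integrable_fin_num mD (integrableS measurableT mD (@subsetT _ D) mi)).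
Qed.

Lemma integral_mean dT (T : measurableType dT) (R : realType)
    (mu : {measure set T -> \bar R}) (D : set T) (k : R) (v s : T -> R) :
  measurable D -> mu.-integrable setT (EFin \o v) -> mu.-integrable setT (EFin \o s) ->
  (forall t, ~ D t -> v t = 0) -> (forall t, ~ D t -> s t = 0) ->
  let w t := k * (2^-1 * v t + 2^-1 * s t) in
  mu.-integrable D (EFin \o w) /\
  (\int[mu]_(t in D) (w t)%:E = (k * (2^-1 * \int[mu]_t v t + 2^-1 * \int[mu]_t s t))%:E)%E.
Proof.
move=> mD vi si v0 s0 w.
have vD := Rintegrable_Z mD 2^-1 (integrableS measurableT mD (@subsetT _ D) vi).
have sD := Rintegrable_Z mD 2^-1 (integrableS measurableT mD (@subsetT _ D) si).
have wi := Rintegrable_Z mD k (Rintegrable_D mD vD sD).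
split => //; rewrite -(fineK (integrable_fin_num mD wi)); congr EFin.
rewrite -/(Rintegral mu D w) RintegralZl//; last exact: Rintegrable_D.
rewrite RintegralD// !RintegralZl//.
- by rewrite (Rintegral_support _ v0) (Rintegral_support _ s0).
- exact: (integrableS measurableT mD (@subsetT _ D) si).
- exact: (integrableS measurableT mD (@subsetT _ D) vi).
Qed.

Theorem theorem5p2 (R : realType) (Capp : R) (Capp_gt0 : 0 < Capp) :
  exists2 C : R, 0 < C &
  forall
    (d : nat) (d_gt0 : (0 < d)%N) (Om : polytope R d)
    (Cell : R) (Om_reg : elliptic_regularity Om Cell)
    (T : R) (T_gt0 : 0 < T)
    (dX : measure_display) (X : measurableType dX)
    (mu : {finite_measure set X -> \bar R}) (mu_complete : measure_is_complete mu)
    (a : R) (a_ge0 : 0 <= a)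
    (c : X -> R) (c_gt0 : forall r, 0 < c r) (c_meas : measurable_fun setT c)
    (c_int : (\int[mu]_r (c r)%:E < +oo)%E)
    (K : X -> set (L2 Om))
    (K_closed : forall r, hclosed (L2space Om) (K r))
    (K_convex : forall r, convex_set (K r))
    (K_0 : forall r, K r 0)
    (K_meas : measurable_graph K)
    (h0 : R) (h0_gt0 : 0 < h0)
    (Vh : R -> set (L2 Om)) (Rh : R -> L2 Om -> L2 Om)
    (Vh_sub : forall h, 0 < h <= h0 -> Vh h `<=` @sobH10 R d Om)
    (Vh_findim : forall h, 0 < h <= h0 -> findim_subspace (Vh h))
    (Rh_ritz : forall h, 0 < h <= h0 -> is_ritz (Vh h) (Rh h))
    (Rh_approx2 : forall h, 0 < h <= h0 -> forall v, sobH10 v -> sobH2 v ->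
       hnorm (L2space Om) (v - Rh h v) + h * grad_norm (v - Rh h v)
         <= Capp * h ^+ 2 * H2_norm v)
    (Rh_approx1 : forall h, 0 < h <= h0 -> forall v, sobH10 v ->
       hnorm (L2space Om) (v - Rh h v) <= Capp * h * grad_norm v)
    (f : R -> L2 Om)
    (f_L2 : bochnerL2 (L2space Om) (@lebesgue_measure R) `]0, T[ (cst 1) f)
    (u0 : L2 Om) (w0 : X -> L2 Om)
    (u0_V : sobH10 u0) (w0_M : hin (Mspace Om mu c) w0)
    (U0_K : {ae mu, forall r, K r (u0 - w0 r)})
    (u : R -> L2 Om) (w : R -> X -> L2 Om)
    (U_flow : gradient_flow (Hspace Om mu a c) T (Psi mu a c K)
       (fun t => ((kappa a)^-1 *: f t, 0)) (u0, w0) (fun t => (u t, w t)))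
    (Lapu : R -> L2 Om)
    (Lapu_L2 : bochnerL2 (L2space Om) (@lebesgue_measure R) `]0, T[ (cst 1) Lapu)
    (Lapu_u : {ae @lebesgue_measure R, forall t, t \in `]0, T[ ->
       is_laplacian (u t) (Lapu t)})
    (h : R) (h_range : 0 < h <= h0)
    (uh0 : L2 Om) (wh0 : X -> L2 Om)
    (Uh0_C : constraint mu a c K (uh0, wh0)) (uh0_Vh : Vh h uh0)
    (uh : R -> L2 Om) (wh : R -> X -> L2 Om)
    (Uh_flow : gradient_flow (Hspace Om mu a c) T (Psi_h mu a c K (Vh h))
       (fun t => ((kappa a)^-1 *: f t, 0)) (uh0, wh0) (fun t => (uh t, wh t))),
  let err t := kappa a * hnorm (L2space Om) (u t - uh t) ^+ 2
               + hnorm (Mspace Om mu c) (w t - wh t) ^+ 2 in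
  let err0 := kappa a * hnorm (L2space Om) (u0 - uh0) ^+ 2
              + hnorm (Mspace Om mu c) (w0 - wh0) ^+ 2 in
  exists tmax : R, [/\ tmax \in `[0, T],
    (forall t, t \in `[0, T] -> err t <= err tmax) &
    ((err tmax)%:E
      + \int[@lebesgue_measure R]_(t in `]0%R, T[) (grad_norm (u t - uh t) ^+ 2)%:E
     <= C%:E * (err0%:E
          + (h ^+ 2)%:E * (Msp T (kappa a + Sc mu c) u f uh0) ^+ 2))%E].
Proof.
exists (3 * (1 + Capp ^+ 2)); first by rewrite mulr_gt0// ltr_wpDr ?sqr_ge0.
move=> d d_gt0 Om Cell Om_reg T T_gt0 dX X mu mu_complete a a_ge0 c c_gt0 c_meas c_int.
move=> K K_closed K_convex K_0 K_meas h0 h0_gt0 Vh Rh Vh_sub Vh_findim Rh_ritz.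
move=> Rh_approx2 Rh_approx1 f f_L2 u0 w0 u0_V w0_M U0_K u w U_flow Lapu Lapu_L2 Lapu_u.
move=> h h_range uh0 wh0 Uh0_C uh0_Vh uh wh Uh_flow err err0.
have PH := Hspace_prehilb Om mu a_ge0 c_meas c_gt0.
have PL := L2space_prehilb Om.
have mD : measurable (`]0, T[%classic : set (measurableTypeR R)) by exact: measurable_itv.
(* [g] is a version of [f] that is measurable everywhere and zero off []0, T[]. *)
have [g [mg g0 fg gfin]] := bochnerL2_version PL mD f_L2.
pose F t : L2 Om * (X -> L2 Om) := ((kappa a)^-1 *: g t, 0).
have FF : ae_eq (@lebesgue_measure R) `]0, T[%classic
    (fun t => ((kappa a)^-1 *: f t, 0) : L2 Om * (X -> L2 Om)) F.
  apply: (@filterS _ _ (ae_filter_ringOfSetsType (@lebesgue_measure R))) fg => t + Dt => /(_ Dt).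
  by rewrite /F => ->.
have [V [UV U00 flow]] := gradient_flow_h1 PH T_gt0 U_flow FF.
have [V' [UV' U00' flow']] := gradient_flow_h1 PH T_gt0 Uh_flow FF.
have mF := source_hmeas mu a_ge0 c_meas c_gt0 mg.
have FX t : hin (Hspace Om mu a c) (F t) := source_in mu a c_meas c_gt0 (g t).
have gfin' : (\int[@lebesgue_measure R]_t (hip (L2space Om) (g t) (g t))%:E < +oo)%E.
  apply: le_lt_trans gfin; rewrite [leRHS]integral_mkcond.
  apply: ge0_le_lower_integral => t _; first by rewrite lee_fin (hip_ge0 PL).
  rewrite patchE; case: ifPn => [_|]; first by rewrite /= mul1r.
  by rewrite notin_setE => /g0 ->; rewrite (hip0l PL).
have Ffin : (\int[@lebesgue_measure R]_t (hip (Hspace Om mu a c) (F t) (F t))%:E < +oo)%E.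
  apply: le_lt_trans gfin'; apply: ge0_le_lower_integral => t _; rewrite lee_fin.
    exact: (hip_ge0 PH).
  exact: (hip_source_le mu a_ge0 c_meas c_gt0 (g t)).
have uh0_V : sobH10 uh0 := Vh_sub _ h_range _ uh0_Vh.
(* The initial energy is finite because [(uh0, wh0)] is admissible and [uh0] lies in [Vh h]; it is
   the source of the last term of [Msp]. *)
have Psi0 : Psi_h mu a c K (Vh h) (uh0, wh0) = (2^-1 * grad_norm uh0 ^+ 2)%:E.
  exact: (energy_inE (U := (uh0, wh0)) uh0_V (conj Uh0_C uh0_Vh)).
have est := flow_energy_estimate PH T_gt0 UV' mF Ffin
  (fun x => energy_ge0 _ x) Psi0 Uh0_C.1 U00' flow'.
have iV' := sqr_hnorm_integrable PH (h1V UV') (h1fin UV').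
have ig := sqr_hnorm_integrable PL mg gfin'.
have iF := sqr_hnorm_integrable PH mF Ffin.
have {}est : \int[@lebesgue_measure R]_t hip (Hspace Om mu a c) (V' t) (V' t) <=
    \int[@lebesgue_measure R]_t hip (L2space Om) (g t) (g t) + grad_norm uh0 ^+ 2.
  apply: (le_trans est); apply: lerD; last by rewrite mulVKf// pnatr_eq0.
  apply: le_Rintegral => // t _.
  exact: (hip_source_le mu a_ge0 c_meas c_gt0 (g t)).
have h_gt0 : 0 < h by case/andP: h_range.
have V0' t : ~ `]0, T[%classic t -> hip (Hspace Om mu a c) (V' t) (V' t) = 0.
  by move=> /(h1V0 UV') ->; exact: (hip0l PH (hin0 PH)).
have gg0 t : ~ `]0, T[%classic t -> hip (L2space Om) (g t) (g t) = 0.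
  by move=> /g0 ->; exact: (hip0l PL (hin0 PL)).
have [wi wE] := integral_mean (h ^+ 2) mD iV' ig V0' gg0.
have L1 := Lam_ge1 mu a_ge0 c_gt0.
(* The discrete initial value has finite continuous energy, so the inclusion puts [u t] in H_0^1;
   elliptic regularity then gives H^2. *)
have reg : {ae @lebesgue_measure R, forall t, `]0, T[%classic t -> sobH10 (u t) /\ sobH2 (u t)}.
  apply: (@filterS2 _ _ (ae_filter_ringOfSetsType (@lebesgue_measure R))) flow Lapu_u.
  move=> t flow_t Lapu_t Dt.
  have [u10 _] := energy_domain (flow_t Dt) Uh0_C.1 (Z := (uh0, wh0)) uh0_V Uh0_C.
  by split; [exact: u10|exact: (Om_reg _ _ u10 (Lapu_t Dt)).1].
have ineq : {ae @lebesgue_measure R, forall t, `]0, T[%classic t ->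
    hip (Hspace Om mu a c) (V t - V' t) ((u t, w t) - (uh t, wh t)) +
      grad_norm (u t - uh t) ^+ 2 <=
    h ^+ 2 * (2^-1 * hip (Hspace Om mu a c) (V' t) (V' t) + 2^-1 * hip (L2space Om) (g t) (g t)) +
    h ^+ 2 * (Capp ^+ 2 * (kappa a + Sc mu c) * H2_norm (u t) ^+ 2)}.
  apply: (@filterS3 _ _ (ae_filter_ringOfSetsType (@lebesgue_measure R))) flow flow' reg.
  move=> t flow_t flow'_t reg_t Dt; have [u10 u2] := reg_t Dt.
  have rho_le : sobH10 (u t) -> hnorm (L2space Om) (u t - Rh h (u t)) <= Capp * h ^+ 2 * H2_norm (u t).
    move=> _; apply: le_trans (Rh_approx2 _ h_range _ u10 u2).
    by rewrite lerDl mulr_ge0 ?(ltW h_gt0)//; exact: sqrtr_ge0.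
  exact: (error_inequality (U := (u t, w t)) (Uh := (uh t, wh t)) a_ge0 c_meas c_gt0 c_int
    K_convex (Vh_sub _ h_range) (Vh_findim _ h_range) (Rh_ritz _ h_range) (FX t)
    ((h1V UV).1 t) ((h1V UV').1 t) erefl Uh0_C uh0_Vh h_gt0 rho_le (flow_t Dt) (flow'_t Dt)).
have gr0 t : 0 <= grad_norm (u t - uh t) ^+ 2 by exact: sqr_ge0.
have wt0 t : 0 <= h ^+ 2 * (2^-1 * hip (Hspace Om mu a c) (V' t) (V' t) +
    2^-1 * hip (L2space Om) (g t) (g t)).
  apply: mulr_ge0; first exact: sqr_ge0.
  by apply: addr_ge0; apply: mulr_ge0; rewrite ?invr_ge0//; exact: hip_ge0.
have mt0 t : 0 <= h ^+ 2 * (Capp ^+ 2 * (kappa a + Sc mu c) * H2_norm (u t) ^+ 2).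
  rewrite mulr_ge0 ?sqr_ge0// mulr_ge0 ?sqr_ge0// mulr_ge0 ?sqr_ge0//.
  exact: le_trans L1.
have [s [sT smax bound]] := h1line_error PH T_gt0 UV UV' (U0 := (u0, w0)) w0_M Uh0_C.1
  U00 U00' wi gr0 wt0 mt0 ineq.
have errE t : err t = hip (Hspace Om mu a c) ((u t, w t) - (uh t, wh t)) ((u t, w t) - (uh t, wh t)).
  exact: (esym (Hspace_sqrB mu a c_meas c_gt0 (u t, w t) (uh t, wh t))).
have err0E : err0 = hip (Hspace Om mu a c) ((u0, w0) - (uh0, wh0)) ((u0, w0) - (uh0, wh0)).
  exact: (esym (Hspace_sqrB mu a c_meas c_gt0 (u0, w0) (uh0, wh0))).
exists s; split; first exact: sT.
  by move=> t tT; rewrite (errE t) (errE s); exact: smax.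
rewrite -(errE s) -err0E wE in bound.
have phiE : (\int[@lebesgue_measure R]_(t in `]0%R, T[%classic) (hnorm (L2space Om) (f t) ^+ 2)%:E =
    (\int[@lebesgue_measure R]_t hip (L2space Om) (g t) (g t))%:E)%E.
  apply: etrans (integral_support mD ig gg0).
  apply: ae_eq_lower_integral.
  apply: (@filterS _ _ (ae_filter_ringOfSetsType (@lebesgue_measure R))) fg => t + Dt => /(_ Dt) ->.
  by rewrite (sqr_hnorm PL).
have M_le : (\int[@lebesgue_measure R]_(t in `]0%R, T[%classic)
      (h ^+ 2 * (Capp ^+ 2 * (kappa a + Sc mu c) * H2_norm (u t) ^+ 2))%:E <=
    (h ^+ 2 * (Capp ^+ 2 * (kappa a + Sc mu c)))%:E *
      \int[@lebesgue_measure R]_(t in `]0%R, T[%classic) (H2_enorm (u t)) ^+ 2)%E.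
  have k0 : 0 < h ^+ 2 * (Capp ^+ 2 * (kappa a + Sc mu c)).
    by rewrite !mulr_gt0 ?exprn_gt0//; exact: lt_le_trans L1.
  (* By [reg], the value [+oo] of [H2_enorm] occurs only on a null set of times. *)
  have -> : (\int[@lebesgue_measure R]_(t in `]0%R, T[%classic) (H2_enorm (u t)) ^+ 2 =
      \int[@lebesgue_measure R]_(t in `]0%R, T[%classic) (H2_norm (u t) ^+ 2)%:E)%E.
    apply: ae_eq_lower_integral.
    apply: (@filterS _ _ (ae_filter_ringOfSetsType (@lebesgue_measure R))) reg => t + Dt.
    by move=> /(_ Dt)[_ u2]; rewrite /H2_enorm (asboolT u2) EFin_expe.
  apply: le_trans (lower_integral_Zl_le _ mD k0 _) => [|t _]; last exact: sqr_ge0.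
  apply: ge0_le_lower_integral => t _; first by rewrite lee_fin.
  by rewrite lee_fin !mulrA.
have err00 : 0 <= err0 by rewrite err0E; exact: (hip_ge0 PH).
rewrite /Msp phiE; apply: (final_bound L1 _ err00 _ _ _ bound _ M_le).
- by rewrite exprn_gt0.
- by apply: Rintegral_ge0 => t _; exact: (hip_ge0 PL).
- exact: sqrtr_ge0.
- apply: integral_ge0 => t _; apply: expe_ge0.
  by rewrite /H2_enorm; case: asboolP => _; rewrite ?leey// lee_fin sqrtr_ge0.
rewrite ler_pM2l ?exprn_gt0//.
exact: half_sum_le est.
Qed.
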